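(* Let $X$ be a homogeneous tree of infinite degree with graph distance $\mathrm d$ and distinguished vertex $x_0$. Let $\dot\varphi:\mathbb N_0\to\mathbb C$ and $\tilde\varphi(x,y)=\dot\varphi(\mathrm d(x,y))$. Then $\tilde\varphi$ is a Schur multiplier if and only if there exist $c_\pm\in\mathbb C$ and a complex Borel measure $\mu$ on $\mathbb D=\{z\in\mathbb C:|z|<1\}$ such that $$\dot\varphi(n)=c_++c_-(-1)^n+\int_{\mathbb D}z^n\,d\mu(z)\quad(n\in\mathbb N_0)\quad\text{and}\quad\int_{\mathbb D}\frac{|1-z^2|}{1-|z|^2}\,d|\mu|(z)<\infty.$$ Moreover, for any such representation $\|\tilde\varphi\|_S\leq|c_+|+|c_-|+\int_{\mathbb D}\frac{|1-z^2|}{1-|z|^2}d|\mu|(z)$, and $\mu$ (with $c_\pm$) can be chosen such that $$|c_+|+|c_-|+\int_{\mathbb D}\frac{|1-z^2|}{1-|z|^2}\,d|\mu|(z)\leq\frac8\pi\|\tilde\varphi\|_S.$$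
   Context: A homogeneous tree of infinite degree is a connected cycle-free graph in which every vertex has infinitely many neighbours. A function $\psi:X\times X\to\mathbb C$ is a Schur multiplier if for every bounded operator $A=(a_{x,y})$ on $\ell^2(X)$ the matrix $(\psi(x,y)a_{x,y})$ again defines a bounded operator $M_\psi A$; $\|\psi\|_S:=\|M_\psi\|$. *)

(* Defs.v *)
From HB Require Import structures.
From mathcomp Require Import all_boot all_order all_algebra.
From mathcomp Require Import all_classical all_reals all_analysis.
From mathcomp Require Export complex.
From Stdlib Require List.
Export Order.TTheory GRing.Theory Num.Theory.

Set Implicit Arguments.
Unset Strict Implicit.
Unset Printing Implicit Defensive.

Local Open Scope classical_set_scope.
Local Open Scope ring_scope.
Local Open Scope complex_scope.

Fixpoint walk (X : Type) (adj : X -> X -> Prop) (x : X) (s : seq X) : Prop :=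
  match s with
  | [::] => True
  | y :: s' => adj x y /\ walk adj y s'
  end.

(* A tree: a simple (symmetric, loopless) connected graph without cycles.
   A cycle is a sequence of >= 3 distinct vertices x, s_1, ..., s_k (k >= 2)
   forming a walk with s_k adjacent to x. *)
Definition is_tree (X : Type) (adj : X -> X -> Prop) : Prop :=
  [/\ (forall x y, adj x y -> adj y x),
      (forall x, ~ adj x x),
      (forall x y, exists s, walk adj x s /\ last x s = y) &
      (forall x s, walk adj x s -> List.NoDup (x :: s) -> (2 <= size s)%N ->
         ~ adj (last x s) x)].

Definition homogeneous_tree_infinite_degree (X : Type) (adj : X -> X -> Prop) :=
  is_tree adj /\ forall x, infinite_set [set y | adj x y].

Definition is_graph_distance (X : Type) (adj : X -> X -> Prop)
    (d : X -> X -> nat) : Prop :=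
  forall x y,
    (exists s, [/\ walk adj x s, last x s = y & size s = d x y]) /\
    (forall s, walk adj x s -> last x s = y -> (d x y <= size s)%N).

Definition cabs (R : realType) (z : R[i]) : R :=
  Num.sqrt (complex.Re z ^+ 2 + complex.Im z ^+ 2).

(* A matrix A = (a_{x,y}) defines a bounded operator on l^2(X) of norm *)
(* <= M iff its bilinear form on finitely supported vectors is bounded *)
(* by M: |<u, A v>| <= M ||u|| ||v||.                                 *)

Definition mx_bounded_by (R : realType) (X : Type) (A : X -> X -> R[i])
    (M : R) : Prop :=
  (0 <= M)%R /\
  forall (s : seq X) (u v : X -> R[i]), List.NoDup s ->
    (cabs (\sum_(x <- s) \sum_(y <- s) conjc (u x) * A x y * v y)
     <= M * Num.sqrt (\sum_(x <- s) cabs (u x) ^+ 2)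
          * Num.sqrt (\sum_(y <- s) cabs (v y) ^+ 2))%R.

Definition bounded_mx (R : realType) (X : Type) (A : X -> X -> R[i]) : Prop :=
  exists M, mx_bounded_by A M.

Definition opnorm (R : realType) (X : Type) (A : X -> X -> R[i]) : R :=
  inf [set M | mx_bounded_by A M].

Definition schur_mult (R : realType) (X : Type) (psi A : X -> X -> R[i]) :
  X -> X -> R[i] := fun x y => psi x y * A x y.

Definition is_schur_multiplier (R : realType) (X : Type)
    (psi : X -> X -> R[i]) : Prop :=
  forall A, bounded_mx A -> bounded_mx (schur_mult psi A).

Definition schur_norm (R : realType) (X : Type) (psi : X -> X -> R[i]) : R :=
  sup [set opnorm (schur_mult psi A) | A in
        [set A : X -> X -> R[i] | bounded_mx A /\ (opnorm A <= 1)%R]].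

(* C is identified with R * R (whose product sigma-algebra is the     *)
(* Borel sigma-algebra of C). A complex Borel measure mu on the disc  *)
(* is represented as mu = h . nu, with nu a (positive) measure and    *)
(* h a complex nu-integrable density on the disc; then |mu| = |h| nu. *)

Definition toC (R : realType) (p : R * R) : R[i] := p.1 +i* p.2.

Definition disc (R : realType) : set (R * R) :=
  [set p | (p.1 ^+ 2 + p.2 ^+ 2 < 1)%R].

Definition disc_weight (R : realType) (p : R * R) : R :=
  (cabs (1 - toC p ^+ 2) / (1 - (p.1 ^+ 2 + p.2 ^+ 2)))%R.

Definition complex_measure_density (R : realType)
    (nu : {measure set (R * R)%type -> \bar R}) (h : R * R -> R[i]) : Prop :=
  [/\ measurable_fun (@disc R) (fun p => complex.Re (h p)),
      measurable_fun (@disc R) (fun p => complex.Im (h p)) &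
      nu.-integrable (@disc R) (fun p => (cabs (h p))%:E)].

Definition cintegral (R : realType) (nu : {measure set (R * R)%type -> \bar R})
    (h : R * R -> R[i]) (f : R * R -> R[i]) : R[i] :=
  (\int[nu]_(p in @disc R) complex.Re (f p * h p)) +i*
  (\int[nu]_(p in @disc R) complex.Im (f p * h p)).

Definition weighted_variation (R : realType)
    (nu : {measure set (R * R)%type -> \bar R}) (h : R * R -> R[i]) : \bar R :=
  (\int[nu]_(p in @disc R) (disc_weight p * cabs (h p))%:E)%E.

Definition represents (R : realType) (phi : nat -> R[i]) (cp cm : R[i])
    (nu : {measure set (R * R)%type -> \bar R}) (h : R * R -> R[i]) : Prop :=
  forall n : nat,
    phi n = cp + cm * (-1) ^+ n + cintegral nu h (fun p => toC p ^+ n).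

Definition admissible_rep (R : realType) (phi : nat -> R[i]) (cp cm : R[i])
    (nu : {measure set (R * R)%type -> \bar R}) (h : R * R -> R[i]) : Prop :=
  [/\ complex_measure_density nu h,
      (weighted_variation nu h < +oo)%E &
      represents phi cp cm nu h].

Definition rep_norm (R : realType) (cp cm : R[i])
    (nu : {measure set (R * R)%type -> \bar R}) (h : R * R -> R[i]) : R :=
  (cabs cp + cabs cm + fine (weighted_variation nu h))%R.

(* Main.v *)
(* Sufficiency. Rooting the tree at x0, with p x the parent of x, put
   xi_x = a delta_x + z xi_(p x) with xi_x0 = delta_x0, and define eta likewise
   from b. If a b = 1 - z^2 then <xi_x, eta_y> = z^d(x,y), and taking
   |a|^2 = |b|^2 = |1 - z^2| bounds the squared norms by |1 - z^2|/(1 - |z|^2).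
   Integrating over z bounds the Schur norm of the kernel.

   Necessity. By uniform boundedness, N = ||psi||_S bounds the Schur product of
   psi with every contraction. Let (S u)(x) be q^(-1/2) times the sum of u over the
   first q children of x, and T a contraction on l^2(N) whose diagonal differences
   t_ij = T_ij - T_(i-1)(j-1) have finite support. The matrix
   A_xy = sum_ij t_ij <S^i delta_x, S^j delta_y>, cut off to a finite subtree, is a
   contraction; testing its Schur product with psi on a normalized radial vector
   and letting the depth and q grow yields |sum_ij t_ij phi(i+j)| <= N. Choosing T
   to be a finite block followed by a tridiagonal tail, this produces the limits
   c_+ + c_- and c_+ - c_- of phi along even and odd integers and, for
   h_n = phi(n) - phi(n+2), the inequality
   |sum_ij B_ij h_(i+j)| + |c_+| + |c_-| <= N for all finite contractions B.

   The density of mu with respect to area measure is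
   G(z) (1 - |z|^2)/(1 - z^2), where G(z) = sum_n (n+1)(n+2) h_n zbar^n: its
   moments have second differences h_n and tend to 0, and its weighted variation is
   the L^1 norm of G. With c_i the Taylor coefficients of (1 - t)^(-3/2), one has
   (n+1)(n+2) = 2 sum_(i+j=n) c_i c_j, so for |theta| <= 1 the integral of theta G
   is sum_ij B_ij h_(i+j) with B_ij = 2 c_i c_j int theta zbar^(i+j). Wallis'
   inequality c_i^2 <= (4/pi)(i+1) gives ||B|| <= 8/pi, hence
   ||G||_1 <= (8/pi)(N - |c_+| - |c_-|). *)
Require Import Defs.
From HB Require Import structures.
From mathcomp Require Import all_boot all_order all_algebra.
From mathcomp Require Import all_classical all_reals all_analysis.
From mathcomp Require Import complex measurable_realfun.
From mathcomp Require Import ring lra zify.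
From Stdlib Require List.

Set Implicit Arguments.
Unset Strict Implicit.
Unset Printing Implicit Defensive.

Import numFieldNormedType.Exports.
Local Open Scope classical_set_scope.
Local Open Scope ring_scope.
Local Open Scope complex_scope.

(** * Complex numbers *)

Section ComplexModulus.
Variable R : realType.
Implicit Types z w : R[i].

(** The lifted matrix is a contraction because S is a coisometry on the q-ary subtree: 1 - S* S is a
    projection, and summation by parts along diagonals rewrites sum_ij t_ij <S^i u, S^j v> as sum_ij
    T_ij <(1 - S* S) S^i u, (1 - S* S) S^j v>. The squared norms of the vectors (1 - S* S) S^i u
    telescope to ||u||^2, since S^i u = 0 for large i when u is finitely supported. Infinite degree
    lets phi(i + j) appear instead of a mean over several distances: descendants of a vertex by i
    and by j generations are i + j apart unless their first steps coincide, which has frequency 1/q.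
    The differences h determine phi only up to a 2-periodic sequence, so c_+ and c_- must be charged
    to the same norm budget as h. The tridiagonal tail does this: its diagonal differences sit at
    its corner, where they read one even and one odd value of phi, and its Toeplitz symbol carries
    the phases of c_+ and c_- at once. In the splitting of (n+1)(n+2) the exponent -3/2 is half of
    -3; it gives c_i^2 of order i + 1, which balances the squared norm 1/(i+1) of z^i for normalized
    area measure. *)

Lemma cabsE z : cabs z = ComplexField.Normc.normc z.
Proof. by case: z. Qed.

Lemma cabs_ge0 z : 0 <= cabs z.
Proof. exact: sqrtr_ge0. Qed.

Lemma cabs0 : cabs (0 : R[i]) = 0.
Proof. by rewrite cabsE; exact: ComplexField.Normc.normc0. Qed.

Lemma cabs1 : cabs (1 : R[i]) = 1.
Proof. by rewrite cabsE; exact: ComplexField.Normc.normc1. Qed.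

Lemma cabsM z w : cabs (z * w) = cabs z * cabs w.
Proof. by rewrite !cabsE ComplexField.Normc.normcM. Qed.

Lemma cabsV z : cabs z^-1 = (cabs z)^-1.
Proof. by rewrite !cabsE ComplexField.Normc.normcV. Qed.

Lemma cabs_norm z : (cabs z)%:C = `|z|.
Proof. by rewrite normc_def. Qed.

Lemma cabsD z w : cabs (z + w) <= cabs z + cabs w.
Proof. by rewrite -lecR rmorphD /= !cabs_norm ler_normD. Qed.

Lemma cabsN z : cabs (- z) = cabs z.
Proof. by case: z => a b; rewrite /cabs /= !sqrrN. Qed.

Lemma cabsB z w : cabs (z - w) <= cabs z + cabs w.
Proof. by rewrite (le_trans (cabsD _ _)) // cabsN. Qed.

Lemma cabs_conj z : cabs (conjc z) = cabs z.
Proof. by case: z => a b; rewrite /cabs /= sqrrN. Qed.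

Lemma cabsX z n : cabs (z ^+ n) = cabs z ^+ n.
Proof. by elim: n => [|n IH]; rewrite ?expr0 ?cabs1 // !exprS cabsM IH. Qed.

Lemma sqr_cabs z : cabs z ^+ 2 = complex.Re z ^+ 2 + complex.Im z ^+ 2.
Proof. by rewrite /cabs sqr_sqrtr // addr_ge0 ?sqr_ge0. Qed.

Lemma cabs_eq0 z : cabs z = 0 -> z = 0.
Proof. by rewrite cabsE; exact: ComplexField.Normc.eq0_normc. Qed.

Lemma cabs_gt0 z : z != 0 -> 0 < cabs z.
Proof.
move=> z0; rewrite lt_neqAle cabs_ge0 andbT eq_sym.
by apply: contra z0 => /eqP /cabs_eq0 ->.
Qed.

Lemma cabs_real (r : R) : cabs r%:C = `|r|.
Proof. by rewrite /cabs /= expr0n addr0 sqrtr_sqr. Qed.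

Lemma cabs_sum (I : Type) (s : seq I) (F : I -> R[i]) :
  cabs (\sum_(i <- s) F i) <= \sum_(i <- s) cabs (F i).
Proof.
elim: s => [|i s IH]; first by rewrite !big_nil cabs0.
by rewrite !big_cons (le_trans (cabsD _ _)) // lerD2l.
Qed.

Lemma ReD z w : complex.Re (z + w) = complex.Re z + complex.Re w.
Proof. by case: z; case: w. Qed.

Lemma ImD z w : complex.Im (z + w) = complex.Im z + complex.Im w.
Proof. by case: z; case: w. Qed.

Lemma ReM z w :
  complex.Re (z * w) = complex.Re z * complex.Re w - complex.Im z * complex.Im w.
Proof. by case: z => a b; case: w. Qed.

Lemma ImM z w :
  complex.Im (z * w) = complex.Re z * complex.Im w + complex.Im z * complex.Re w.
Proof. by case: z => a b; case: w => c d /=. Qed.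

Lemma Re_le_cabs z : `|complex.Re z| <= cabs z.
Proof. by rewrite -sqrtr_sqr ler_sqrt ?lerDl ?sqr_ge0 // addr_ge0 ?sqr_ge0. Qed.

Lemma Im_le_cabs z : `|complex.Im z| <= cabs z.
Proof. by rewrite -sqrtr_sqr ler_sqrt ?lerDr ?sqr_ge0 // addr_ge0 ?sqr_ge0. Qed.

Lemma cabs_le_Re_Im z : cabs z <= `|complex.Re z| + `|complex.Im z|.
Proof.
rewrite -(@ler_pXn2r _ 2) ?nnegrE ?cabs_ge0 ?addr_ge0 // sqr_cabs.
rewrite sqrrD !real_normK ?num_real //.
by rewrite -addrA lerD2l lerDr mulrn_wge0 // mulr_ge0.
Qed.

Lemma conjcM z w : conjc (z * w) = conjc z * conjc w.
Proof. exact: rmorphM. Qed.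

Lemma conjcX z n : conjc (z ^+ n) = conjc z ^+ n.
Proof. exact: rmorphXn. Qed.

Lemma conjcB z w : conjc (z - w) = conjc z - conjc w.
Proof. exact: rmorphB. Qed.

Lemma conjc_sum (I : Type) (s : seq I) (F : I -> R[i]) :
  conjc (\sum_(i <- s) F i) = \sum_(i <- s) conjc (F i).
Proof. exact: rmorph_sum. Qed.

Lemma mul_conj z : conjc z * z = (cabs z ^+ 2)%:C.
Proof.
case: z => a b; rewrite sqr_cabs /=; apply/eqP; rewrite eq_complex /=.
by apply/andP; split; apply/eqP; ring.
Qed.

(** By 0^-1 = 0 the phase of 0 is 0, so its modulus is only bounded by 1; in exchange multiplication
    by it always yields the modulus. *)
Definition phase z : R[i] := (cabs z)^-1%:C * conjc z.

Lemma phaseP z : phase z * z = (cabs z)%:C.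
Proof.
rewrite /phase -mulrA mul_conj -rmorphM /=.
have [->|/cabs_gt0 z0] := eqVneq z 0; first by rewrite cabs0 expr0n mulr0.
by rewrite expr2 mulrA mulVf ?mul1r // gt_eqF.
Qed.

Lemma cabs_phase z : cabs (phase z) <= 1.
Proof.
rewrite /phase cabsM cabs_real cabs_conj ger0_norm ?invr_ge0 ?cabs_ge0 //.
have [->|/cabs_gt0 z0] := eqVneq z 0; first by rewrite cabs0 mulr0.
by rewrite mulVf // gt_eqF.
Qed.

Lemma eq_Re_Im z w :
  complex.Re z = complex.Re w -> complex.Im z = complex.Im w -> z = w.
Proof. by case: z => a b; case: w => c d /= -> ->. Qed.

End ComplexModulus.

(** * The Cauchy-Schwarz inequality for finite sums *)

Section CauchySchwarz.
Variable R : realType.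

(** After squaring, the gap is (S b - a T)^2. [S] and [T] stand for norms already formed: this
    serves the induction below and, later, forms that split into two orthogonal parts. *)
Lemma cauchy_schwarz_step (S T a b : R) : 0 <= S -> 0 <= T ->
  S * T + a * b <= Num.sqrt (S ^+ 2 + a ^+ 2) * Num.sqrt (T ^+ 2 + b ^+ 2).
Proof.
move=> S0 T0; rewrite -sqrtrM ?addr_ge0 ?sqr_ge0 //.
apply: le_trans (ler_norm _) _; rewrite -sqrtr_sqr ler_sqrt.
  rewrite -subr_ge0 (_ : _ - _ = (S * b - a * T) ^+ 2) ?sqr_ge0 //; ring.
by rewrite mulr_ge0 // addr_ge0 ?sqr_ge0.
Qed.

Lemma cauchy_schwarz (I : Type) (s : seq I) (a b : I -> R) :
  \sum_(i <- s) a i * b i <=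
  Num.sqrt (\sum_(i <- s) a i ^+ 2) * Num.sqrt (\sum_(i <- s) b i ^+ 2).
Proof.
elim: s => [|i s IH]; first by rewrite !big_nil sqrtr0 mul0r.
rewrite !big_cons addrC (le_trans (lerD IH (lexx _))) //.
have A0 (c : I -> R) : 0 <= \sum_(j <- s) c j ^+ 2.
  by apply: sumr_ge0 => j _; rewrite sqr_ge0.
have := @cauchy_schwarz_step _ _ (a i) (b i) (sqrtr_ge0 (\sum_(j <- s) a j ^+ 2))
  (sqrtr_ge0 (\sum_(j <- s) b j ^+ 2)).
by rewrite !sqr_sqrtr ?A0 // ![_ + _ i ^+ 2]addrC.
Qed.

End CauchySchwarz.

(** * Geometry of trees *)

Section TreeGeometry.
Variables (X : Type) (adj : X -> X -> Prop) (d : X -> X -> nat).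
Hypothesis tree_adj : is_tree adj.
Hypothesis distance_d : is_graph_distance adj d.

Let adjC x y : adj x y -> adj y x.
Proof. by case: tree_adj => + _ _ _; apply. Qed.

Let adj_irr x : ~ adj x x.
Proof. by case: tree_adj => _ + _ _; apply. Qed.

(** [p] is the vertex from which [x] was entered; only an immediate return is excluded. *)
Fixpoint nonbacktracking (p x : X) (s : seq X) : Prop :=
  if s is y :: s' then [/\ adj x y, y <> p & nonbacktracking x y s'] else True.

Lemma nonbacktracking_walk s p x : nonbacktracking p x s -> walk adj x s.
Proof. by elim: s p x => //= y s IH p x [xy _ /IH]. Qed.

Lemma walk_cat x s1 s2 :
  walk adj x (s1 ++ s2) <-> walk adj x s1 /\ walk adj (last x s1) s2.
Proof. by elim: s1 x => /= [x|y s1 IH x]; [tauto|rewrite IH; tauto]. Qed.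

(** By induction the walk is simple from [x] on. If [p] recurred, the vertices from [p] up to the
    recurrence would form a cycle; since the step after [x] avoids [p], it has at least three
    vertices, as acyclicity requires. *)
Lemma nb_NoDup s p x : adj p x -> nonbacktracking p x s -> List.NoDup (p :: x :: s).
Proof.
elim: s p x => [|y s IH] p x px.
  move=> _; constructor; last by constructor; [|constructor].
  by case=> // xp; subst x; exact: adj_irr px.
move=> [xy yp nbs]; have nd := IH _ _ xy nbs; constructor=> //.
move=> [xp|[//|ps]]; first by subst x; exact: adj_irr px.
have [s1 [s2 es]] := List.in_split _ _ ps; subst s.
have [_ _ _ acyclic] := tree_adj.
have /walk_cat[w1 /= [lp _]] := nonbacktracking_walk nbs.
apply: (acyclic p (x :: y :: s1)) => //=.
have pn : ~ List.In p ((x :: y :: s1) ++ s2) by exact: (@List.NoDup_remove_2 _ (x :: y :: s1)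
  s2 p nd).
constructor; first by move=> H; apply: pn;
  exact: (List.in_or_app (x :: y :: s1) s2 p (or_introl H)).
exact: (@List.NoDup_app_remove_r _ _ (p :: s2)).
Qed.

Lemma dist_le x y s : walk adj x s -> last x s = y -> (d x y <= size s)%N.
Proof. by have [_] := distance_d x y; apply. Qed.

Lemma geodesic x y : exists s, [/\ walk adj x s, last x s = y & size s = d x y].
Proof. by have [] := distance_d x y. Qed.

Lemma dist_xx x : d x x = 0%N.
Proof. by have /= := @dist_le x x [::] I erefl; case: (d x x). Qed.

Lemma dist_eq0 x y : d x y = 0%N -> x = y.
Proof. by have [[|z s] [_ /= <-]] := geodesic x y => // <-. Qed.

Lemma dist_adj_le x q y : adj x q -> (d x y <= (d q y).+1)%N.
Proof.
by move=> xq; have [s [ws ls <-]] := geodesic q y; apply: (@dist_le _ _ (q :: s)).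
Qed.

(** A shortest walk that turned back to a vertex just left would leave a remainder shorter than the
    distance from that vertex. *)
Lemma geodesic_nb x y q s : adj x q -> walk adj q s -> last q s = y ->
  size s = (d x y).-1 -> x <> y -> nonbacktracking x q s /\ size s = d q y.
Proof.
move=> + + + + xy; have xy0 : (0 < d x y)%N.
  by rewrite lt0n; apply: contra_notN xy => /eqP/dist_eq0.
elim: s x q xy xy0 => [|z s IH] x q xy xy0 xq ws ls ss.
  by split=> //; rewrite -ls dist_xx.
have dq : size (z :: s) = d q y.
  apply/eqP; rewrite eqn_leq dist_le // andbT ss.
  by have := dist_adj_le y xq; lia.
have [qz wz] := ws.
have zx : z <> x.
  move=> zx; subst z; have := @dist_le x y s wz ls; move: ss => /=; lia.
have qy : q <> y by move=> qy; move: dq; rewrite qy dist_xx.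
split=> //; split=> //; apply: (proj1 (IH q z qy _ qz wz ls _)).
  by rewrite -dq.
by rewrite -dq.
Qed.

Lemma geodesic_step x y : x <> y -> exists q s,
  [/\ adj x q, nonbacktracking x q s, last q s = y, size s = d q y & d x y = (d q y).+1].
Proof.
move=> xy; have [[|q s] [ws ls ss]] := geodesic x y; first by case: xy.
have [xq wq] := ws.
have [|nbs sd] := @geodesic_nb x y q s xq wq ls _ xy; first by rewrite -ss.
exists q, s; split=> //; by rewrite -ss -sd.
Qed.

(** Two walks leaving the edge between [y] and [z] in opposite directions join to one: [s] is
    reversed step by step onto the accumulator [t], and [y'] is the first vertex of the joined walk
    after its start. *)
Lemma nb_reverse_cat s y z t : adj y z -> nonbacktracking y z s -> nonbacktracking z y t ->
  exists y' t', [/\ adj (last z s) y', nonbacktracking (last z s) y' t',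
    last y' t' = last y t & size t' = (size t + size s)%N].
Proof.
elim: s y z t => [|w s IH] y z t yz /=.
  by move=> _ nbt; exists y, t; rewrite addn0; split=> //; apply: adjC.
move=> [zw wy nbs] nbt.
have [|y' [t' [a b c e]]] := IH z w (y :: t) zw nbs.
  by split=> //; [apply: adjC|move=> yw; apply: wy].
by exists y', t'; split=> //; rewrite e /= addSnnS.
Qed.

(** Reversing one walk and continuing with the other gives a nonbacktracking walk, hence a simple
    one, so its two ends differ. *)
Lemma nb_branch x q r s t : adj x q -> adj x r -> q <> r ->
  nonbacktracking x q s -> nonbacktracking x r t -> last q s <> last r t.
Proof.
move=> xq xr qr nbs nbt.
have [|y' [t' [a b c _]]] := @nb_reverse_cat s x q (r :: t) xq nbs.
  by split=> // rq; apply: qr.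
move=> e; have := nb_NoDup a b; rewrite List.NoDup_cons_iff => -[+ _]; apply.
rewrite e -[last r t]/(last x (r :: t)) -c.
elim: t' y' {a b c} => /= [y'|z t' IH y']; first by left.
by right; apply: IH.
Qed.

Lemma last_In (x : X) s : List.In (last x s) (x :: s).
Proof. by elim: s x => /= [x|z s IH x]; [left|right; apply: IH]. Qed.

(** A geodesic to the same endpoint must leave [x] through the same neighbour, by [nb_branch]; the
    claim then follows by induction along the walk. *)
Lemma nb_dist s x q : adj x q -> nonbacktracking x q s -> d x (last q s) = (size s).+1.
Proof.
elim: s x q => [|z s IH] x q xq nbs.
  have [r [t [xr nbt lt st ->]]] : exists r t, [/\ adj x r, nonbacktracking x r t,
      last r t = q, size t = d r q & d x q = (d r q).+1].
    by apply: geodesic_step => xq'; apply: (@adj_irr x); rewrite {2}xq'.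
  congr _.+1; have [->|rq] := pselect (r = q); first exact: dist_xx.
  by case: (nb_branch xr xq rq nbt (I : nonbacktracking x q [::])).
have xl : x <> last q (z :: s).
  have := nb_NoDup xq nbs; rewrite List.NoDup_cons_iff => -[+ _] => xn xl.
  by apply: xn; rewrite xl; exact: last_In.
have [r [t [xr nbt lt st ->]]] := geodesic_step xl.
have rq : r = q.
  by apply: contrapT => qr; exact: (nb_branch xr xq qr nbt nbs).
by subst r; case: nbs => qz _ nbs; rewrite /= IH.
Qed.

Lemma dist_sym x y : d x y = d y x.
Proof.
have [->//|xy] := pselect (x = y).
have [q [s [xq nbs ls ss ->]]] := geodesic_step xy.
have [y' [t' [a b c e]]] := @nb_reverse_cat s x q [::] xq nbs I.
by rewrite ls in a b; have := nb_dist a b; rewrite c e add0n ss => ->.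
Qed.

(** If the geodesic from [x] to [y] does not start with [q], putting [q] in front keeps it
    nonbacktracking, hence geodesic. *)
Lemma dist_neighbor x q y : adj x q ->
  d x y = (d q y).+1 \/ d q y = (d x y).+1.
Proof.
move=> xq; have qx := adjC xq; have [xy|xy] := pselect (x = y).
  by subst y; right; rewrite (@nb_dist [::] q x qx I) dist_xx.
have [r [t [xr nbt lt st dxy]]] := geodesic_step xy.
have [<-|qr] := pselect (r = q); [by left|right].
rewrite -lt; have := @nb_dist (r :: t) q x qx; rewrite /= => ->//.
by rewrite lt dxy st.
Qed.

(** The geodesics from [x] to [y] and [z] start with [q] and [r]; joined at [x] they do not
    backtrack. *)
Lemma dist_through x q r y z : adj x q -> adj x r -> q <> r ->
  d x y = (d q y).+1 -> d x z = (d r z).+1 -> d y z = (d y x + d x z)%N.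
Proof.
move=> xq xr qr dq dr.
have step u w : adj x u -> d x w = (d u w).+1 ->
    exists s, [/\ nonbacktracking x u s, last u s = w & size s = d u w].
  move=> xu du; have xw : x <> w by move=> xw; rewrite xw dist_xx in du.
  have [s [ws ls ss]] := geodesic u w; exists s.
  by split=> //; case: (geodesic_nb xu ws ls _ xw) => //; rewrite ss du.
have [s [nbs ls ss]] := step _ _ xq dq.
have [t [nbt lt st]] := step _ _ xr dr.
have [|y' [t' [a b c e]]] := @nb_reverse_cat s x q (r :: t) xq nbs.
  by split=> // rq; apply: qr.
rewrite ls in a b; have := nb_dist a b; rewrite c /= lt => ->.
by rewrite e dist_sym dq dr ss /= st; lia.
Qed.

Lemma dist_step_uniq x q r y : adj x q -> adj x r ->
  d x y = (d q y).+1 -> d x y = (d r y).+1 -> q = r.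
Proof.
move=> xq xr dq dr; apply: contrapT => qr.
have := dist_through xq xr qr dq dr; rewrite dist_xx dist_sym; lia.
Qed.

Variable x0 : X.
Hypothesis infinite_degree : forall x, infinite_set [set y | adj x y].

Notation depth := (d x0).

Lemma parent_exists : exists p : X -> X,
  forall x, x <> x0 -> adj x (p x) /\ depth x = (depth (p x)).+1.
Proof.
have H x : exists q, x <> x0 -> adj x q /\ depth x = (depth q).+1.
  have [->|xx0] := pselect (x = x0); first by exists x0.
  have [q [s [xq _ _ _ e]]] := geodesic_step xx0.
  by exists q => _; split=> //; rewrite dist_sym e dist_sym.
exists (fun x => projT1 (cid (H x))) => x; exact: (projT2 (cid (H x))).
Qed.

Variable p : X -> X.
Hypothesis parentP : forall x, x <> x0 -> adj x (p x) /\ depth x = (depth (p x)).+1.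

(** If the geodesic to [y] left [x] through another neighbour than its parent, [x] would lie between
    [y] and the root and [y] would be strictly deeper. *)
Lemma dist_parent x y : x <> y -> (depth y <= depth x)%N ->
  d x y = (d (p x) y).+1.
Proof.
move=> xy yx; have xx0 : x <> x0.
  move=> xx0; move: yx; rewrite xx0 dist_xx leqn0 => /eqP /dist_eq0 y0.
  by apply: xy; rewrite xx0.
have [ap dp] := parentP xx0.
have [q [s [xq _ _ _ dq]]] := geodesic_step xy.
have [<-//|pq] := pselect (q = p x).
have := @dist_through x q (p x) y x0 xq ap pq dq.
rewrite !(dist_sym _ x0) => /(_ dp).
have := dist_eq0 (x := x) (y := y); rewrite (dist_sym y x) dq; lia.
Qed.

Lemma children_exist : exists c : X -> nat -> X, forall x,
  [/\ injective (c x),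
      (forall a, adj x (c x a)),
      (forall a, depth (c x a) = (depth x).+1) &
      (forall a, p (c x a) = x)].
Proof.
suff H x : exists c : nat -> X, [/\ injective c, (forall a, adj x (c a)),
      (forall a, depth (c a) = (depth x).+1) & (forall a, p (c a) = x)].
  exists (fun x => projT1 (cid (H x))) => x; exact: (projT2 (cid (H x))).
(* At the root [p x] is an arbitrary vertex; removing it still leaves infinitely many neighbours. *)
have /infiniteP/card_leP[f] : infinite_set ([set y | adj x y] `\` [set p x]).
  by apply: infinite_setD => //; exact: finite_set1.
have dc y : adj x y -> y <> p x -> depth y = (depth x).+1.
  move=> xy ypx; have [e|//] := dist_neighbor x0 xy; last by rewrite !(dist_sym x0).
  have xx0 : x <> x0 by move=> xx0; rewrite xx0 dist_xx in e.
  have [ap dp] := parentP xx0; case: ypx.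
  by apply: (dist_step_uniq xy ap e); rewrite dist_sym dp dist_sym.
pose g a := set_val (f (SigSub (mem_set (I : [set: nat] a)))).
have gP a : adj x (g a) /\ g a <> p x.
  by have := set_valP (f (SigSub (mem_set (I : [set: nat] a)))).
have gd a : depth (g a) = (depth x).+1 by have [? ?] := gP a; exact: dc.
exists g; split=> [a b gab|a|//|a]; last first.
- have ax0 : g a <> x0 by move=> e; have := gd a; rewrite e dist_xx.
  have [ap dp] := parentP ax0; have [xa _] := gP a.
  by apply: (@dist_step_uniq (g a) _ _ x0 ap (adjC xa));
    rewrite !(dist_sym _ x0) // gd.
- by case: (gP a).
- have /val_inj := gab; move=> /(inj (f := f)) H.
  by have := H (mem_set I) (mem_set I); case.
Qed.

Variable c : X -> nat -> X.
Hypothesis adj_child : forall x a, adj x (c x a).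
Hypothesis parent_child : forall x a, p (c x a) = x.
Hypothesis depth_child : forall x a, depth (c x a) = (depth x).+1.

(** [y] is [x] or an ancestor of [x] exactly when depth x = depth y + d x y; the strict inequalities
    exclude this in both orders. *)
Definition incomparable x y :=
  (depth x < depth y + d x y)%N /\ (depth y < depth x + d x y)%N.

Lemma incomparable_sym x y : incomparable x y -> incomparable y x.
Proof. by rewrite /incomparable (dist_sym y x) => -[]. Qed.

(** Were the child closer to [y], the vertex [x] would lie on the geodesic from [y] to the root,
    that is, be an ancestor of [y]. *)
Lemma incomparable_child x y a : incomparable x y ->
  d (c x a) y = (d x y).+1 /\ incomparable (c x a) y.
Proof.
move=> [xy yx]; have H : d (c x a) y = (d x y).+1.
  have [dq|//] := dist_neighbor y (adj_child x a).
  have [xx0|xx0] := pselect (x = x0); first by move: yx; rewrite xx0 dist_xx; lia.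
  have [ap dp] := parentP xx0.
  have cp : c x a <> p x.
    by move=> cp; have := depth_child x a; rewrite cp; lia.
  have := dist_through (adj_child x a) ap cp dq (z := x0).
  by rewrite !(dist_sym _ x0) (dist_sym y x) => /(_ dp); lia.
by split=> //; rewrite /incomparable depth_child H; lia.
Qed.

Lemma incomparable_siblings x a b : c x a <> c x b ->
  d (c x a) (c x b) = 2%N /\ incomparable (c x a) (c x b).
Proof.
move=> ab; have H : d (c x a) (c x b) = 2%N.
  rewrite dist_parent ?depth_child // parent_child.
  by rewrite (@nb_dist [::] x (c x b)).
by split=> //; rewrite /incomparable H !depth_child; lia.
Qed.

End TreeGeometry.

(** * Kernels with a bounded Gram factorization *)

Section BilinearForms.
Variable R : realType.

Definition form (X : Type) (A : X -> X -> R[i]) (s : seq X) (u v : X -> R[i]) :=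
  \sum_(x <- s) \sum_(y <- s) conjc (u x) * A x y * v y.

Definition nrm (X : Type) (s : seq X) (u : X -> R[i]) : R :=
  Num.sqrt (\sum_(x <- s) cabs (u x) ^+ 2).

Lemma sumsq_ge0 (X : Type) (s : seq X) (u : X -> R[i]) :
  0 <= \sum_(x <- s) cabs (u x) ^+ 2.
Proof. by apply: sumr_ge0 => x _; rewrite sqr_ge0. Qed.

Lemma nrm_ge0 (X : Type) (s : seq X) (u : X -> R[i]) : 0 <= nrm s u.
Proof. exact: sqrtr_ge0. Qed.

Lemma sqr_nrm (X : Type) (s : seq X) (u : X -> R[i]) :
  nrm s u ^+ 2 = \sum_(x <- s) cabs (u x) ^+ 2.
Proof. by rewrite sqr_sqrtr // sumsq_ge0. Qed.

Lemma NoDup_uniq (X : eqType) (s : seq X) : List.NoDup s <-> uniq s.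
Proof.
elim: s => [|x s IH] /=; first by split=> // _; constructor.
rewrite List.NoDup_cons_iff IH.
have H t : List.In x t <-> x \in t.
  elim: t => //= y t IHt; rewrite inE IHt; split.
    by move=> [->|->]; rewrite ?eqxx ?orbT.
  by move=> /orP[/eqP ->|->]; [left|right].
rewrite H; split=> [[/negP a b]|/andP[/negP a b]]; last by split.
by rewrite b andbT.
Qed.

Lemma sum_eqr (X : eqType) (W : seq X) (x : X) (F : X -> R[i]) :
  uniq W -> x \in W -> \sum_(w <- W) (x == w)%:R * F w = F x.
Proof.
move=> uW xW; rewrite (bigD1_seq x) //= eqxx mul1r big1 ?addr0 // => w wx.
by rewrite eq_sym (negbTE wx) mul0r.
Qed.

Lemma sum_eqr_real (X : eqType) (W : seq X) (x : X) (F : X -> R) :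
  uniq W -> x \in W -> \sum_(w <- W) (x == w)%:R * F w = F x.
Proof.
move=> uW xW; rewrite (bigD1_seq x) //= eqxx mul1r big1 ?addr0 // => w wx.
by rewrite eq_sym (negbTE wx) mul0r.
Qed.

Lemma eq_sum_In (X : Type) (T : nmodType) (F G : X -> T) (t : seq X) :
  (forall x, List.In x t -> F x = G x) ->
  \sum_(x <- t) F x = \sum_(x <- t) G x.
Proof.
elim: t => [|x t IH] H; first by rewrite !big_nil.
rewrite !big_cons H ?IH //; last by left.
by move=> y yt; apply: H; right.
Qed.

Lemma ler_sum_In (X : Type) (F G : X -> R) (t : seq X) :
  (forall x, List.In x t -> F x <= G x) ->
  \sum_(x <- t) F x <= \sum_(x <- t) G x.
Proof.
elim: t => [|x t IH] H; first by rewrite !big_nil.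
rewrite !big_cons lerD ?IH //; first by apply: H; left.
by move=> y yt; apply: H; right.
Qed.

(* A kernel [psi x y = <f_x, g_y>] turns [A] into the sum over [w] of
   [diag(f_.(w)) A diag(g_.(w))]. *)
Lemma gram_form_le (X Y : Type) (psi A : X -> X -> R[i]) (M C : R) (s : seq X)
  (W : seq Y) (f g : X -> Y -> R[i]) (u v : X -> R[i]) :
  mx_bounded_by A M -> List.NoDup s -> 0 <= C ->
  (forall x y, List.In x s -> List.In y s ->
     psi x y = \sum_(w <- W) f x w * g y w) ->
  (forall x, List.In x s -> \sum_(w <- W) cabs (f x w) ^+ 2 <= C) ->
  (forall x, List.In x s -> \sum_(w <- W) cabs (g x w) ^+ 2 <= C) ->
  cabs (form (schur_mult psi A) s u v) <= C * M * nrm s u * nrm s v.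
Proof.
move=> [M0 bA] nds C0 psiE fC gC.
pose U w x := u x * conjc (f x w); pose V w y := g y w * v y.
have -> : form (schur_mult psi A) s u v = \sum_(w <- W) form A s (U w) (V w).
  rewrite /form [RHS]exchange_big /=; apply: eq_sum_In => x xs.
  rewrite [RHS]exchange_big /=; apply: eq_sum_In => y ys.
  rewrite /schur_mult psiE // mulr_suml mulr_sumr mulr_suml.
  apply: eq_bigr => w _; rewrite /U /V rmorphM /= conjcK; ring.
apply: le_trans (cabs_sum _ _) _.
apply: (@le_trans _ _ (\sum_(w <- W) M * (nrm s (U w) * nrm s (V w)))).
  by apply: ler_sum => w _; rewrite mulrA; exact: bA.
rewrite -mulr_sumr (mulrC C) -!mulrA ler_wpM2l //.
apply: le_trans (cauchy_schwarz _ _ _) _.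
(* Summing over [w] first turns the row bound into C ||a||^2; the f-side and the g-side each
   contribute a factor sqrt C. *)
have bnd (h : X -> Y -> R[i]) (a : X -> R[i]) :
    (forall x, List.In x s -> \sum_(w <- W) cabs (h x w) ^+ 2 <= C) ->
    Num.sqrt (\sum_(w <- W) \sum_(x <- s) cabs (a x) ^+ 2 * cabs (h x w) ^+ 2)
     <= Num.sqrt C * nrm s a.
  move=> hC; rewrite -sqrtrM // ler_sqrt ?mulr_ge0 ?sumsq_ge0 //.
  rewrite exchange_big mulr_sumr /=; apply: ler_sum_In => x xs.
  by rewrite -mulr_sumr mulrC ler_wpM2r ?sqr_ge0 ?hC.
rewrite [leRHS](_ : _ = Num.sqrt C * nrm s u * (Num.sqrt C * nrm s v)); last first.
  by rewrite mulrACA -expr2 sqr_sqrtr.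
apply: ler_pM; rewrite ?sqrtr_ge0 //.
- under eq_bigr do rewrite sqr_nrm.
  under eq_bigr do under eq_bigr do rewrite cabsM exprMn cabs_conj.
  exact: bnd.
- under eq_bigr do rewrite sqr_nrm.
  under eq_bigr do under eq_bigr do rewrite cabsM exprMn mulrC.
  exact: bnd.
Qed.

End BilinearForms.

(** * Vectors along the path to the root that factor the kernel z^d *)

Section SphericalKernel.
Variables (R : realType) (X : eqType) (d : X -> X -> nat) (x0 : X) (p : X -> X).
Hypothesis dist_refl : forall x, d x x = 0%N.
Hypothesis distC : forall x y, d x y = d y x.
Notation depth := (d x0).
Hypothesis depth_parent : forall x, x != x0 -> depth x = (depth (p x)).+1.
Hypothesis dist_par : forall x y, x != y -> (depth y <= depth x)%N ->
  d x y = (d (p x) y).+1.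
Variable z : R[i].

(** [n] is fuel for the recursion along parents; [xi] supplies the depth, so that the root is
    reached exactly when the fuel runs out. *)
Fixpoint xi_rec (a : R[i]) (n : nat) (x w : X) : R[i] :=
  if n is n'.+1 then a * (x == w)%:R + z * xi_rec a n' (p x) w
  else (x == w)%:R.

Definition xi a x := xi_rec a (depth x) x.

Lemma xi_root a w : xi a x0 w = (x0 == w)%:R.
Proof. by rewrite /xi dist_refl. Qed.

Lemma xi_parent a x w : x != x0 -> xi a x w = a * (x == w)%:R + z * xi a (p x) w.
Proof. by move=> /depth_parent dx; rewrite /xi dx. Qed.

(** The vector lives on the path from [x] to the root, where only [x] itself is as deep as [x]. *)
Lemma xi_eq0 a x w : (depth x <= depth w)%N -> w != x -> xi a x w = 0.
Proof.
have [n dx] : exists n, depth x = n by eexists.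
rewrite /xi dx; elim: n x dx => [|n IH] x dx xw wx /=.
  by rewrite eq_sym (negbTE wx).
have xx0 : x != x0 by apply: contra_eqN dx => /eqP ->; rewrite dist_refl.
have dx' := depth_parent xx0.
rewrite eq_sym (negbTE wx) mulr0 add0r IH ?mulr0 //; [lia|lia|].
by apply: contraTneq xw => ->; lia.
Qed.

Variable W : seq X.
Hypothesis uniqW : uniq W.
Hypothesis parentW : forall x, x \in W -> x != x0 -> p x \in W.

(** Peel off the deeper vertex. For x <> y its delta does not meet the other vector, which leaves
    one factor z; for x = y the recursion reads a b + z^2 = 1. The pairing is bilinear, without
    conjugation, so that pure powers of z result. *)
Lemma xi_gram a b x y : a * b = 1 - z ^+ 2 -> x \in W -> y \in W ->
  \sum_(w <- W) xi a x w * xi b y w = z ^+ d x y.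
Proof.
have [n] := ubnP (depth x + depth y)%N.
elim: n a b x y => // n IH a b x y dxy abE xW yW.
(* Exchanging the vertices also exchanges [a] and [b], hence the generalization over both. *)
wlog yx : a b x y dxy abE xW yW / (depth y <= depth x)%N.
  move=> H; have [yx|xy] := leqP (depth y) (depth x); first exact: H.
  rewrite distC -(H b a y x) ?(ltnW xy) //; first by apply: eq_bigr => w _; rewrite mulrC.
    by rewrite addnC.
  by rewrite mulrC.
have [xy|xy] := eqVneq x y.
  subst y; rewrite dist_refl expr0.
  case: (eqVneq x x0) => [xx0|xx0].
    rewrite xx0 in xW *; under eq_bigr => w _ do rewrite !xi_root.
    by rewrite sum_eqr // eqxx.
  have dx := depth_parent xx0; have pW := parentW xW xx0.
  have px_x : x != p x by apply: contra_eqN dx => /eqP <-; lia.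
  transitivity (\sum_(w <- W) ((x == w)%:R * (a * b * (x == w)%:R
     + a * z * xi b (p x) w + b * z * xi a (p x) w)
     + z ^+ 2 * (xi a (p x) w * xi b (p x) w))).
    by apply: eq_bigr => w _; rewrite (xi_parent a w xx0) (xi_parent b w xx0); ring.
  rewrite big_split /= sum_eqr // eqxx -mulr_sumr (IH _ _ (p x) (p x)) //; last lia.
  rewrite !xi_eq0 ?dx // dist_refl abE mulr1n; ring.
have xx0 : x != x0.
  apply: contra_neqN xy => /eqP x_x0; move: yx; rewrite x_x0 dist_refl leqn0 => dy.
  apply/eqP; rewrite eq_sym; apply/negPn/negP => yx0.
  by rewrite (depth_parent yx0) in dy.
have dx := depth_parent xx0; have pW := parentW xW xx0.
transitivity (\sum_(w <- W) ((x == w)%:R * (a * xi b y w)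
     + z * (xi a (p x) w * xi b y w))).
  by apply: eq_bigr => w _; rewrite (xi_parent a w xx0); ring.
rewrite big_split /= sum_eqr // -mulr_sumr (IH _ _ (p x) y) //; last lia.
by rewrite xi_eq0 // mulr0 add0r (dist_par xy yx) exprS.
Qed.

(** The delta at x and z xi_(p x) have disjoint supports, so the squared norms satisfy n_x = |a|^2 +
    |z|^2 n_(p x), starting from 1 at the root; the hypotheses say that this recursion never leads
    above [C]. *)
Lemma xi_norm a x (C : R) : 1 <= C -> cabs a ^+ 2 + cabs z ^+ 2 * C <= C ->
  x \in W -> \sum_(w <- W) cabs (xi a x w) ^+ 2 <= C.
Proof.
move=> C1 aC; have [n] := ubnP (depth x).
elim: n x => // n IH x dxn xW.
case: (eqVneq x x0) => [xx0|xx0].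
  rewrite xx0 in xW *; apply: le_trans C1.
  rewrite (eq_bigr (fun w => (x0 == w)%:R * 1)) ?sum_eqr_real // => w _.
  by rewrite xi_root; case: eqP => _; rewrite ?cabs1 ?cabs0 ?expr1n ?expr0n ?mulr1.
have dx := depth_parent xx0; have pW := parentW xW xx0.
apply: le_trans aC.
rewrite (eq_bigr (fun w => (x == w)%:R * cabs a ^+ 2
   + cabs z ^+ 2 * cabs (xi a (p x) w) ^+ 2)); last first.
  move=> w _; rewrite (xi_parent a w xx0); have [<-|xw] := eqVneq x w.
    rewrite xi_eq0 ?dx //; last by apply: contra_eqN dx => /eqP <-; lia.
    by rewrite mulr1 mulr0 addr0 cabs0 expr0n mulr0 addr0 mul1r.
  by rewrite mulr0 add0r mul0r add0r cabsM exprMn.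
by rewrite big_split /= sum_eqr_real // -mulr_sumr lerD2l ler_wpM2l ?sqr_ge0 ?IH //; lia.
Qed.

End SphericalKernel.

(** * Uniform boundedness of Schur multipliers *)

Section SchurNorm.
Variables (R : realType) (X : Type).
Implicit Types (A B psi : X -> X -> R[i]) (s : seq X) (u v : X -> R[i]) (M : R).

Lemma form_linear A B (c : R[i]) s u v :
  form (fun x y => A x y + c * B x y) s u v = form A s u v + c * form B s u v.
Proof.
rewrite /form mulr_sumr -big_split; apply: eq_bigr => x _ /=.
rewrite mulr_sumr -big_split; apply: eq_bigr => y _ /=; ring.
Qed.

Lemma schur_mult_linear psi A B (c : R[i]) :
  schur_mult psi (fun x y => A x y + c * B x y) =
  (fun x y => schur_mult psi A x y + c * schur_mult psi B x y).
Proof. by apply/funext => x; apply/funext => y; rewrite /schur_mult; ring. Qed.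

(** For fixed finite test vectors, entrywise smallness alone makes the Schur form small; this
    controls the remainder of a series of matrices. *)
Lemma form_schur_entry_le psi A (e : R) s u v :
  (forall x y, cabs (A x y) <= e) ->
  cabs (form (schur_mult psi A) s u v) <=
  e * \sum_(x <- s) \sum_(y <- s) cabs (u x) * cabs (psi x y) * cabs (v y).
Proof.
move=> Ae; apply: le_trans (cabs_sum _ _) _; rewrite mulr_sumr.
apply: ler_sum => x _; apply: le_trans (cabs_sum _ _) _; rewrite mulr_sumr.
apply: ler_sum => y _; rewrite /schur_mult !cabsM cabs_conj.
have := cabs_ge0 (u x); have := cabs_ge0 (v y); have := cabs_ge0 (psi x y).
have := ler_wpM2r (cabs_ge0 (psi x y)) (Ae x y); move=> H a b c.
rewrite [leRHS](_ : _ = cabs (u x) * (e * cabs (psi x y)) * cabs (v y)); last by ring.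
by rewrite ler_wpM2r // ler_wpM2l // mulrC.
Qed.

Lemma mx_bounded_entry A M x y : mx_bounded_by A M -> cabs (A x y) <= M.
Proof.
move=> [M0 bA]; pose e (a b : X) : R[i] := if pselect (a = b) then 1 else 0.
have e1 a : e a a = 1 by rewrite /e; case: pselect.
have [xy|xy] := pselect (x = y).
  subst y; have := bA [:: x] (e x) (e x).
  rewrite !big_seq1 e1 cabs1 expr1n sqrtr1 !mulr1 => H.
  have {H} : cabs (1^*%C * A x x) <= M by apply: H; constructor; [case|constructor].
  by case: (A x x) => a b; rewrite /= !(mul1r, mul0r, oppr0, subr0, addr0, mulr1, mulr0).
have e0 a b : a <> b -> e a b = 0 by rewrite /e; case: pselect.
have := bA [:: x; y] (e x) (e y).
rewrite !big_cons !big_nil !e1 (e0 x y) // (e0 y x); last by move=> /esym.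
rewrite !rmorph0 !rmorph1 cabs1 cabs0 !expr0n /= expr1n !mul0r !mulr0 !addr0 !add0r.
rewrite mul1r !mulr1 sqrtr1 !mulr1; apply; repeat constructor => //.
by case=> // /esym.
Qed.

Lemma mx_bounded_le A M M' : M <= M' -> mx_bounded_by A M -> mx_bounded_by A M'.
Proof.
move=> MM [M0 bA]; split; first exact: le_trans MM.
by move=> s u v nds; apply: le_trans (bA _ _ _ nds) _; rewrite !ler_wpM2r ?sqrtr_ge0.
Qed.

Lemma mx_boundedZ A (c : R[i]) M : mx_bounded_by A M ->
  mx_bounded_by (fun x y => c * A x y) (cabs c * M).
Proof.
move=> [M0 bA]; split; first by rewrite mulr_ge0 ?cabs_ge0.
move=> s u v nds.
rewrite (_ : \sum_(x <- s) _ = c * form A s u v).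
  by rewrite cabsM -!mulrA ler_wpM2l ?cabs_ge0 // mulrA; exact: bA.
rewrite /form mulr_sumr; apply: eq_bigr => x _; rewrite mulr_sumr.
by apply: eq_bigr => y _; ring.
Qed.

Lemma mx_boundedD A B M M' : mx_bounded_by A M -> mx_bounded_by B M' ->
  mx_bounded_by (fun x y => A x y + B x y) (M + M').
Proof.
move=> [M0 bA] [M0' bB]; split; first by rewrite addr_ge0.
move=> s u v nds; rewrite -[X in cabs X]/(form _ s u v).
rewrite (_ : (fun x y => _) = (fun x y => A x y + 1 * B x y)); last first.
  by apply/funext => x; apply/funext => y; rewrite mul1r.
rewrite form_linear mul1r !mulrDl; apply: le_trans (cabsD _ _) _.
by apply: lerD; [exact: bA|exact: bB].
Qed.

Lemma opnorm_le A M : mx_bounded_by A M -> opnorm A <= M.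
Proof. by move=> bA; apply: ge_inf => //; exists 0 => N [N0 _]. Qed.

Lemma opnorm_ge0 A : 0 <= opnorm A.
Proof.
rewrite /opnorm; set S := [set _ | _]; have [nS|/nonemptyPn ->] := pselect (S !=set0).
  by apply: lb_le_inf => // M [].
by rewrite inf0.
Qed.

Lemma opnormP A : bounded_mx A -> mx_bounded_by A (opnorm A).
Proof.
move=> [M0 bA0]; split; first exact: opnorm_ge0.
move=> s u v nds; rewrite -mulrA.
have n0 : 0 <= nrm s u * nrm s v by rewrite mulr_ge0 ?nrm_ge0.
rewrite -/(nrm s u) -/(nrm s v) -/(form A s u v).
have bnd M : mx_bounded_by A M -> cabs (form A s u v) <= M * (nrm s u * nrm s v).
  by move=> [_ /(_ s u v nds)]; rewrite mulrA.
have [e|e] := eqVneq (nrm s u * nrm s v) 0.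
  by have := bnd _ bA0; rewrite e !mulr0.
have p : 0 < nrm s u * nrm s v by rewrite lt_neqAle eq_sym e.
rewrite -ler_pdivrMr //; apply: lb_le_inf; first by exists M0.
by move=> M /bnd; rewrite ler_pdivrMr.
Qed.

(** The limit is the supremum of the left ends a n - e n. The error [e] is carried along because
    later estimates need it explicitly. *)
Lemma nested_limit (a e : nat -> R) : (forall n, 0 <= e n) ->
  (forall n m, (n <= m)%N -> `|a m - a n| <= e n) ->
  exists L, forall n, `|L - a n| <= e n.
Proof.
move=> e0 H; pose S := [set t | exists n, t = a n - e n].
have ubS m : ubound S (a m + e m).
  move=> _ [n ->]; have [nm|/ltnW mn] := leqP n m.
    by have := H _ _ nm; have := e0 m; rewrite ler_norml => ? /andP[? ?]; lra.
  by have := H _ _ mn; have := e0 n; rewrite ler_norml => ? /andP[? ?]; lra.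
have S0 : S !=set0 by exists (a 0%N - e 0%N); exists 0%N.
exists (sup S) => n; rewrite ler_norml; apply/andP; split.
  have : a n - e n <= sup S; last lra.
  by apply: ub_le_sup; [exists (a 0%N + e 0%N)|exists n].
have := ge_sup S0 (@ubS n); lra.
Qed.

Lemma le_limit_inv (x y c : R) : 0 <= c ->
  (forall n : nat, x <= y + c / n.+1%:R) -> x <= y.
Proof.
move=> c0 H; rewrite leNgt; apply/negP => yx.
have d0 : 0 < x - y by rewrite subr_gt0.
have := H (Num.Def.truncn (c / (x - y))).
set n := Num.Def.truncn _; rewrite leNgt => /negP; apply.
have : c / (x - y) < n.+1%:R by rewrite truncnS_gt.
rewrite ltr_pdivrMr // => cn; rewrite -ltrBrDl ltr_pdivrMr ?ltr0Sn //.
by rewrite mulrC.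
Qed.

(** A gliding hump. Without a uniform bound there are contractions A_n and finite test vectors on
    which the Schur product exceeds (n+1)/r_n times the norms. A series of summands r_n A_n with
    suitable signs is again a bounded matrix, yet its Schur product reaches n times the norms on the
    n-th test. *)
Lemma schur_uniform psi : is_schur_multiplier psi ->
  exists N, forall A, mx_bounded_by A 1 -> mx_bounded_by (schur_mult psi A) N.
Proof.
move=> mpsi; apply: contrapT => /forallNP H.
pose T := ((X -> X -> R[i]) * (seq X * ((X -> R[i]) * (X -> R[i]))))%type.
pose f (t : T) B := form (schur_mult psi B) t.2.1 t.2.2.1 t.2.2.2.
pose nn (t : T) := nrm t.2.1 t.2.2.1 * nrm t.2.1 t.2.2.2.
pose P (N : R) (t : T) := [/\ mx_bounded_by t.1 1, List.NoDup t.2.1, 0 < nn t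
  & N * nn t < cabs (f t t.1)].
have exP N : exists t, 0 <= N -> P N t.
  have [N0|N0] := boolP (0 <= N); last by exists (fun _ _ => 0, ([::], (fun=> 0, fun=> 0))).
  have /existsNP[A /not_implyP[bA nonbacktracking]] := H N.
  have [s [u [v [nds lt]]]] : exists s u v, List.NoDup s /\
      N * nrm s u * nrm s v < cabs (form (schur_mult psi A) s u v).
    apply: contrapT => K; apply: nonbacktracking; split=> // s u v nds.
    rewrite leNgt; apply/negP => lt; apply: K.
    by exists s, u, v.
  exists (A, (s, (u, v))) => _; split=> //; last by rewrite /nn mulrA.
  rewrite /nn /= lt_neqAle mulr_ge0 ?nrm_ge0 // andbT.
  apply: contraTneq lt => e; rewrite -leNgt -mulrA -e mulr0.
  have [K [K0 /(_ s u v nds)]] := mpsi A (ex_intro _ 1 bA).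
  by rewrite -mulrA -/(nrm s u) -/(nrm s v) -e mulr0.
pose F N := projT1 (cid (exP N)).
have FP N : 0 <= N -> P N (F N) by rewrite /F; case: cid.
pose C (t : T) := \sum_(x <- t.2.1) \sum_(y <- t.2.1)
  cabs (t.2.2.1 x) * cabs (psi x y) * cabs (t.2.2.2 y).
have C0 t : 0 <= C t.
  by apply: sumr_ge0 => x _; apply: sumr_ge0 => y _; rewrite !mulr_ge0 ?cabs_ge0.
(* One of the signs keeps the new hump uncancelled: the two candidates differ by 2 r f(A), so at
   least one has modulus r |f(A)| or more. *)
pose sg (t : T) B (r : R) : R[i] :=
  if r * cabs (f t t.1) <= cabs (f t B + r%:C * f t t.1) then r%:C else - r%:C.
pose tt n (r : R) := F (n.+1%:R / r).
(* The factor 4 makes the radii decay geometrically; the quotient [C t / nn t] makes all later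
   summands together contribute at most [nn t] to the current test. *)
pose next n (Br : (X -> X -> R[i]) * R) : (X -> X -> R[i]) * R :=
  let t := tt n Br.2 in
  (fun x y => Br.1 x y + sg t Br.1 Br.2 * t.1 x y,
   Br.2 / (4 * (1 + C t / nn t))).
pose st := fix st n := if n is n'.+1 then next n' (st n')
  else ((fun _ _ => 0) : X -> X -> R[i], 1 : R).
pose B n := (st n).1; pose r n := (st n).2; pose t n := tt n (r n).
have BS n : B n.+1 = fun x y => B n x y + sg (t n) (B n) (r n) * (t n).1 x y by [].
have rS n : r n.+1 = r n / (4 * (1 + C (t n) / nn (t n))) by [].
have sgr (t' : T) D (q : R) : 0 < q -> cabs (sg t' D q) = q.
  by move=> q0; rewrite /sg; case: ifP; rewrite ?cabsN cabs_real gtr0_norm.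
have tP n : 0 < r n -> P (n.+1%:R / r n) (t n).
  by move=> r0; apply: FP; rewrite divr_ge0 // ltW.
have q0 n : 0 < r n -> 0 < 1 + C (t n) / nn (t n).
  move=> /tP[_ _ n0 _]; have : 0 <= C (t n) / nn (t n); last by lra.
  by apply: divr_ge0 => //; exact: ltW.
have r0 n : 0 < r n.
  elim: n => [|n IH]; first exact: ltr01.
  by rewrite rS divr_gt0 // mulr_gt0 // q0.
have rC n : 4 * r n.+1 * (nn (t n) + C (t n)) = r n * nn (t n).
  have [_ _ n0 _] := tP _ (r0 n); have qn := q0 _ (r0 n); rewrite rS.
  have -> : nn (t n) + C (t n) = nn (t n) * (1 + C (t n) / nn (t n)).
    by field; rewrite gt_eqF.
  move: qn; set q := 1 + _ => qn; field; by rewrite gt_eqF.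
have rh n : 4 * r n.+1 <= r n.
  have [_ _ n0 _] := tP _ (r0 n); rewrite -(ler_pM2r n0) -rC.
  by rewrite ler_wpM2l ?lerDl // mulr_ge0 // ltW.
have rinv n : r n <= n.+1%:R^-1.
  elim: n => [|n IH]; first by rewrite invr1.
  apply: (@le_trans _ _ (n.+1%:R^-1 / 4)).
    by rewrite ler_pdivlMr // mulrC; exact: le_trans (rh n) IH.
  rewrite -invfM lef_pV2 ?posrE ?mulr_gt0 // ?ltr0Sn //.
  by rewrite -natrM ler_nat; lia.
(* The slack 2 r_n pays for the next summand: 2 - 2 r_n + r_n <= 2 - 2 r_(n+1) because 4 r_(n+1) <=
   r_n. *)
have bB n : mx_bounded_by (B n) (2 - 2 * r n).
  elim: n => [|n IH].
    rewrite [r 0%N]/(1 : R); split; first by rewrite mulr1 subrr.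
    move=> s u v _; rewrite big1 ?cabs0; last first.
      by move=> x _; rewrite big1 // => y _; rewrite mulr0 mul0r.
    by rewrite !mulr_ge0 ?sqrtr_ge0 // mulr1 subrr.
  have [bA _ _ _] := tP _ (r0 n).
  rewrite BS; apply: mx_bounded_le (mx_boundedD IH (mx_boundedZ _ bA)).
  by rewrite sgr // mulr1; have := rh n; have := r0 n; lra.
have BB x y n m : (n <= m)%N -> cabs (B m x y - B n x y) <= 2 * r n - 2 * r m.
  move=> /subnKC <-; elim: (m - n)%N => [|k IH].
    by rewrite addn0 !subrr cabs0.
  have [bA _ _ _] := tP _ (r0 (n + k)%N).
  rewrite addnS BS (_ : _ - _ = (B (n + k)%N x y - B n x y)
     + sg (t (n + k)%N) (B (n + k)%N) (r (n + k)%N) * (t (n + k)%N).1 x y); last by ring.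
  apply: le_trans (cabsD _ _) _; rewrite cabsM sgr //.
  have := mx_bounded_entry x y bA; have := rh (n + k)%N; have := r0 (n + k)%N.
  move=> q1 q2 q3; have := ler_wpM2l (ltW q1) q3; move: q2 IH; lra.
have [Binf BinfP] : exists Bi : X -> X -> R[i],
    forall x y n, cabs (Bi x y - B n x y) <= 4 * r n.
  have H2 x y : exists b : R[i], forall n, cabs (b - B n x y) <= 4 * r n.
    have [||a aP] := @nested_limit (fun n => complex.Re (B n x y)) (fun n => 2 * r n).
    - by move=> n; have := r0 n; lra.
    - move=> n m nm; have := BB x y n m nm; have := Re_le_cabs (B m x y - B n x y).
      by case: (B m x y) => ? ?; case: (B n x y) => ? ? /=; have := r0 m; lra.
    have [||b bP] := @nested_limit (fun n => complex.Im (B n x y)) (fun n => 2 * r n).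
    - by move=> n; have := r0 n; lra.
    - move=> n m nm; have := BB x y n m nm; have := Im_le_cabs (B m x y - B n x y).
      by case: (B m x y) => ? ?; case: (B n x y) => ? ? /=; have := r0 m; lra.
    exists (a +i* b) => n; apply: le_trans (cabs_le_Re_Im _) _.
    by have := aP n; have := bP n; case: (B n x y) => ? ? /=; lra.
  exists (fun x y => projT1 (cid (H2 x y))) => x y; exact: (projT2 (cid (H2 x y))).
have BinfE n : Binf = fun x y => B n x y + 1 * (Binf x y - B n x y).
  by apply/funext => x; apply/funext => y; ring.
have bBinf : mx_bounded_by Binf 2.
  split=> // s u v nds; rewrite -/(form Binf s u v) -/(nrm s u) -/(nrm s v).
  pose S : R := \sum_(x <- s) \sum_(y <- s) cabs (u x) * cabs (1 : R[i]) * cabs (v y).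
  have S0 : 0 <= S.
    by apply: sumr_ge0 => x _; apply: sumr_ge0 => y _; rewrite !mulr_ge0 ?cabs_ge0.
  apply: (@le_limit_inv _ _ (4 * S)) => [|n]; first by rewrite mulr_ge0.
  rewrite (BinfE n) form_linear mul1r; apply: le_trans (cabsD _ _) _.
  apply: lerD.
    have le2 : 2 - 2 * r n <= 2 by have := r0 n; lra.
    by have [_ /(_ s u v nds)] := mx_bounded_le le2 (bB n).
  have := form_schur_entry_le (fun _ _ => 1) s u v (fun x y => BinfP x y n).
  rewrite (_ : schur_mult _ _ = (fun x y => Binf x y - B n x y)); last first.
    by apply/funext => x; apply/funext => y; rewrite /schur_mult mul1r.
  move=> /le_trans; apply; rewrite -/S (mulrAC 4 S) ler_wpM2r // ler_wpM2l //.
have [K [K0 bK]] := mpsi _ (ex_intro _ 2 bBinf).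
have Kn n : n%:R <= K.
  have [bA nds n0 lt] := tP _ (r0 n).
  have := bK _ (t n).2.2.1 (t n).2.2.2 nds.
  rewrite -/(form _ _ _ _) -/(nrm _ _) -/(nrm _ _) -mulrA -/(nn (t n)) => up.
  rewrite -(ler_pM2r n0); apply: le_trans up.
  rewrite (BinfE n.+1) schur_mult_linear form_linear mul1r.
  have e1 := form_schur_entry_le psi (t n).2.1 (t n).2.2.1 (t n).2.2.2
     (fun x y => BinfP x y n.+1).
  have e2 : n.+1%:R * nn (t n) <= cabs (f (t n) (B n.+1)).
    rewrite BS /f schur_mult_linear form_linear.
    apply: (@le_trans _ _ (r n * cabs (f (t n) (t n).1))).
      by rewrite [leRHS]mulrC -ler_pdivrMr // mulrAC; exact: ltW.
    rewrite /sg; case: ifP => // /negbT; rewrite -ltNge => lt2.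
    set a := f (t n) (B n) in lt2 *; set b := f (t n) (t n).1 in lt2 *.
    rewrite -/(f _ _) -/(f _ _) -/a -/b.
    have := cabsB (a + (r n)%:C * b) (a + - (r n)%:C * b).
    rewrite (_ : _ - _ = (2 * r n)%:C * b); last by rewrite rmorphM /= rmorph_nat; ring.
    rewrite cabsM cabs_real gtr0_norm ?mulr_gt0 //.
    by move: lt2; lra.
  have e3 : 4 * r n.+1 * C (t n) <= nn (t n).
    have r1 : r n <= 1.
      by apply: le_trans (rinv n) _; rewrite invf_le1 ?ltr0Sn // ler1n.
    have a := ler_wpM2r (ltW n0) r1; rewrite mul1r in a.
    have b : 0 <= 4 * r n.+1 * nn (t n) by apply: mulr_ge0; [apply: mulr_ge0 => //|];
      exact: ltW.
    by have := rC n; rewrite mulrDr; lra.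
  have := cabsB (form (schur_mult psi (B n.+1)) (t n).2.1 (t n).2.2.1 (t n).2.2.2 +
     form (schur_mult psi (fun x y => Binf x y - B n.+1 x y)) (t n).2.1 (t n).2.2.1 (t n).2.2.2)
    (form (schur_mult psi (fun x y => Binf x y - B n.+1 x y)) (t n).2.1 (t n).2.2.1 (t
      n).2.2.2).
  rewrite addrK; move: e1 e2; rewrite -/(C (t n)) /f -(natr1 n) mulrDl mul1r.
  move: e3; lra.
have := Kn (Num.Def.truncn K).+1; rewrite leNgt truncnS_gt //.
Qed.

(** A supremum is an upper bound only for a set bounded above; [schur_uniform] supplies that
    bound. *)
Lemma schur_norm_bound psi A : is_schur_multiplier psi -> mx_bounded_by A 1 ->
  mx_bounded_by (schur_mult psi A) (schur_norm psi).
Proof.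
move=> mpsi bA; have [N NP] := schur_uniform mpsi.
have b2 := mpsi A (ex_intro _ 1 bA).
apply: mx_bounded_le (opnormP b2); apply: ub_le_sup.
  exists N => _ [D [bD D1] <-]; apply: opnorm_le; apply: NP.
  exact: mx_bounded_le D1 (opnormP bD).
by exists A => //; split; [exists 1|exact: opnorm_le].
Qed.

Lemma schur_norm_le psi (K : R) : 0 <= K ->
  (forall A M, mx_bounded_by A M -> mx_bounded_by (schur_mult psi A) (K * M)) ->
  is_schur_multiplier psi /\ schur_norm psi <= K.
Proof.
move=> K0 H; split.
  by move=> A [M bA]; exists (K * M); apply: H.
apply: ge_sup.
  exists (opnorm (schur_mult psi (fun _ _ => 0))), (fun _ _ => 0) => //.
  have b0 : mx_bounded_by (fun _ _ : X => 0 : R[i]) 0.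
    split=> // s u v _; rewrite big1 ?cabs0 ?mul0r //.
    by move=> x _; rewrite big1 // => y _; rewrite mulr0 mul0r.
  by split; [exists 0|apply: le_trans (opnorm_le b0) _].
move=> _ [D [bD D1] <-]; apply: le_trans (opnorm_le (H _ _ (opnormP bD))) _.
by rewrite ler_piMr.
Qed.

End SchurNorm.

(** * Transfer of matrices from the half-line to the tree *)

Section Transfer.
Variables (R : realType) (X : eqType) (d : X -> X -> nat) (x0 : X).
Variables (p : X -> X) (c : X -> nat -> X) (inc : X -> X -> Prop).
Notation depth := (d x0).
Hypothesis dist_refl : forall x, d x x = 0%N.
Hypothesis depth_child : forall x a, depth (c x a) = (depth x).+1.
Hypothesis parent_child : forall x a, p (c x a) = x.
Hypothesis child_inj : forall x, injective (c x).
Hypothesis dist_childl : forall x y a, (depth y <= depth x)%N ->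
  d (c x a) y = (d x y).+1.
Hypothesis dist_childr : forall x y b, (depth x <= depth y)%N ->
  d x (c y b) = (d x y).+1.
Hypothesis inc_childl : forall x y a, inc x y ->
  d (c x a) y = (d x y).+1 /\ inc (c x a) y.
Hypothesis inc_childr : forall x y b, inc x y ->
  d x (c y b) = (d x y).+1 /\ inc x (c y b).
Hypothesis inc_siblings : forall x a b, a != b ->
  d (c x a) (c x b) = 2%N /\ inc (c x a) (c x b).

(** * The lifted matrix on a finite q-ary subtree *)

Section FiniteSubtree.
Variable Q : nat.
Notation q := Q.+1.

Fixpoint level k : seq X :=
  if k is k'.+1 then [seq c x a | x <- level k', a <- iota 0 q] else [:: x0].

Definition ball_ D := flatten [seq level k | k <- iota 0 D.+1].

Lemma levelS k : level k.+1 = [seq c x a | x <- level k, a <- iota 0 q].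
Proof. by []. Qed.

Lemma ballS D : ball_ D.+1 = ball_ D ++ level D.+1.
Proof.
rewrite /ball_ -(addn1 D.+1) iotaD map_cat flatten_cat; congr (_ ++ _).
exact: cats0.
Qed.

Lemma sum_const (V : pzSemiRingType) (t : V) : \sum_(0 <= a < q) t = q%:R * t.
Proof. by rewrite sumr_const_nat subn0 mulr_natl. Qed.

Lemma sum_level (T : nmodType) k (F : X -> T) :
  \sum_(x <- level k.+1) F x = \sum_(x <- level k) \sum_(0 <= a < q) F (c x a).
Proof. by rewrite levelS big_allpairs_dep /index_iota subn0. Qed.

Lemma sum_ball (T : nmodType) D (F : X -> T) :
  \sum_(x <- ball_ D) F x = \sum_(0 <= k < D.+1) \sum_(x <- level k) F x.
Proof. by rewrite /ball_ big_flatten big_map /index_iota subn0. Qed.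

Lemma level_depth k x : x \in level k -> depth x = k.
Proof.
elim: k x => [|k IH] x; first by rewrite inE => /eqP ->; rewrite dist_refl.
by move=> /allpairsP[[y a] [/= yk _ ->]]; rewrite depth_child (IH y).
Qed.

Lemma child_level k x a : x \in level k -> (a < q)%N -> c x a \in level k.+1.
Proof. by move=> xk aq; apply/allpairsP; exists (x, a); rewrite mem_iota. Qed.

Lemma uniq_level k : uniq (level k).
Proof.
elim: k => // k IH; rewrite levelS; apply: allpairs_uniq_dep => // [x _|];
  first exact: iota_uniq.
move=> [x a] [y b] _ _ /= e.
have xy : x = y by rewrite -(parent_child x a) e parent_child.
by subst y; rewrite (child_inj e).
Qed.

Lemma mem_ball k D x : x \in level k -> (x \in ball_ D) = (k <= D)%N.
Proof.
move=> xk; apply/flatten_mapP/idP => [[l]|kD].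
  rewrite mem_iota add0n => /andP[_ lD] xl.
  by rewrite -(level_depth xk) (level_depth xl).
by exists k; rewrite // mem_iota add0n ltnS kD.
Qed.

Lemma uniq_ball D : uniq (ball_ D).
Proof.
elim: D => // D IH; rewrite ballS cat_uniq IH uniq_level andbT.
by apply/hasPn => x xD; rewrite (mem_ball _ xD) ltnn.
Qed.

(** The normalization for which [child_sum] is a coisometry S; its adjoint gives each child [kappa]
    times the value at the parent. *)
Definition kappa : R[i] := (Num.sqrt q%:R)^-1%:C.

Lemma kappa_conj : conjc kappa = kappa.
Proof. by rewrite /kappa /= oppr0. Qed.

Lemma kappa_sqr : q%:R * (kappa * kappa) = 1.
Proof.
rewrite /kappa -rmorphM /= -invfM -expr2 sqr_sqrtr ?ler0n //.
by rewrite -(rmorph_nat (real_complex R)) -rmorphM /= divff // pnatr_eq0.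
Qed.

Lemma cabs_kappa_sqr : cabs kappa ^+ 2 = q%:R^-1.
Proof.
rewrite /kappa cabs_real ger0_norm ?invr_ge0 ?sqrtr_ge0 //.
by rewrite exprVn sqr_sqrtr ?ler0n.
Qed.

Definition child_sum (u : X -> R[i]) : X -> R[i] :=
  fun x => kappa * \sum_(0 <= a < q) u (c x a).

Definition shift i (u : X -> R[i]) := iter i child_sum u.

Lemma shiftS i u x : shift i.+1 u x = kappa * \sum_(0 <= a < q) shift i u (c x a).
Proof. by []. Qed.

Lemma eq_shift i u v : u =1 v -> shift i u =1 shift i v.
Proof. by move=> uv; have -> : u = v by apply/funext. Qed.

Lemma shift_sum (I : Type) (s : seq I) (al : I -> R[i]) (F : I -> X -> R[i]) i x :
  shift i (fun w => \sum_(k <- s) al k * F k w) x =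
  \sum_(k <- s) al k * shift i (F k) x.
Proof.
elim: i x => [|i IH] x //; rewrite shiftS.
under eq_bigr do rewrite IH.
rewrite exchange_big /= mulr_sumr; apply: eq_bigr => k _.
by rewrite -mulr_sumr mulrCA.
Qed.

Lemma shift_conj i u x : conjc (shift i u x) = shift i (fun w => conjc (u w)) x.
Proof.
elim: i x => [|i IH] x //; rewrite !shiftS conjcM kappa_conj; congr (_ * _).
by rewrite conjc_sum; apply: eq_bigr => a _; rewrite IH.
Qed.

Lemma shift_eq0 D u i k x : (forall w, w \notin ball_ D -> u w = 0) ->
  x \in level k -> (D < k + i)%N -> shift i u x = 0.
Proof.
move=> u0; elim: i k x => [|i IH] k x xk Dk.
  by apply: u0; rewrite (mem_ball _ xk) -ltnNge -(addn0 k).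
rewrite shiftS big_nat big1 ?mulr0 // => a /andP[_ aq].
by apply: (IH k.+1); [exact: child_level|rewrite addSnnS].
Qed.

Section Core.
Variable D : nat.
Variables u v : X -> R[i].
Hypothesis u_supp : forall w, w \notin ball_ D -> u w = 0.
Hypothesis v_supp : forall w, w \notin ball_ D -> v w = 0.

Definition corr (u v : X -> R[i]) i j :=
  \sum_(w <- ball_ D) conjc (shift i u w) * shift j v w.

(** The value at [x] of (1 - S* S) S^i u: the part orthogonal to functions that vanish at the root
    and are constant on siblings. *)
Definition innov (u : X -> R[i]) x i : R[i] :=
  shift i u x - (if x == x0 then 0 else kappa * shift i.+1 u (p x)).

Lemma child_neq_root x a : (c x a == x0) = false.
Proof. by apply/negP => /eqP e; have := depth_child x a; rewrite e dist_refl. Qed.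

Lemma corr_diff i j :
  corr u v i j - corr u v i.+1 j.+1 =
  \sum_(x <- ball_ D) conjc (innov u x i) * innov v x j.
Proof.
(* On level [D] the shifted vector vanishes, so the sum for i+1, j+1 stops one level earlier and
   each remaining vertex can be paired with its children. *)
have last0 : \sum_(w <- level D) conjc (shift i.+1 u w) * shift j.+1 v w = 0.
  rewrite big_seq big1 // => w wD.
  by rewrite (shift_eq0 u_supp wD) ?addnS ?ltnS ?leq_addr // conjc0 mul0r.
rewrite /corr !sum_ball big_nat_recl // [X in _ - X]big_nat_recr //= last0 addr0.
rewrite [RHS]big_nat_recl //= !big_seq1 /innov eqxx !subr0 -addrA; congr (_ + _).
rewrite -sumrB; apply: eq_bigr => k _.
rewrite !(sum_level k) -sumrB; apply: eq_bigr => w _.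
under [RHS]eq_bigr do rewrite child_neq_root parent_child.
rewrite !shiftS.
set f := fun a => shift i u (c w a); set g := fun a => shift j v (c w a).
set Sf := \sum_(0 <= a < q) f a; set Sg := \sum_(0 <= a < q) g a.
have -> : child_sum (shift i u) w = kappa * Sf by [].
have -> : child_sum (shift j v) w = kappa * Sg by [].
(* Of the four terms of the product of projections, the last cancels one mixed term after summation
   over siblings, since q kappa^2 = 1. *)
rewrite [RHS](eq_bigr (fun a => conjc (f a) * g a - conjc (f a) * (kappa * (kappa * Sg))
  - (kappa * kappa) * conjc Sf * g a + (kappa * kappa) * conjc Sf * ((kappa * kappa) * Sg)));
    last first.
  by move=> a _; rewrite -/(f a) -/(g a) conjcB !conjcM kappa_conj; ring.
rewrite big_split /= !sumrB -mulr_suml -!mulr_sumr -conjc_sum -/Sf -/Sg.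
rewrite sum_const !conjcM kappa_conj.
have e : kappa * kappa * conjc Sf * (kappa * kappa * (q%:R * Sg)) =
  kappa * kappa * conjc Sf * Sg.
  have kq := kappa_sqr; move: kq; set Q' : R[i] := q%:R => kq.
  by rewrite -[RHS](mul1r (kappa * kappa * conjc Sf * Sg)) -[X in _ = X * _]kq; ring.
rewrite e; set S := \sum_(0 <= a < q) conjc (f a) * g a.
rewrite -[X in X - _ = _]/S; ring.
Qed.

Variable T : nat -> nat -> R[i].

Definition diagonal_diff (T : nat -> nat -> R[i]) i j : R[i] :=
  T i j - (if (i, j) is (i'.+1, j'.+1) then T i' j' else 0).

Lemma corr_eq0 i j : (D < i)%N || (D < j)%N -> corr u v i j = 0.
Proof.
move=> ij; rewrite /corr sum_ball big1 // => k _; rewrite big_seq big1 // => w wk.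
case/orP: ij => h.
  by rewrite (shift_eq0 u_supp wk) ?conjc0 ?mul0r //; lia.
by rewrite (shift_eq0 v_supp wk) ?mulr0 //; lia.
Qed.

(** Summation by parts along diagonals moves the difference from [T] to the correlations, where
    [corr_diff] applies; boundary terms vanish because correlations are 0 past [D]. *)
Lemma diagonal_diff_corr K : (D < K)%N ->
  \sum_(0 <= i < K) \sum_(0 <= j < K) diagonal_diff T i j * corr u v i j =
  \sum_(x <- ball_ D) form T (iota 0 K) (innov u x) (innov v x).
Proof.
move=> DK.
transitivity (\sum_(0 <= i < K) \sum_(0 <= j < K) T i j * (corr u v i j - corr u v i.+1 j.+1)).
  have -> : \sum_(0 <= i < K) \sum_(0 <= j < K) diagonal_diff T i j * corr u v i j =
    \sum_(0 <= i < K) \sum_(0 <= j < K) T i j * corr u v i j -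
    \sum_(0 <= i < K) \sum_(0 <= j < K)
      (if (i, j) is (i'.+1, j'.+1) then T i' j' else 0) * corr u v i j.
    rewrite -sumrB; apply: eq_bigr => i _; rewrite -sumrB; apply: eq_bigr => j _.
    by rewrite mulrBl.
  have -> : \sum_(0 <= i < K) \sum_(0 <= j < K)
      (if (i, j) is (i'.+1, j'.+1) then T i' j' else 0) * corr u v i j =
     \sum_(0 <= i < K) \sum_(0 <= j < K) T i j * corr u v i.+1 j.+1.
    case: K DK => // K DK; rewrite big_nat_recl // big1 ?add0r; last by move=> j _;
      rewrite mul0r.
    rewrite [RHS]big_nat_recr //= [X in _ + X]big1 ?addr0; last first.
      by move=> j _; rewrite corr_eq0 ?mulr0 // DK.
    apply: eq_bigr => i _; rewrite big_nat_recl //= mul0r add0r.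
    by rewrite [RHS]big_nat_recr //= corr_eq0 ?mulr0 ?addr0 // DK orbT.
  by rewrite -sumrB; apply: eq_bigr => i _; rewrite -sumrB; apply: eq_bigr => j _;
    rewrite mulrBr.
rewrite /form [RHS]exchange_big /= /index_iota subn0; apply: eq_bigr => i _.
rewrite [RHS]exchange_big /=; apply: eq_bigr => j _.
rewrite corr_diff mulr_sumr; apply: eq_bigr => x _; ring.
Qed.

End Core.

(** The inner sums are ||S^i u||^2 - ||S^(i+1) u||^2; they telescope to ||u||^2. So u -> ((1 - S* S)
    S^i u)_i is isometric. *)
Lemma sum_innov D u K : (forall w, w \notin ball_ D -> u w = 0) -> (D < K)%N ->
  \sum_(x <- ball_ D) \sum_(0 <= i < K) cabs (innov u x i) ^+ 2 =
  \sum_(x <- ball_ D) cabs (u x) ^+ 2.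
Proof.
move=> u0 DK; rewrite exchange_big /=; apply: (@complexI R).
rewrite !rmorph_sum /=.
transitivity (- \sum_(0 <= i < K) (corr D u u i.+1 i.+1 - corr D u u i i)).
  rewrite -sumrN; apply: eq_bigr => i _; rewrite opprB corr_diff // rmorph_sum.
  by apply: eq_bigr => x _; rewrite mul_conj.
rewrite telescope_sumr // (corr_eq0 u0 u0) ?DK // sub0r opprK.
by apply: eq_bigr => x _; rewrite mul_conj.
Qed.

(** Points outside the ball get the zero vector, so that the lifted matrix is defined on the whole
    tree and acts only in the ball. *)
Definition delta D (x w : X) : R[i] := (x == w)%:R * (w \in ball_ D)%:R.

Definition cut D (s : seq X) (u : X -> R[i]) w := \sum_(x <- s) u x * delta D x w.

Definition lift_matrix (T : nat -> nat -> R[i]) K D x y : R[i] :=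
  \sum_(0 <= i < K) \sum_(0 <= j < K) diagonal_diff T i j *
    \sum_(w <- ball_ D) shift i (delta D x) w * shift j (delta D y) w.

Lemma exchange_big4 (V : nmodType) (I J : Type) (r1 : seq I) (r2 : seq J)
  (s1 s2 : seq X) (F : I -> J -> X -> X -> V) :
  \sum_(i <- r1) \sum_(j <- r2) \sum_(x <- s1) \sum_(y <- s2) F i j x y =
  \sum_(x <- s1) \sum_(y <- s2) \sum_(i <- r1) \sum_(j <- r2) F i j x y.
Proof.
transitivity (\sum_(i <- r1) \sum_(x <- s1) \sum_(j <- r2) \sum_(y <- s2) F i j x y).
  by apply: eq_bigr => i _; rewrite exchange_big.
rewrite exchange_big; apply: eq_bigr => x _ /=.
rewrite [RHS]exchange_big /=; apply: eq_bigr => i _; exact: exchange_big.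
Qed.

Lemma form_lift_matrix (psi : X -> X -> R[i]) T K D s u v :
  form (schur_mult psi (lift_matrix T K D)) s u v =
  \sum_(0 <= i < K) \sum_(0 <= j < K) diagonal_diff T i j * \sum_(w <- ball_ D)
    \sum_(x <- s) \sum_(y <- s) conjc (u x) * psi x y * v y *
      (shift i (delta D x) w * shift j (delta D y) w).
Proof.
transitivity (\sum_(0 <= i < K) \sum_(0 <= j < K) \sum_(x <- s) \sum_(y <- s)
   diagonal_diff T i j * (conjc (u x) * psi x y * v y *
    \sum_(w <- ball_ D) shift i (delta D x) w * shift j (delta D y) w)); last first.
  apply: eq_bigr => i _; apply: eq_bigr => j _.
  rewrite [X in _ = _ * X]exchange_big [RHS]mulr_sumr /=; apply: eq_bigr => x _.
  rewrite [X in _ = _ * X]exchange_big [RHS]mulr_sumr /=; apply: eq_bigr => y _.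
  by congr (_ * _); exact: mulr_sumr.
rewrite exchange_big4; apply: eq_bigr => x _; apply: eq_bigr => y _.
rewrite /schur_mult /lift_matrix !mulr_sumr mulr_suml; apply: eq_bigr => i _.
rewrite !mulr_sumr mulr_suml; apply: eq_bigr => j _; ring.
Qed.

Lemma delta_conj D x w : conjc (delta D x w) = delta D x w.
Proof. by rewrite /delta conjcM !conjc_nat. Qed.

Lemma form_lift_matrix_corr T K D s u v : form (lift_matrix T K D) s u v =
  \sum_(0 <= i < K) \sum_(0 <= j < K) diagonal_diff T i j *
    corr D (cut D s u) (cut D s v) i j.
Proof.
transitivity (form (schur_mult (fun _ _ => 1) (lift_matrix T K D)) s u v).
  by apply: eq_bigr => x _; apply: eq_bigr => y _; rewrite /schur_mult mul1r.
rewrite form_lift_matrix; apply: eq_bigr => i _; apply: eq_bigr => j _; congr (_ * _).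
apply: eq_bigr => w _; rewrite shift_conj /cut.
rewrite (eq_shift _ (_ : _ =1 fun w' => \sum_(x <- s) conjc (u x) * delta D x w')); last first.
  by move=> w'; rewrite conjc_sum; apply: eq_bigr => x _; rewrite conjcM delta_conj.
rewrite !shift_sum big_distrlr /=.
apply: eq_bigr => x _; apply: eq_bigr => y _; ring.
Qed.

Lemma cut_supp D s u w : w \notin ball_ D -> cut D s u w = 0.
Proof. by move=> wD; rewrite /cut big1 // => x _; rewrite /delta (negbTE wD) !mulr0. Qed.

Lemma cut_ball D s u w : w \in ball_ D -> uniq s ->
  cut D s u w = if w \in s then u w else 0.
Proof.
move=> wD us; rewrite /cut /delta wD.
under eq_bigr do rewrite mulr1 mulrC eq_sym.
case: ifP => ws; first exact: sum_eqr.
rewrite big_seq big1 // => x xs; case: eqP => [e|_]; last by rewrite mul0r.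
by rewrite -e ws in xs.
Qed.

Lemma sum_cut_le D s u : uniq s ->
  \sum_(w <- ball_ D) cabs (cut D s u w) ^+ 2 <= \sum_(x <- s) cabs (u x) ^+ 2.
Proof.
move=> us; rewrite (eq_big_seq (fun w => \sum_(x <- s) (w == x)%:R * cabs (u x) ^+ 2)).
  rewrite exchange_big /=; apply: ler_sum => x _; rewrite -mulr_suml.
  apply: ler_piMl; first exact: sqr_ge0.
  have [xD|xD] := boolP (x \in ball_ D).
    under eq_bigr do rewrite -[_%:R]mulr1 eq_sym.
    by rewrite sum_eqr_real // uniq_ball.
  rewrite big_seq big1 // => w wD; case: eqP => // wx.
  by rewrite wx (negbTE xD) in wD.
move=> w wD; rewrite cut_ball //; case: ifP => ws; first by rewrite sum_eqr_real.
rewrite cabs0 expr0n big_seq big1 // => x xs; case: eqP => [e|_]; last by rewrite mul0r.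
by rewrite e xs in ws.
Qed.

Lemma sum_symb_widen (V : nmodType) K K' (F : nat -> nat -> V) : (K <= K')%N ->
  (forall i j, (K <= i)%N || (K <= j)%N -> F i j = 0) ->
  \sum_(0 <= i < K') \sum_(0 <= j < K') F i j =
  \sum_(0 <= i < K) \sum_(0 <= j < K) F i j.
Proof.
move=> KK F0; rewrite (big_cat_nat (n := K)) //= [X in _ + X = _](_ : _ = 0) ?addr0; last first.
  rewrite big_nat big1 // => i /andP[Ki _].
  by rewrite big1 // => j _; rewrite F0 // Ki.
apply: eq_bigr => i _; rewrite (big_cat_nat (n := K)) //=.
rewrite [X in _ + X = _](_ : _ = 0) ?addr0 // big_nat big1 // => j /andP[Kj _].
by rewrite F0 // Kj orbT.
Qed.

(** The form is a sum over [x] of forms of [T] on the sequences i -> innov u x i, that is, [T]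
    tensored with the identity between isometric embeddings. *)
Lemma lift_matrix_bounded T K D : mx_bounded_by T 1 ->
  (forall i j, (K <= i)%N || (K <= j)%N -> diagonal_diff T i j = 0) ->
  mx_bounded_by (lift_matrix T K D) 1.
Proof.
move=> [_ bT] symb0; split=> // s u v /NoDup_uniq us; rewrite mul1r.
rewrite -/(form (lift_matrix T K D) s u v) form_lift_matrix_corr.
(* Diagonal differences vanish from [K] on and correlations past [D]; [K'] lies beyond both. *)
pose K' := maxn K D.+1.
rewrite -(@sum_symb_widen _ K K') ?leq_maxl //; last first.
  by move=> i j ij; rewrite symb0 // mul0r.
have DK' : (D < K')%N by rewrite /K' leq_maxr.
have cs (u' : X -> R[i]) w : w \notin ball_ D -> cut D s u' w = 0 by exact: cut_supp.
rewrite (diagonal_diff_corr (cs u) (cs v)) //; apply: le_trans (cabs_sum _ _) _.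
apply: (@le_trans _ _ (\sum_(x <- ball_ D)
  nrm (iota 0 K') (innov (cut D s u) x) * nrm (iota 0 K') (innov (cut D s v) x))).
  apply: ler_sum => x _; rewrite -[leRHS]mul1r mulrA; apply: bT.
  by apply/NoDup_uniq; exact: iota_uniq.
apply: le_trans (cauchy_schwarz _ _ _) _.
have H (u' : X -> R[i]) :
    Num.sqrt (\sum_(x <- ball_ D) nrm (iota 0 K') (innov (cut D s u') x) ^+ 2)
    <= Num.sqrt (\sum_(x <- s) cabs (u' x) ^+ 2).
  rewrite ler_wsqrtr // (le_trans _ (sum_cut_le D u' us)) //.
  rewrite -(sum_innov (cs u') DK'); apply: ler_sum => x _.
  by rewrite sqr_nrm /index_iota subn0.
by apply: ler_pM; rewrite ?sqrtr_ge0.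
Qed.

(** * Radial test vectors and averages over descendants *)

Definition avg (f : X -> R[i]) x := q%:R^-1 * \sum_(0 <= a < q) f (c x a).

Definition iavg i (f : X -> R[i]) := iter i avg f.

Lemma iavgS i f x : iavg i.+1 f x = q%:R^-1 * \sum_(0 <= a < q) iavg i f (c x a).
Proof. by []. Qed.

Lemma q_neq0 : q%:R != 0 :> R[i].
Proof. by rewrite pnatr_eq0. Qed.

Lemma kappa_mul : kappa * kappa = q%:R^-1.
Proof. by rewrite -[LHS](mulKf q_neq0) kappa_sqr mulr1. Qed.

(** Against the weight kappa^depth, summation over children becomes averaging, as kappa^2 = 1/q; the
    indicator records that i generations below level [e] one is still in the ball. *)
Lemma shift_weight D i e x f : x \in level e ->
  shift i (fun w => kappa ^+ depth w * f w * (w \in ball_ D)%:R) x =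
  kappa ^+ e * (e + i <= D)%N%:R * iavg i f x.
Proof.
elim: i e x => [|i IH] e x xe.
  by rewrite /shift /= (level_depth xe) (mem_ball _ xe) addn0 mulrAC.
rewrite shiftS iavgS.
transitivity (kappa * \sum_(0 <= a < q) kappa ^+ e.+1 * (e.+1 +
  i <= D)%N%:R * iavg i f (c x a)).
  congr (_ * _); apply: eq_big_nat => a /andP[_ aq].
  by rewrite (IH e.+1) // child_level.
rewrite -mulr_sumr exprS addSnnS -kappa_mul; ring.
Qed.

Lemma sum_delta D j (g : X -> R[i]) w :
  \sum_(y <- ball_ D) g y * shift j (delta D y) w =
  shift j (fun w' => g w' * (w' \in ball_ D)%:R) w.
Proof.
rewrite -shift_sum; apply: eq_shift => w'; rewrite /delta.
have [wD|wD] := boolP (w' \in ball_ D).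
  under eq_bigr do rewrite mulr1 mulrC eq_sym.
  by rewrite sum_eqr ?uniq_ball // mulr1.
by rewrite mulr0 big1 // => y _; rewrite !mulr0.
Qed.

Variable phi : nat -> R[i].

Definition mean i j x y := iavg i (fun x' => iavg j (fun y' => phi (d x' y')) y) x.

(** On the radial vector both shifts turn into averages over descendants of a common vertex [w],
    whose weight q^(-e) gives every level total mass 1. *)
Lemma form_lift_matrix_test T K D :
  form (schur_mult (fun x y => phi (d x y)) (lift_matrix T K D)) (ball_ D)
    (fun x => kappa ^+ depth x) (fun x => kappa ^+ depth x) =
  \sum_(0 <= i < K) \sum_(0 <= j < K) diagonal_diff T i j * \sum_(0 <= e < D.+1)
    \sum_(w <- level e) (kappa * kappa) ^+ e *
      (((e + i <= D) && (e + j <= D))%N%:R * mean i j w w).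
Proof.
rewrite form_lift_matrix; apply: eq_bigr => i _; apply: eq_bigr => j _; congr (_ * _).
rewrite sum_ball; apply: eq_bigr => e _; apply: eq_big_seq => w we.
transitivity (\sum_(x <- ball_ D) (kappa ^+ depth x *
    (kappa ^+ e * (e + j <= D)%N%:R * iavg j (fun y => phi (d x y)) w)) *
    shift i (delta D x) w).
  apply: eq_bigr => x _.
  rewrite -(@shift_weight D j e w) // -sum_delta !mulr_sumr mulr_suml.
  by apply: eq_bigr => y _; rewrite conjcX kappa_conj; ring.
rewrite (eq_bigr (fun x => (kappa ^+ e * (e + j <= D)%N%:R) * (kappa ^+ depth x *
    iavg j (fun y => phi (d x y)) w * shift i (delta D x) w))); last first.
  by move=> x _; ring.
rewrite -mulr_sumr (@sum_delta D i (fun x => kappa ^+ depth x *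
    iavg j (fun y => phi (d x y)) w)) (@shift_weight D i e w) // -/(mean i j w w).
rewrite exprMn mulrb; case: (e + i <= D)%N; case: (e + j <= D)%N; rewrite /= ?mulr0n ?mulr1n;
  ring.
Qed.

Lemma avg_const f x (t : R[i]) : (forall a, f (c x a) = t) -> avg f x = t.
Proof.
move=> ft; rewrite /avg; under eq_bigr do rewrite ft.
by rewrite sum_const mulKf // q_neq0.
Qed.

(** Each step down from incomparable vertices lengthens the distance by one, so the average is over
    a constant. *)
Lemma mean_inc i j x y : inc x y -> mean i j x y = phi (d x y + i + j)%N.
Proof.
rewrite /mean; elim: i x => [|i IH] x xy /=.
  rewrite addn0; elim: j y xy => [|j IH] y xy /=; first by rewrite addn0.
  apply: avg_const => b; have [db ib] := inc_childr b xy.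
  by rewrite IH // db addSnnS.
apply: avg_const => a; have [da ia] := inc_childl a xy.
by rewrite -/(iavg _ _ _) IH // da; congr phi; lia.
Qed.

Lemma mean_0r i w : mean i 0 w w = phi i.
Proof.
rewrite /mean /=; have H x : (depth w <= depth x)%N ->
    iavg i (fun x' => phi (d x' w)) x = phi (d x w + i)%N.
  elim: i x => [|i IH] x wx; first by rewrite addn0.
  apply: avg_const => a; transitivity (phi (d (c x a) w + i)%N).
    by apply: IH; rewrite depth_child leqW.
  by rewrite dist_childl // addSnnS.
by rewrite H // dist_refl.
Qed.

Lemma mean_0l j w : mean 0 j w w = phi j.
Proof.
rewrite /mean /=; have H y : (depth w <= depth y)%N ->
    iavg j (fun y' => phi (d w y')) y = phi (d w y + j)%N.
  elim: j y => [|j IH] y wy; first by rewrite addn0.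
  apply: avg_const => a; transitivity (phi (d w (c y a) + j)%N).
    by apply: IH; rewrite depth_child leqW.
  by rewrite dist_childr // addSnnS.
by rewrite H // dist_refl.
Qed.

Lemma iavg_sum (h : nat -> X -> R[i]) i x :
  iavg i (fun x' => q%:R^-1 * \sum_(0 <= b < q) h b x') x =
  q%:R^-1 * \sum_(0 <= b < q) iavg i (h b) x.
Proof.
elim: i x => [|i IH] x //; rewrite iavgS; under eq_bigr do rewrite IH.
rewrite -mulr_sumr; congr (_ * _); rewrite exchange_big /= mulr_sumr.
by apply: eq_bigr => b _.
Qed.

Lemma iavg_le f (C : R) i x : (forall y, cabs (f y) <= C) -> cabs (iavg i f x) <= C.
Proof.
move=> fC; elim: i x => [|i IH] x; first exact: fC.
rewrite iavgS cabsM cabsV -(rmorph_nat (real_complex R)) cabs_real ger0_norm ?ler0n //.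
rewrite ler_pdivrMl ?ltr0n //; apply: le_trans (cabs_sum _ _) _.
apply: le_trans (ler_sum _ (fun a _ => IH (c x a))) _.
by rewrite sum_const.
Qed.

(** Split both averages at the first step. Pairs of different children are incomparable and give
    phi(i+j) exactly; the q equal pairs among q^2 cost at most 2 C each. *)
Lemma mean_err (C : R) i j w : (forall n, cabs (phi n) <= C) ->
  cabs (mean i j w w - phi (i + j)%N) <= 2 * C / q%:R.
Proof.
move=> phiC; have C0 : 0 <= C := le_trans (cabs_ge0 _) (phiC 0%N).
have r0 : 0 <= 2 * C / q%:R by rewrite divr_ge0 ?mulr_ge0 ?ler0n.
case: i => [|i]; first by rewrite mean_0l subrr cabs0.
case: j => [|j]; first by rewrite mean_0r addn0 subrr cabs0.
have -> : mean i.+1 j.+1 w w = q%:R^-1 * (q%:R^-1 * \sum_(0 <= a < q)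
    \sum_(0 <= b < q) mean i j (c w a) (c w b)).
  rewrite /mean iavgS [X in _ = _ * X]mulr_sumr; congr (_ * _); apply: eq_bigr => a _.
  exact: (iavg_sum (fun b x' => iavg j (fun y' => phi (d x' y')) (c w b))).
have ndiag a b : a != b -> mean i j (c w a) (c w b) = phi (i.+1 + j.+1)%N.
  move=> ab; have [d2 ic] := inc_siblings w ab.
  by rewrite mean_inc // d2; congr phi; lia.
have -> : phi (i.+1 + j.+1)%N = q%:R^-1 * (q%:R^-1 * \sum_(0 <= a < q)
    \sum_(0 <= b < q) phi (i.+1 + j.+1)%N).
  by rewrite !sum_const !mulKf // q_neq0.
rewrite -!mulrBr -sumrB.
rewrite (eq_big_nat _ _ (F2 := fun a => mean i j (c w a) (c w a) - phi (i.+1 + j.+1)%N));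
  last first.
  move=> a aq; rewrite -sumrB (bigD1_seq a) ?iota_uniq ?mem_index_iota //=.
  by rewrite big1 ?addr0 // => b ba; rewrite ndiag 1?eq_sym // subrr.
have qi : cabs (q%:R^-1 : R[i]) = q%:R^-1.
  by rewrite cabsV -(rmorph_nat (real_complex R)) cabs_real ger0_norm ?ler0n.
rewrite !cabsM qi [leRHS]mulrC ler_wpM2l ?invr_ge0 ?ler0n // ler_pdivrMl ?ltr0n //.
apply: le_trans (cabs_sum _ _) _.
apply: (@le_trans _ _ (\sum_(0 <= a < q) 2 * C)); last first.
  by rewrite sum_const.
apply: ler_sum => a _; apply: le_trans (cabsB _ _) _.
rewrite mulr_natl mulr2n lerD //; apply: iavg_le => x; apply: iavg_le => y.
exact: phiC.
Qed.

Lemma level_weight e : \sum_(w <- level e) cabs ((kappa * kappa) ^+ e) = 1.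
Proof.
elim: e => [|e IH]; first by rewrite big_seq1 expr0 cabs1.
rewrite sum_level -[RHS]IH; apply: eq_bigr => w _.
rewrite sum_const exprSr !cabsM cabsX.
by rewrite -[cabs kappa * cabs kappa]expr2 cabs_kappa_sqr mulrCA divff ?mulr1 // pnatr_eq0.
Qed.

(** Two errors arise: coinciding first steps cost 2 C / q on each of the D + 1 levels, and descents
    leaving the ball affect only the last K levels. *)
Lemma form_lift_matrix_test_err T K D (C : R) : (forall n, cabs (phi n) <= C) ->
  cabs (form (schur_mult (fun x y => phi (d x y)) (lift_matrix T K D)) (ball_ D)
    (fun x => kappa ^+ depth x) (fun x => kappa ^+ depth x) -
   D.+1%:R * \sum_(0 <= i < K) \sum_(0 <= j < K) diagonal_diff T i j * phi (i + j)%N) <=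
  (\sum_(0 <= i < K) \sum_(0 <= j < K) cabs (diagonal_diff T i j)) *
    (D.+1%:R * (2 * C / q%:R) + 2 * K%:R * C).
Proof.
move=> phiC; have C0 : 0 <= C := le_trans (cabs_ge0 _) (phiC 0%N).
rewrite form_lift_matrix_test mulr_sumr -sumrB mulr_suml.
apply: le_trans (cabs_sum _ _) _; apply: ler_sum_nat => i /andP[_ iK].
rewrite mulr_sumr -sumrB mulr_suml.
apply: le_trans (cabs_sum _ _) _; apply: ler_sum_nat => j /andP[_ jK].
rewrite mulrCA -mulrBr cabsM ler_wpM2l ?cabs_ge0 //.
have -> : D.+1%:R * phi (i + j)%N = \sum_(0 <= e < D.+1) \sum_(w <- level e)
    (kappa * kappa) ^+ e * phi (i + j)%N.
  rewrite (eq_bigr (fun _ => phi (i + j)%N)).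
    by rewrite sumr_const_nat subn0 mulr_natl.
  move=> e _; rewrite -mulr_suml -[RHS]mul1r; congr (_ * _).
  elim: e => [|e IH]; first by rewrite big_seq1 expr0.
  rewrite sum_level -[RHS]IH; apply: eq_bigr => w _.
  by rewrite sum_const exprSr mulrCA kappa_sqr mulr1.
rewrite -sumrB.
apply: le_trans (cabs_sum _ _) _.
apply: (@le_trans _ _ (\sum_(0 <= e < D.+1)
    (2 * C / q%:R + (if (D < e + K)%N then C else 0)))).
  apply: ler_sum_nat => e /andP[_ eD]; rewrite -sumrB.
  apply: le_trans (cabs_sum _ _) _.
  set B := (X in _ <= X); rewrite -[leRHS]mul1r -(level_weight e) mulr_suml.
  apply: ler_sum => w _; rewrite -mulrBr cabsM ler_wpM2l ?cabs_ge0 // /B.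
  have := mean_err i j w phiC.
  case: ifP => [h err|/negbT]; last first.
    rewrite -leqNgt => eDK.
    case: (_ && _) / andP => [_ h|[]]; first by rewrite mulr1n mul1r addr0.
    by split; lia.
  have r0 : 0 <= 2 * C / q%:R by rewrite divr_ge0 ?mulr_ge0 ?ler0n.
  case: (_ && _); first by rewrite mulr1n mul1r (le_trans err) // lerDl.
  by rewrite mulr0n mul0r sub0r cabsN (le_trans (phiC _)) // lerDr.
rewrite big_split /= sumr_const_nat subn0 -[(2 * C / _) *+ _]mulr_natl lerD2l.
rewrite big_nat_rev /= add0n.
have H n : (n <= D.+1)%N -> \sum_(0 <= e < n) (if (D < D.+1 - e.+1 + K)%N then C else 0)
    <= (minn n K)%:R * C.
  elim: n => [|n IH] nD; first by rewrite big_geq // min0n mul0r.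
  rewrite big_nat_recr //= (le_trans (lerD (IH (ltnW nD)) (lexx _))) //.
  case: ifP => h; last by rewrite addr0 ler_wpM2r // ler_nat; lia.
  have nK : (n < K)%N by lia.
  by rewrite (minn_idPl nK) (minn_idPl (ltnW nK)) -natr1 mulrDl mul1r.
apply: le_trans (H _ (leqnn _)) _; rewrite ler_wpM2r //.
by apply: (@le_trans _ _ K%:R); [rewrite ler_nat geq_minr|rewrite ler_peMl ?ler0n ?ler1n].
Qed.

Lemma form_test_norm D :
  nrm (ball_ D) (fun x => kappa ^+ depth x) ^+ 2 = D.+1%:R.
Proof.
rewrite sqr_nrm sum_ball (eq_bigr (fun _ => 1)).
  by rewrite sumr_const_nat subn0.
move=> e _; rewrite -[RHS](level_weight e); apply: eq_big_seq => w we.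
by rewrite (level_depth we) cabsX [in RHS]cabsX cabsM -expr2 exprAC.
Qed.

End FiniteSubtree.

(** * The limit of large depth and branching *)

Variable phi : nat -> R[i].
Variable N : R.
Hypothesis schurN : forall A, mx_bounded_by A 1 ->
  mx_bounded_by (schur_mult (fun x y => phi (d x y)) A) N.

(** Test on the matrix unit joining the root to a vertex of depth n. *)
Lemma symbol_le n : cabs (phi n) <= N.
Proof.
pose y := iter n (fun x => c x 0%N) x0.
have dy : depth y = n.
  by rewrite /y; elim: n {y} => [|n IH] /=; rewrite ?dist_refl // depth_child IH.
pose A a b : R[i] := (x0 == a)%:R * (y == b)%:R.
have bA : mx_bounded_by A 1.
  split=> // s u v /NoDup_uniq us; rewrite mul1r.
  have H (z : X) (w : X -> R[i]) :
      cabs (\sum_(x <- s) (z == x)%:R * w x) <= Num.sqrt (\sum_(x <- s) cabs (w x) ^+ 2).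
    have [zs|zs] := boolP (z \in s).
      rewrite sum_eqr // -[leLHS]ger0_norm ?cabs_ge0 // -sqrtr_sqr ler_wsqrtr //.
      by rewrite (bigD1_seq z) //= lerDl sumr_ge0 // => x _; rewrite sqr_ge0.
    rewrite big_seq big1 ?cabs0 ?sqrtr_ge0 // => x xs; case: eqP => [e|]; last by rewrite mul0r.
    by rewrite e xs in zs.
  rewrite (_ : \sum_(x <- s) _ = conjc (\sum_(x <- s) (x0 == x)%:R * u x) *
    (\sum_(x <- s) (y == x)%:R * v x)); last first.
    rewrite conjc_sum big_distrlr /=; apply: eq_bigr => a _; apply: eq_bigr => b _.
    by rewrite conjcM conjc_nat /A; ring.
  by rewrite cabsM cabs_conj; apply: ler_pM; rewrite ?cabs_ge0.
have := mx_bounded_entry x0 y (schurN bA).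
by rewrite /schur_mult /A !eqxx dy !mulr1.
Qed.

Lemma transfer T K : mx_bounded_by T 1 ->
  (forall i j, (K <= i)%N || (K <= j)%N -> diagonal_diff T i j = 0) ->
  cabs (\sum_(0 <= i < K) \sum_(0 <= j < K) diagonal_diff T i j * phi (i + j)%N) <= N.
Proof.
move=> bT symb0; have N0 : 0 <= N := le_trans (cabs_ge0 _) (symbol_le 0).
set S := \sum_(0 <= i < K) _.
pose B : R := \sum_(0 <= i < K) \sum_(0 <= j < K) cabs (diagonal_diff T i j).
have B0 : 0 <= B by apply: sumr_ge0 => i _; apply: sumr_ge0 => j _; exact: cabs_ge0.
apply: (@le_limit_inv _ _ _ (B * (2 * N + 2 * K%:R * N))) => [|n].
  by rewrite mulr_ge0 // addr_ge0 // !mulr_ge0 ?ler0n.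
have n0 : 0 < n.+1%:R :> R by rewrite ltr0n.
rewrite -(ler_pM2l n0) mulrDr [X in _ <= _ + X]mulrCA divff ?gt_eqF // mulr1.
(* Here q = n + 1 and the ball has n + 1 levels; after division by n + 1, the squared norm of the
   test vector, both errors are of order 1/n. *)
have [_ bA] := schurN (lift_matrix_bounded n n bT symb0).
have := bA (ball_ n n) (fun x => kappa n ^+ depth x) (fun x => kappa n ^+ depth x).
move=> /(_ ((NoDup_uniq _).2 (uniq_ball n n))).
rewrite -/(form _ _ _ _) -/(nrm _ _) -mulrA -expr2 form_test_norm => up.
have := form_lift_matrix_test_err n T K n symbol_le.
rewrite -/S -/B; set F := form _ _ _ _ in up *.
rewrite mulrCA divff ?gt_eqF // mulr1 => err.
have := cabsB F (F - n.+1%:R * S).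
rewrite subKr cabsM -(rmorph_nat (real_complex R)) cabs_real ger0_norm ?ler0n //.
by rewrite -(rmorph_nat (real_complex R)) in err; move: up err; rewrite [n.+1%:R * N]mulrC; lra.
Qed.

End Transfer.

(** * The Hankel matrix of second differences *)

Section HankelFunctional.
Variable R : realType.
Implicit Types (u v : nat -> R[i]).

(** Extension by zero, to replace an arbitrary finite index set by an initial segment, where
    neighbouring indices are available. *)
Definition pad (s : seq nat) u i : R[i] := if i \in s then u i else 0.

Lemma sum_pad (V : nmodType) (s : seq nat) K (F : nat -> V) : uniq s ->
  {subset s <= iota 0 K} ->
  \sum_(i <- s) F i = \sum_(0 <= i < K) (if i \in s then F i else 0).
Proof.
move=> us sK; rewrite -[in RHS]big_mkcond /= -[in RHS]big_filter; apply: perm_big.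
apply: uniq_perm => //; first exact/filter_uniq/iota_uniq.
move=> i; rewrite mem_filter /index_iota subn0; apply/idP/andP => [iS|[]//].
by split=> //; exact: sK.
Qed.

Lemma form_pad (A : nat -> nat -> R[i]) (s : seq nat) K u v : uniq s ->
  {subset s <= iota 0 K} ->
  form A s u v = form A (iota 0 K) (pad s u) (pad s v).
Proof.
move=> us sK; rewrite /form (sum_pad _ us sK) /index_iota subn0.
apply: eq_bigr => i _; rewrite {1}/pad; case: ifP => si; last first.
  by rewrite big1 // => j _; rewrite conjc0 !mul0r.
rewrite (sum_pad _ us sK) /index_iota subn0; apply: eq_bigr => j _.
by rewrite /pad; case: ifP => // _; rewrite mulr0.
Qed.

Lemma sumsq_pad (s : seq nat) K u : uniq s -> {subset s <= iota 0 K} ->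
  \sum_(i <- s) cabs (u i) ^+ 2 = \sum_(0 <= i < K) cabs (pad s u i) ^+ 2.
Proof.
move=> us sK; rewrite (sum_pad _ us sK); apply: eq_bigr => i _.
by rewrite /pad; case: ifP => // _; rewrite cabs0 expr0n.
Qed.

Lemma bounded_support (s : seq nat) : exists K, {subset s <= iota 0 K}.
Proof.
exists (\max_(i <- s) i).+1 => i si; rewrite mem_iota add0n ltnS /=.
exact: leq_bigmax_seq.
Qed.

Lemma half_sqrt (a b : R) : 0 <= a -> 0 <= b ->
  4^-1 * (Num.sqrt (4 * a) * Num.sqrt (4 * b)) = Num.sqrt a * Num.sqrt b.
Proof.
move=> a0 b0; rewrite !sqrtrM ?ler0n //.
have -> : Num.sqrt 4 = 2 :> R.
  by rewrite (_ : 4 = 2 ^+ 2) ?sqrtr_sqr ?ger0_norm // -natrX.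
by field.
Qed.

Definition tridiag (a b : R[i]) (i j : nat) : R[i] :=
  a * (i == j)%:R + b / 2 * ((i == j.+1)%:R + (j == i.+1)%:R).

Definition prevn u k : R[i] := if k is k'.+1 then u k' else 0.

Lemma parallelogram (x y : R[i]) :
  cabs (x + y) ^+ 2 + cabs (x - y) ^+ 2 = 2 * (cabs x ^+ 2 + cabs y ^+ 2).
Proof. by rewrite !sqr_cabs; case: x => a b; case: y => c d /=; ring. Qed.

(* The symbol (al + be) / 2 + (al - be) / 2 cos t is the convex combination
   of al and be with weights (1 + cos t) / 2 and (1 - cos t) / 2. *)
Lemma tridiag_bounded (al be : R[i]) : cabs al <= 1 -> cabs be <= 1 ->
  mx_bounded_by (tridiag ((al + be) / 2) ((al - be) / 2)) 1.
Proof.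
move=> al1 be1; split=> // s u0 v0 /NoDup_uniq us; rewrite mul1r.
rewrite -/(form _ s u0 v0); have [K sK] := bounded_support s.
rewrite (form_pad _ _ _ us sK) !(sumsq_pad _ us sK).
have pK w : pad s w K = 0.
  by rewrite /pad; case: ifP => // /sK; rewrite mem_iota add0n ltnn.
set u := pad s u0; set v := pad s v0.
(* In the variables u_k + u_(k-1) and u_k - u_(k-1) the form separates into an [al] part and a [be]
   part. The sum includes k = K because the shifted sequence reaches one place further. *)
have -> : form (tridiag ((al + be) / 2) ((al - be) / 2)) (iota 0 K) u v =
  \sum_(0 <= k < K.+1) (al / 4 * (conjc (u k + prevn u k) * (v k + prevn v k)) +
    be / 4 * (conjc (u k - prevn u k) * (v k - prevn v k))).
  have E (a b : R[i]) : form (tridiag a b) (iota 0 K) u v =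
     a * (\sum_(0 <= k < K) conjc (u k) * v k) +
     b / 2 * (\sum_(0 <= k < K) (conjc (u k.+1) * v k + conjc (u k) * v k.+1)).
    rewrite !mulr_sumr -big_split /= /form /index_iota subn0.
    transitivity (\sum_(i <- iota 0 K) (a * (\sum_(j <- iota 0 K) (i == j)%:R * (conjc (u i) *
      v j))
      + b / 2 * (\sum_(j <- iota 0 K) (i == j.+1)%:R * (conjc (u i) * v j)
           + \sum_(j <- iota 0 K) (i.+1 == j)%:R * (conjc (u i) * v j)))).
      apply: eq_bigr => i _; rewrite -big_split !mulr_sumr -big_split /=.
      by apply: eq_bigr => j _; rewrite /tridiag [i.+1 == j]eq_sym; ring.
    rewrite !big_split /= -!mulr_sumr !big_split /=; congr (_ * _ + _ * (_ + _)).
    - by apply: eq_big_seq => i iK; rewrite sum_eqr // iota_uniq.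
    - rewrite exchange_big /=; apply: eq_big_seq => j jK.
      have [jK'|jK'] := boolP (j.+1 \in iota 0 K).
        under eq_bigr do rewrite eq_sym.
        by rewrite sum_eqr ?iota_uniq.
      rewrite big_seq big1; last first.
        by move=> i iK; case: eqP => [e|_]; [rewrite -e iK in jK'|rewrite mul0r].
      have -> : j.+1 = K by move: jK jK'; rewrite !mem_iota; lia.
      by rewrite /u pK conjc0 mul0r.
    - apply: eq_big_seq => i iK.
      have [iK'|iK'] := boolP (i.+1 \in iota 0 K).
        by rewrite sum_eqr ?iota_uniq.
      rewrite big_seq big1; last first.
        by move=> j jK; case: eqP => [e|_]; [rewrite e jK in iK'|rewrite mul0r].
      have -> : i.+1 = K by move: iK iK'; rewrite !mem_iota; lia.
      by rewrite /v pK mulr0.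
  rewrite E [RHS](eq_bigr (fun k =>
     ((al + be) / 4 * (conjc (u k) * v k) + (al + be) / 4 * (conjc (prevn u k) * prevn v k))
     + (al - be) / 4 * (conjc (u k) * prevn v k + conjc (prevn u k) * v k))); last first.
    by move=> k _; rewrite conjcB (rmorphD (@conjc R)) /=; field.
  rewrite !big_split /= -!mulr_sumr.
  have e1 : \sum_(0 <= k < K.+1) conjc (u k) * v k = \sum_(0 <= k < K) conjc (u k) * v k.
    by rewrite big_nat_recr //= /u pK conjc0 mul0r addr0.
  have e2 : \sum_(0 <= k < K.+1) conjc (prevn u k) * prevn v k =
    \sum_(0 <= k < K) conjc (u k) * v k.
    by rewrite big_nat_recl //= mulr0 add0r.
  have e3 : \sum_(0 <= k < K.+1) (conjc (u k) * prevn v k + conjc (prevn u k) * v k) =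
      \sum_(0 <= k < K) (conjc (u k.+1) * v k + conjc (u k) * v k.+1).
    by rewrite big_nat_recl // [prevn v 0]/(0 : R[i]) [prevn u 0]/(0 : R[i]) mulr0 conjc0
      mul0r !add0r.
  by rewrite e1 e2 e3 big_split /=; field.
apply: le_trans (cabs_sum _ _) _.
pose w2 (w : nat -> R[i]) k := Num.sqrt (2 * (cabs (w k) ^+ 2 + cabs (prevn w k) ^+ 2)).
apply: (@le_trans _ _ (\sum_(0 <= k < K.+1) 4^-1 * (w2 u k * w2 v k))).
  apply: ler_sum => k _; apply: le_trans (cabsD _ _) _.
  have c4 : cabs (4^-1 : R[i]) = 4^-1.
    by rewrite cabsV -(rmorph_nat (real_complex R)) cabs_real ger0_norm.
  rewrite !cabsM !cabs_conj c4 /w2 -!parallelogram.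
  apply: le_trans (_ : 4^-1 * (cabs (u k + prevn u k) * cabs (v k + prevn v k)
     + cabs (u k - prevn u k) * cabs (v k - prevn v k)) <= _).
    rewrite mulrDr; apply: lerD; rewrite ler_wpM2r ?mulr_ge0 ?cabs_ge0 //.
      by rewrite ler_piMl.
    by rewrite ler_piMl.
  by rewrite ler_wpM2l //; apply: cauchy_schwarz_step; exact: cabs_ge0.
rewrite -mulr_sumr -half_sqrt ?sumr_ge0 //; try by move=> k _; exact: sqr_ge0.
rewrite ler_wpM2l //; apply: le_trans (cauchy_schwarz _ _ _) _.
have H w : w K = 0 -> \sum_(0 <= k < K.+1) w2 w k ^+ 2 = 4 * \sum_(0 <= k < K) cabs (w k) ^+ 2.
  move=> wK; rewrite (eq_bigr (fun k => 2 * cabs (w k) ^+ 2 + 2 * cabs (prevn w k) ^+ 2));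
    last first.
    by move=> k _; rewrite -mulrDr sqr_sqrtr // mulr_ge0 // addr_ge0 // sqr_ge0.
  rewrite big_split /= -!mulr_sumr big_nat_recr //= wK cabs0 expr0n addr0.
  by rewrite big_nat_recl //= cabs0 expr0n add0r; ring.
by rewrite !H // /u /v pK.
Qed.

Definition blockT (M : nat) (B E : nat -> nat -> R[i]) i j : R[i] :=
  if (i < M)%N && (j < M)%N then B i j
  else if (M <= i)%N && (M <= j)%N then E i j else 0.

Lemma blockT_bounded M B E : mx_bounded_by B 1 -> mx_bounded_by E 1 ->
  mx_bounded_by (blockT M B E) 1.
Proof.
move=> [_ bB] [_ bE]; split=> // s u v nds; rewrite mul1r.
pose lo (w : nat -> R[i]) i := if (i < M)%N then w i else 0.
pose hi (w : nat -> R[i]) i := if (M <= i)%N then w i else 0.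
rewrite (_ : \sum_(x <- s) _ = form B s (lo u) (lo v) + form E s (hi u) (hi v)); last first.
  rewrite /form -big_split; apply: eq_bigr => i _.
  rewrite -big_split; apply: eq_bigr => j _; rewrite /= /blockT /lo /hi.
  have cif (t : bool) (z : R[i]) : conjc (if t then z else 0) = if t then conjc z else 0.
    by case: t => //; exact: conjc0.
  rewrite !cif !(leqNgt M); case: (i < M)%N; case: (j < M)%N => /=;
    by rewrite ?(mul0r, mulr0, addr0, add0r).
have split w : \sum_(i <- s) cabs (w i) ^+ 2 = nrm s (lo w) ^+ 2 + nrm s (hi w) ^+ 2.
  rewrite !sqr_nrm -big_split; apply: eq_bigr => i _ /=; rewrite /lo /hi (leqNgt M i).
  by case: (i < M)%N; rewrite /= cabs0 expr0n ?addr0 ?add0r.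
rewrite !split; apply: le_trans (cabsD _ _) _.
apply: le_trans (cauchy_schwarz_step _ _ (nrm_ge0 _ _) (nrm_ge0 _ _)).
have := bB s (lo u) (lo v) nds; have := bE s (hi u) (hi v) nds; rewrite !mul1r => h1 h2.
exact: lerD.
Qed.

Lemma zero_bounded : mx_bounded_by (fun _ _ : nat => 0 : R[i]) 1.
Proof.
split=> // s u v _; rewrite big1 ?cabs0 ?mul1r ?mulr_ge0 ?sqrtr_ge0 //.
by move=> x _; rewrite big1 // => y _; rewrite mulr0 mul0r.
Qed.

(** A weighted translation: i -> i + m is injective, so no entry of [v] is used twice. *)
Lemma band_bounded (m : nat) (t : nat -> R[i]) : (forall i, cabs (t i) <= 1) ->
  mx_bounded_by (fun i j => (j == i + m)%N%:R * t i) 1.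
Proof.
move=> t1; split=> // s u v /NoDup_uniq us; rewrite mul1r.
rewrite (_ : \sum_(x <- s) _ = \sum_(i <- s) conjc (u i) * t i * pad s v (i + m)%N); last first.
  apply: eq_bigr => i _; rewrite /pad; case: ifP => im.
    rewrite (eq_bigr (fun j => (i + m == j)%N%:R * (conjc (u i) * t i * v j))).
      by rewrite sum_eqr.
    by move=> j _; rewrite eq_sym; ring.
  rewrite big_seq big1 ?mulr0 // => j js; case: eqP => [e|]; last by rewrite mul0r mulr0 mul0r.
  by rewrite -e js in im.
apply: le_trans (cabs_sum _ _) _.
apply: (@le_trans _ _ (\sum_(i <- s) cabs (u i) * cabs (pad s v (i + m)%N))).
  apply: ler_sum => i _; rewrite !cabsM cabs_conj ler_wpM2r ?cabs_ge0 //.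
  by rewrite ler_piMr ?cabs_ge0.
apply: le_trans (cauchy_schwarz _ _ _) _; rewrite ler_wpM2l ?sqrtr_ge0 //.
rewrite ler_wsqrtr //.
rewrite -(big_map (fun i => i + m)%N xpredT (fun j => cabs (pad s v j) ^+ 2)).
set s' := map _ s.
rewrite (bigID (mem s)) /= [X in _ + X]big1 ?addr0; last first.
  by move=> j js; rewrite /pad (negbTE js) cabs0 expr0n.
rewrite -big_filter.
have us' : uniq ([seq j <- s' | j \in s]).
  by apply: filter_uniq; rewrite map_inj_uniq // => a b /addIn.
have sub : {subset [seq j <- s' | j \in s] <= s} by move=> j; rewrite mem_filter => /andP[].
rewrite [leRHS](bigID (mem ([seq j <- s' | j \in s]))) /=.
apply: (@le_trans _ _ (\sum_(i <- s | i \in [seq j <- s' | j \in s]) cabs (v i) ^+ 2)).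
  rewrite -[leRHS]big_filter le_eqVlt; apply/orP; left; apply/eqP.
  transitivity (\sum_(j <- [seq j <- s' | j \in s]) cabs (v j) ^+ 2).
    by apply: eq_big_seq => j /sub js; rewrite /pad js.
  apply: perm_big; apply: uniq_perm => //; first exact: filter_uniq.
  by move=> j; rewrite [RHS]mem_filter; apply/idP/andP => [h|[]//]; split=> //; exact: sub.
by rewrite lerDl sumr_ge0 // => j _; rewrite sqr_ge0.
Qed.

(** * Bounds for the second differences and the limits of phi *)

Variables (phi : nat -> R[i]) (N : R).
Hypothesis symbol_bound : forall T K, mx_bounded_by T 1 ->
  (forall i j, (K <= i)%N || (K <= j)%N -> diagonal_diff T i j = 0) ->
  cabs (\sum_(0 <= i < K) \sum_(0 <= j < K) diagonal_diff T i j * phi (i + j)%N) <= N.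

Definition hankel_symbol n := phi n - phi n.+2.

Lemma diagonal_diff_sum T K : \sum_(0 <= i < K.+1) \sum_(0 <= j < K.+1) diagonal_diff T i j *
  phi (i + j)%N =
  \sum_(0 <= i < K.+1) \sum_(0 <= j < K.+1) T i j * phi (i + j)%N -
  \sum_(0 <= i < K) \sum_(0 <= j < K) T i j * phi (i + j).+2.
Proof.
transitivity (\sum_(0 <= i < K.+1) \sum_(0 <= j < K.+1) T i j * phi (i + j)%N -
  \sum_(0 <= i < K.+1) \sum_(0 <= j < K.+1)
     (if (i, j) is (i'.+1, j'.+1) then T i' j' else 0) * phi (i + j)%N).
  rewrite -sumrB; apply: eq_bigr => i _; rewrite -sumrB; apply: eq_bigr => j _.
  by rewrite mulrBl.
congr (_ - _); rewrite big_nat_recl // big1 ?add0r; last by move=> j _; rewrite mul0r.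
apply: eq_bigr => i _; rewrite big_nat_recl //= mul0r add0r.
by apply: eq_bigr => j _; rewrite addSn addnS.
Qed.

(** Take T to be [B] followed by the tridiagonal tail. Inside the block summation by parts turns phi
    into h. The tail is constant along diagonals, so it contributes only where it starts: its (M,M)
    entry reads phi(2M) and the two adjacent off-diagonal entries read phi(2M+1). *)
Lemma hankel_block M B al be : mx_bounded_by B 1 -> cabs al <= 1 -> cabs be <= 1 ->
  cabs (\sum_(0 <= i < M) \sum_(0 <= j < M) B i j * hankel_symbol (i + j)%N +
    ((al + be) / 2 * phi (M + M)%N + (al - be) / 2 * phi (M + M).+1)) <= N.
Proof.
move=> bB al1 be1; set a := (al + be) / 2; set b := (al - be) / 2.
pose T := blockT M B (tridiag a b).
have bT : mx_bounded_by T 1 by exact: blockT_bounded bB (tridiag_bounded al1 be1).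
have symb0 i j : (M.+2 <= i)%N || (M.+2 <= j)%N -> diagonal_diff T i j = 0.
  rewrite /diagonal_diff /T /blockT /tridiag; move=> h.
  case: i h => [|i] h; case: j h => [|j] h //=.
  - have -> : (j.+1 < M)%N = false by lia.
    rewrite andbF subr0; case: ifP => // _; rewrite !eqSS.
    have -> : (j == 0)%N = false by lia.
    by rewrite !mulr0n addr0 !mulr0 addr0.
  - have -> : (i.+1 < M)%N = false by lia.
    rewrite /= subr0; case: ifP => // _; rewrite !eqSS.
    have -> : (i == 0)%N = false by lia.
    by rewrite !mulr0n addr0 !mulr0 addr0.
  have -> : (i.+1 < M)%N && (j.+1 < M)%N = false by lia.
  have -> : (i < M)%N && (j < M)%N = false by lia.
  have [/andP[Mi Mj]|ij] := boolP ((M <= i)%N && (M <= j)%N).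
    by rewrite !leqW // !eqSS subrr.
  case: ifP => ij1; rewrite subr0 // !eqSS.
  have -> : (i == j)%N = false by lia.
  have -> : (i == j.+1)%N = false by lia.
  have -> : (j == i.+1)%N = false by lia.
  by rewrite !mulr0n addr0 !mulr0 addr0.
have := symbol_bound bT symb0; rewrite diagonal_diff_sum.
set L := (X in cabs X <= _ -> _); suff -> : L =
  \sum_(0 <= i < M) \sum_(0 <= j < M) B i j * hankel_symbol (i + j)%N +
    (a * phi (M + M)%N + b * phi (M + M).+1) by [].
rewrite /L {L}.
have TB i j : (i < M)%N -> (j < M)%N -> T i j = B i j.
  by move=> iM jM; rewrite /T /blockT iM jM.
have T0l i j : (i < M)%N -> (M <= j)%N -> T i j = 0.
  by move=> iM Mj; rewrite /T /blockT iM ltnNge Mj /= leqNgt iM.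
have T0r i j : (j < M)%N -> (M <= i)%N -> T i j = 0.
  by move=> iM Mj; rewrite /T /blockT iM ltnNge Mj /= [(M <= j)%N]leqNgt iM.
have TE i j : (M <= i)%N -> (M <= j)%N -> T i j = tridiag a b i j.
  by move=> iM Mj; rewrite /T /blockT ltnNge iM /= Mj.
have rect n (F : nat -> R[i]) : \sum_(0 <= i < M + n) \sum_(0 <= j < M + n) T i j * F (i +
  j)%N =
    \sum_(0 <= i < M) \sum_(0 <= j < M) B i j * F (i + j)%N +
    \sum_(M <= i < M + n) \sum_(M <= j < M + n) tridiag a b i j * F (i + j)%N.
  rewrite (big_cat_nat (n := M)) ?leq_addr //=; congr (_ + _).
    apply: eq_big_nat => i /andP[_ iM].
    rewrite (big_cat_nat (n := M)) ?leq_addr //= [X in _ + X](_ : _ = 0) ?addr0.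
      by apply: eq_big_nat => j /andP[_ jM]; rewrite TB.
    by rewrite big_nat big1 // => j /andP[Mj _]; rewrite T0l ?mul0r.
  apply: eq_big_nat => i /andP[Mi _].
  rewrite (big_cat_nat (n := M)) ?leq_addr //= [X in X + _](_ : _ = 0) ?add0r.
    by apply: eq_big_nat => j /andP[Mj _]; rewrite TE.
  by rewrite big_nat big1 // => j /andP[_ jM]; rewrite T0r ?mul0r.
have := rect 2%N phi; have := rect 1%N (fun n => phi n.+2).
rewrite addn2 addn1 => -> ->.
have s2 (F : nat -> R[i]) : \sum_(M <= i < M.+2) F i = F M + F M.+1.
  by rewrite big_nat_recr //= big_nat1.
rewrite !s2 !big_nat1 /tridiag !eqxx.
have -> : (M == M.+1) = false by lia.
have -> : (M.+1 == M) = false by lia.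
have -> : (M.+1 == M.+2) = false by lia.
have -> : (M == M.+2) = false by lia.
have -> : \sum_(0 <= i < M) \sum_(0 <= j < M) B i j * hankel_symbol (i + j)%N =
    \sum_(0 <= i < M) \sum_(0 <= j < M) B i j * phi (i + j)%N -
    \sum_(0 <= i < M) \sum_(0 <= j < M) B i j * phi (i + j).+2.
  rewrite -sumrB; apply: eq_bigr => i _; rewrite -sumrB; apply: eq_bigr => j _.
  by rewrite /hankel_symbol mulrBr.
by rewrite !mulr1n !mulr0n !addnS !addSn; field.
Qed.

(** Use a zero tail and put phases on the m-th off-diagonal, whose k-th entry reads h at 2k + m; m =
    0 and m = 1 together reach every index. *)
Lemma hankel_summable_step m n : \sum_(0 <= k < n) cabs (hankel_symbol (k + (k + m))%N) <= N.
Proof.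
have c0 : cabs (0 : R[i]) <= 1 by rewrite cabs0.
pose t i := if (i < n)%N then phase (hankel_symbol (i + (i + m))%N) else 0.
have t1 i : cabs (t i) <= 1 by rewrite /t; case: ifP; rewrite ?cabs_phase ?cabs0.
have := hankel_block (n + m) (band_bounded m t1) c0 c0; rewrite /t.
rewrite addr0 subr0 !mul0r !addr0.
rewrite (_ : \sum_(0 <= i < n + m) _ = (\sum_(0 <= k < n) cabs (hankel_symbol (k + (k +
  m))%N))%:C).
  by rewrite cabs_real ger0_norm ?sumr_ge0 // => *; exact: cabs_ge0.
rewrite (big_cat_nat (n := n)) ?leq_addr //= [X in _ + X](_ : _ = 0) ?addr0; last first.
  by rewrite big_nat big1 // => i /andP[ni _]; rewrite big1 // => j _;
    rewrite ltnNge ni /= mulr0 mul0r.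
rewrite rmorph_sum; apply: eq_big_nat => i /andP[_ ni] /=; rewrite ni.
rewrite -phaseP (bigD1_seq (i + m)%N) ?iota_uniq ?mem_index_iota ?ltn_add2r //= eqxx mul1r.
by rewrite big1 ?addr0 // => j ji; rewrite (negbTE ji) !mul0r.
Qed.

Lemma hankel_summable n : \sum_(0 <= k < n) cabs (hankel_symbol k) <= 2 * N.
Proof.
apply: (@le_trans _ _ (\sum_(0 <= k < n.*2) cabs (hankel_symbol k))).
  rewrite [leRHS](big_cat_nat (n := n)) //=; last by rewrite -addnn leq_addr.
  by rewrite lerDl sumr_ge0 // => *; exact: cabs_ge0.
rewrite (_ : \sum_(0 <= k < n.*2) _ = \sum_(0 <= k < n) cabs (hankel_symbol (k + (k + 0))%N) +
   \sum_(0 <= k < n) cabs (hankel_symbol (k + (k + 1))%N)).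
  by rewrite mulr_natl mulr2n lerD // hankel_summable_step.
rewrite -big_split /=; elim: n => [|n IH]; first by rewrite !big_geq.
by rewrite doubleS !big_nat_recr //= IH -addrA addn0 addn1 addnS addnn.
Qed.

(** The variation remaining after n, the supremum of the partial sums minus the n-th one, is the
    error fed to [nested_limit]. *)
Lemma summable_diff_cvg (f : nat -> R[i]) (C : R) :
  (forall n, \sum_(0 <= k < n) cabs (f k.+1 - f k) <= C) ->
  exists L, forall e, 0 < e -> exists n0, forall n, (n0 <= n)%N -> cabs (f n - L) <= e.
Proof.
move=> fC; pose S n := \sum_(0 <= k < n) cabs (f k.+1 - f k).
have SS : has_sup [set S n | n in [set: nat]].
  by split; [exists (S 0%N), 0%N|exists C => _ [n _ <-]; exact: fC].
set sig := sup [set S n | n in [set: nat]].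
have Ssig n : S n <= sig by apply: ub_le_sup; [exact: (proj2 SS)|exists n].
have ff n m : (n <= m)%N -> cabs (f m - f n) <= sig - S n.
  move=> nm; apply: (@le_trans _ _ (S m - S n)); last by rewrite lerB.
  rewrite -(telescope_sumr _ nm) /S (big_cat_nat (m := 0%N) (n := n) (p := m)) //= addrAC
    subrr add0r.
  exact: cabs_sum.
have [||a aP] := @nested_limit R (fun n => complex.Re (f n)) (fun n => sig - S n).
- by move=> n; rewrite subr_ge0.
- move=> n m /ff; apply: le_trans; apply: le_trans (Re_le_cabs _).
  by case: (f m) => ? ?; case: (f n).
have [||b bP] := @nested_limit R (fun n => complex.Im (f n)) (fun n => sig - S n).
- by move=> n; rewrite subr_ge0.
- move=> n m /ff; apply: le_trans; apply: le_trans (Im_le_cabs _).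
  by case: (f m) => ? ?; case: (f n).
exists (a +i* b) => e e0.
have [_ [n0 _ <-] lt] := sup_adherent (divr_gt0 e0 (ltr0Sn R 1)) SS.
exists n0 => n nn0; apply: le_trans (cabs_le_Re_Im _) _.
have Sn : S n0 <= S n.
  by rewrite /S (big_cat_nat (n := n0) (p := n)) //= lerDl sumr_ge0 // => *; exact: cabs_ge0.
have := aP n; have := bP n; rewrite -/sig in lt.
case: (f n) => x y /=; rewrite ![`|_ - x|]distrC ![`|_ - y|]distrC.
by move: lt Sn; lra.
Qed.

Lemma symbol_limits : exists cp cm : R[i], forall e, 0 < e ->
  exists n0, forall n, (n0 <= n)%N ->
    cabs (phi (n + n)%N - (cp + cm)) <= e /\ cabs (phi (n + n).+1 - (cp - cm)) <= e.
Proof.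
have [|L0 H0] := @summable_diff_cvg (fun n => phi (n + n)%N) N.
  move=> n; apply: le_trans (hankel_summable_step 0 n); apply: ler_sum => k _.
  by rewrite addn0 -cabsN opprB /hankel_symbol addnS addSn.
have [|L1 H1] := @summable_diff_cvg (fun n => phi (n + n).+1) N.
  move=> n; apply: le_trans (hankel_summable_step 1 n); apply: ler_sum => k _.
  by rewrite addn1 -cabsN opprB /hankel_symbol !addnS !addSn.
exists ((L0 + L1) / 2), ((L0 - L1) / 2) => e e0.
have [n0 h0] := H0 _ e0; have [n1 h1] := H1 _ e0.
exists (maxn n0 n1) => n; rewrite geq_max => /andP[a b]; split.
  by rewrite (_ : (L0 + L1) / 2 + (L0 - L1) / 2 = L0) ?h0 //; field.
by rewrite (_ : (L0 + L1) / 2 - (L0 - L1) / 2 = L1) ?h1 //; field.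
Qed.

Lemma restrict_bounded (B : nat -> nat -> R[i]) M (g : R[i]) : cabs g <= 1 ->
  mx_bounded_by B 1 ->
  mx_bounded_by (fun i j => if (i < M)%N && (j < M)%N then g * B i j else 0) 1.
Proof.
move=> g1 bB; have := blockT_bounded M (mx_bounded_le _ (mx_boundedZ g bB)) zero_bounded.
rewrite mulr1 => /(_ g1); congr mx_bounded_by.
by apply/funext => i; apply/funext => j; rewrite /blockT if_same.
Qed.

Lemma hankel_functional (cp cm : R[i]) M B :
  (forall e, 0 < e -> exists n0, forall n, (n0 <= n)%N ->
    cabs (phi (n + n)%N - (cp + cm)) <= e /\ cabs (phi (n + n).+1 - (cp - cm)) <= e) ->
  mx_bounded_by B 1 ->
  cabs (\sum_(0 <= i < M) \sum_(0 <= j < M) B i j * hankel_symbol (i + j)%N) +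
    cabs cp + cabs cm <= N.
Proof.
move=> lim bB; set S := \sum_(0 <= i < M) _.
apply/ler_addgt0Pr => e e0; have e20 : 0 < e / 2 by rewrite divr_gt0.
have [n0 /(_ (maxn n0 M) (leq_maxl _ _))[h0 h1]] := lim _ e20.
set K := maxn n0 M in h0 h1; have MK : (M <= K)%N by exact: leq_maxr.
(* With [al] and [be] the phases of c_+ and c_-, the corner term tends to al c_+ + be c_- = |c_+| +
   |c_-|. The block is padded by zeros to move the corner far out, and rotated by the phase of [S]
   so that the contributions add. *)
have := hankel_block K (restrict_bounded M (cabs_phase S) bB) (cabs_phase cp) (cabs_phase cm).
have -> : \sum_(0 <= i < K) \sum_(0 <= j < K)
    (if (i < M)%N && (j < M)%N then phase S * B i j else 0) * hankel_symbol (i + j)%N =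
      (cabs S)%:C.
  rewrite -phaseP mulr_sumr.
  rewrite (@sum_symb_widen _ M K (fun i j => (if (i < M)%N && (j < M)%N then phase S * B i j
    else 0) * hankel_symbol (i + j)%N)) //.
    apply: eq_big_nat => i /andP[_ iM]; rewrite mulr_sumr; apply: eq_big_nat => j /andP[_ jM].
    by rewrite iM jM mulrA.
  by move=> i j ij; case: ifP => h; rewrite ?mul0r //; move: ij h; lia.
set a := (_ + _) / 2; set b := (_ - _) / 2 => up.
have a1 : cabs a <= 1.
  rewrite /a cabsM (_ : cabs 2^-1 = 2^-1); last first.
    by rewrite cabsV -(rmorph_nat (real_complex R)) cabs_real ger0_norm.
  have := cabsD (phase cp) (phase cm); have := cabs_phase cp; have := cabs_phase cm; lra.
have b1 : cabs b <= 1.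
  rewrite /b cabsM (_ : cabs 2^-1 = 2^-1); last first.
    by rewrite cabsV -(rmorph_nat (real_complex R)) cabs_real ger0_norm.
  have := cabsB (phase cp) (phase cm); have := cabs_phase cp; have := cabs_phase cm; lra.
have E : (cabs S)%:C + (a * phi (K + K)%N + b * phi (K + K).+1) =
   (cabs S + cabs cp + cabs cm)%:C + (a * (phi (K + K)%N - (cp + cm)) +
       b * (phi (K + K).+1 - (cp - cm))).
  by rewrite !rmorphD /= -(phaseP cp) -(phaseP cm) /a /b; field.
have := cabsB ((cabs S)%:C + (a * phi (K + K)%N + b * phi (K + K).+1))
   (a * (phi (K + K)%N - (cp + cm)) + b * (phi (K + K).+1 - (cp - cm))).
rewrite {1}E addrK cabs_real ger0_norm ?addr_ge0 ?cabs_ge0 // => /le_trans; apply.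
apply: lerD => //; apply: le_trans (cabsD _ _) _; rewrite (cabsM a) (cabsM b).
have := ler_pM (cabs_ge0 _) (cabs_ge0 _) a1 h0.
have := ler_pM (cabs_ge0 _) (cabs_ge0 _) b1 h1.
lra.
Qed.

End HankelFunctional.

(** * Wallis coefficients *)

Section Wallis.
Variable R : realType.
Local Notation mu := (@lebesgue_measure R).

Lemma FTC_everywhere (F f : R -> R) (a b : R) : a < b -> continuous f ->
  (forall x : R, is_derive x 1 F (f x)) ->
  (\int[mu]_(x in `[a, b]) (f x)%:E = (F b - F a)%:E)%E.
Proof.
move=> ab cf dF; have cF : continuous F.
  by move=> x; apply: differentiable_continuous; apply/derivable1_diffP.
rewrite (@continuous_FTC2 R f F a b) //.
- by apply: continuous_subspaceT => x; exact: cf.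
- split; first by move=> x _.
  + by apply: cvg_at_right_filter; exact: cF.
  + by apply: cvg_at_left_filter; exact: cF.
- by move=> x _; rewrite derive1E derive_val.
Qed.

Lemma integrable_segment (f : R -> R) a b : continuous f ->
  mu.-integrable `[a, b] (EFin \o f).
Proof.
move=> cf; apply: continuous_compact_integrable; first exact: segment_compact.
by apply: continuous_subspaceT => x; exact: cf.
Qed.

Lemma continuous_cosX n : continuous (fun x : R => cos x ^+ n).
Proof.
by move=> x; apply: (@continuous_comp _ _ _ cos (fun y => y ^+ n));
  [exact: continuous_cos|exact: exprn_continuous].
Qed.

Definition wint n : R := \int[mu]_(x in `[0, (pi / 2 : R)]) (cos x ^+ n).

Let pi2_gt0 : 0 < pi / 2 :> R.
Proof. by rewrite divr_gt0 // pi_gt0. Qed.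

Lemma wint_le n : wint n.+1 <= wint n.
Proof.
apply: le_Rintegral => //; [exact: integrable_segment (@continuous_cosX _)| |].
  exact: integrable_segment (@continuous_cosX _).
move=> x; rewrite /= in_itv /= => /andP[x0 x1].
have c0 : 0 <= cos x.
  by apply: cos_ge0_pihalf; rewrite x1 andbT; apply: le_trans x0; rewrite oppr_le0 ltW.
by rewrite exprS ler_piMl ?exprn_ge0 ?cos_le1.
Qed.

Lemma wint0 : wint 0 = pi / 2.
Proof.
rewrite /wint /Rintegral (@FTC_everywhere id) ?subr0 //.
  exact: continuous_cosX.
Qed.

Lemma wint1 : wint 1 = 1.
Proof.
rewrite /wint /Rintegral (@FTC_everywhere sin) /= ?sin_pihalf ?sin0 ?subr0 //.
exact: continuous_cosX.
Qed.

(** The difference of the integrands is the derivative of sin cos^(n+1), which vanishes at both ends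
    of [0, pi/2]. *)
Lemma wint_rec n : n.+2%:R * wint n.+2 = n.+1%:R * wint n.
Proof.
pose f x : R := n.+2%:R * cos x ^+ n.+2 - n.+1%:R * cos x ^+ n.
pose F x : R := sin x * cos x ^+ n.+1.
have cf : continuous f.
  by move=> x; apply: cvgB; apply: cvgMl_tmp; exact: continuous_cosX.
have dF (x : R) : is_derive x 1 F (f x).
  have -> : F = sin * (cos ^+ n.+1) by apply/funext => y; rewrite /F /= exprfctE.
  apply: is_derive_eq.
  rewrite /GRing.scale /= ?exprfctE /f.
  have s2 : sin x * sin x = 1 - cos x * cos x by rewrite -!expr2 -(cos2Dsin2 x) addrAC subrr
    add0r.
  have -> : cos x ^+ n.+2 = cos x ^+ n * (cos x * cos x) by rewrite -expr2 -exprD addn2.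
  rewrite [cos x ^+ n.+1]exprSr.
  transitivity (cos x ^+ n * (cos x * cos x) - n.+1%:R * cos x ^+ n * (sin x * sin x)).
    by ring.
  by rewrite s2 -[n.+2%:R]natr1; ring.
have If : (\int[mu]_(x in `[0%R, (pi / 2)%R]) (f x)%:E = 0)%E.
  by rewrite (FTC_everywhere pi2_gt0 cf dF) /F cos_pihalf sin0 expr0n mul0r mulr0 subrr.
have ic m : mu.-integrable `[0, (pi / 2 : R)] (EFin \o (fun x => cos x ^+ m)).
  exact: integrable_segment (@continuous_cosX m).
have icZ m (r : R) : mu.-integrable `[0, (pi / 2 : R)] (EFin \o (fun x => r * cos x ^+ m)).
  by apply: integrable_segment => x; apply: cvgMl_tmp; exact: continuous_cosX.
apply/eqP; rewrite -subr_eq0 /wint -!RintegralZl //.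
by rewrite -RintegralB // /Rintegral If.
Qed.

(* The coefficient of t^n in (1 - t)^(-3/2), so that the convolution of [wallis]
   with itself gives the coefficients of (1 - t)^(-3). *)
Definition wallis n : R := \prod_(0 <= k < n) ((k.*2 + 3)%:R / (k.*2 + 2)%:R).

Lemma wallis0 : wallis 0 = 1.
Proof. by rewrite /wallis big_geq. Qed.

Lemma wallisS n : wallis n.+1 = wallis n * ((n.*2 + 3)%:R / (n.*2 + 2)%:R).
Proof. by rewrite /wallis big_nat_recr. Qed.

Lemma wallis_ge0 n : 0 <= wallis n.
Proof. by apply: prodr_ge0 => k _; rewrite divr_ge0 ?ler0n. Qed.

Lemma wallis_neq0 n : wallis n != 0.
Proof.
elim: n => [|n IH]; first by rewrite wallis0 oner_eq0.
by rewrite wallisS mulf_neq0 // mulf_neq0 ?invr_eq0 // pnatr_eq0 addnS.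
Qed.

Lemma wint_odd n : wint (n.*2 + 1) = (wallis n)^-1.
Proof.
elim: n => [|n IH]; first by rewrite wallis0 invr1 wint1.
have := wint_rec (n.*2 + 1); rewrite doubleS !addSn IH wallisS invfM invf_div.
rewrite -!addnS => /(canRL (mulKf _)) ->; last by rewrite pnatr_eq0 addnS.
by rewrite mulrA mulrC; congr (_ * _); exact: mulrC.
Qed.

Lemma wint_even n : wint (n.*2 + 2) = pi / 2 * wallis n / (n.*2 + 2)%:R.
Proof.
elim: n => [|n IH].
  have := wint_rec 0; rewrite wint0 mul1r wallis0 mulr1 => <-.
  by rewrite mulrC mulKf // pnatr_eq0.
have := wint_rec (n.*2 + 2); rewrite doubleS !addSn IH wallisS -!addnS.
move=> /(canRL (mulKf _)) ->; last by rewrite pnatr_eq0 addnS.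
rewrite mulrC; congr (_ * _); set P := pi / 2.
clearbody P; move: (_%:R : R) (_%:R^-1 : R) => b c.
by rewrite mulrC -!mulrA; congr (_ * (_ * _)); exact: mulrC.
Qed.

(** The integral of cos^(2n+2), equal to pi c_n / (4 (n+1)), is at most that of cos^(2n+1), equal to
    1/c_n. The constant 4/pi is asymptotically sharp. *)
Lemma wallis_sqr_le n : wallis n ^+ 2 * pi <= 4 * n.+1%:R.
Proof.
have := wint_le (n.*2 + 1); rewrite -addnS wint_odd wint_even.
have w0 : 0 < wallis n by rewrite lt_neqAle eq_sym wallis_neq0 wallis_ge0.
have -> : (n.*2 + 2)%N = (2 * n.+1)%N by lia.
have n0 : 0 < (2 * n.+1)%:R :> R by rewrite ltr0n.
rewrite ler_pdivrMr // => /(ler_wpM2l (ltW w0)).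
by rewrite (mulrA (wallis n) (wallis n)^-1) divff ?wallis_neq0 // mul1r natrM expr2; lra.
Qed.

(** A coefficient form of the differential equation of (1 - t)^(-3). Symmetry gives 2 A_n = n S_n,
    and (i+1) c_(i+1) = (i + 3/2) c_i gives A_(n+1) = A_n + (3/2) S_n; together (n+1) S_(n+1) =
    (n+3) S_n. *)
Lemma wallis_conv n : \sum_(0 <= i < n.+1) wallis i * wallis (n - i)%N = n.+1%:R * n.+2%:R / 2.
Proof.
pose S n := \sum_(0 <= i < n.+1) wallis i * wallis (n - i)%N.
pose A n := \sum_(0 <= i < n.+1) i%:R * (wallis i * wallis (n - i)%N).
have sym m : 2 * A m = m%:R * S m.
  rewrite mulr_natl mulr2n {2}/A big_nat_rev -big_split mulr_sumr /=.
  apply: eq_big_nat => i /andP[_ im]; rewrite add0n subSS subKn //.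
  by rewrite [wallis (m - i) * _]mulrC -mulrDl -natrD subnKC.
have rec m : A m.+1 = A m + 3 / 2 * S m.
  rewrite {1}/A big_nat_recl // mul0r add0r /A /S mulr_sumr -big_split /=.
  apply: eq_big_nat => i _; rewrite subSS wallisS.
  have -> : i.+1%:R = (i.*2 + 2)%:R / 2 :> R.
    by rewrite (_ : (i.*2 + 2)%N = (i.+1 * 2)%N) ?natrM ?mulfK //; lia.
  have -> : (i.*2 + 3)%:R = 2 * i%:R + 3 :> R by rewrite natrD -mul2n natrM.
  have : (i.*2 + 2)%:R != 0 :> R by rewrite pnatr_eq0; lia.
  by move=> h; field.
rewrite -/(S n); elim: n => [|n IH].
  by rewrite /S big_nat1 wallis0 !mulr1 mul1r divff.
have e : n.+1%:R * S n.+1 = n.+3%:R * S n.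
  rewrite -sym rec mulrDr sym -[n.+3%:R](_ : n%:R + 3 = _) ?mulrDl;
    last by rewrite -natrD addn3.
  by field.
apply: (mulfI (_ : n.+1%:R != 0)); first by rewrite pnatr_eq0.
by rewrite e IH; ring.
Qed.

End Wallis.

(** * Integration of complex functions *)

Section ComplexIntegral.
Context d (T : measurableType d) (R : realType).
Variables (mu : {measure set T -> \bar R}) (D : set T).
Hypothesis mD : measurable D.
Implicit Types (f g : T -> R[i]) (b : T -> R).

Definition cmeas f :=
  measurable_fun D (fun x => complex.Re (f x)) /\
  measurable_fun D (fun x => complex.Im (f x)).

Definition cintegrable f :=
  cmeas f /\ mu.-integrable D (fun x => (cabs (f x))%:E).

Definition CI f : R[i] :=
  (\int[mu]_(x in D) complex.Re (f x)) +i* (\int[mu]_(x in D) complex.Im (f x)).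

Lemma cmeas_cst (c : R[i]) : cmeas (fun _ => c).
Proof. by split; exact: measurable_cst. Qed.

Lemma cmeasD f g : cmeas f -> cmeas g -> cmeas (fun x => f x + g x).
Proof.
move=> [a b] [c e]; split.
  by under eq_fun do rewrite ReD; exact: measurable_funD.
by under eq_fun do rewrite ImD; exact: measurable_funD.
Qed.

Lemma cmeasM f g : cmeas f -> cmeas g -> cmeas (fun x => f x * g x).
Proof.
move=> [a b] [c e]; split.
  by under eq_fun do rewrite ReM; apply: measurable_funB; exact: measurable_funM.
by under eq_fun do rewrite ImM; apply: measurable_funD; exact: measurable_funM.
Qed.

Lemma cmeasX f n : cmeas f -> cmeas (fun x => f x ^+ n).
Proof.
move=> mf; elim: n => [|n IH]; first exact: cmeas_cst.
by under eq_fun do rewrite exprS; exact: cmeasM.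
Qed.

Lemma cmeas_conj f : cmeas f -> cmeas (fun x => conjc (f x)).
Proof.
move=> [a b]; split.
  by rewrite (_ : (fun x => _) = (fun x => complex.Re (f x))) //; apply/funext => x;
    case: (f x).
rewrite (_ : (fun x => _) = (fun x => - complex.Im (f x))).
  exact: measurableT_comp.
by apply/funext => x; case: (f x).
Qed.

Lemma cmeas_real b : measurable_fun D b -> cmeas (fun x => (b x)%:C).
Proof. by move=> mb; split => //=; exact: measurable_cst. Qed.

Lemma cmeas_sum (I : Type) (s : seq I) (F : I -> T -> R[i]) :
  (forall i, cmeas (F i)) -> cmeas (fun x => \sum_(i <- s) F i x).
Proof.
move=> mF; elim: s => [|i s IH].
  by under eq_fun do rewrite big_nil; exact: cmeas_cst.
by under eq_fun do rewrite big_cons; exact: cmeasD.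
Qed.

Lemma measurable_cabs f : cmeas f -> measurable_fun D (fun x => cabs (f x)).
Proof.
move=> [a b]; apply: (measurableT_comp (f := @Num.sqrt R)).
  by apply: continuous_measurable_fun; exact: sqrt_continuous.
by apply: measurable_funD; exact: measurable_funX.
Qed.

(** 1/f = |f|^(-2) conj f, also at zeros of f, where both sides are 0; the real factor is a real
    power. *)
Lemma cmeas_inv f : cmeas f -> cmeas (fun x => (f x)^-1).
Proof.
move=> mf; have minv : measurable_fun D (fun x => (cabs (f x) ^+ 2)^-1).
  rewrite (_ : (fun x => _) = (fun x => cabs (f x) `^ (-2))).
    apply: (measurableT_comp (f := fun y : R => y `^ (-2))); last exact: measurable_cabs.
    exact: measurable_powR.
  by apply/funext => x; rewrite powRN powR_mulrn ?cabs_ge0.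
rewrite (_ : (fun x => _) = (fun x => ((cabs (f x) ^+ 2)^-1)%:C * conjc (f x))).
  by apply: cmeasM; [exact: cmeas_real|exact: cmeas_conj].
apply/funext => x; have [->|f0] := eqVneq (f x) 0; first by rewrite invr0 conjc0 mulr0.
apply: (mulIf f0); rewrite mulVf // -mulrA mul_conj -rmorphM /= mulVf //.
by rewrite expf_neq0 // gt_eqF // cabs_gt0.
Qed.

Lemma cmeas_cvg (F : nat -> T -> R[i]) f : (forall n, cmeas (F n)) ->
  (forall x, D x -> complex.Re (F n x) @[n --> \oo] --> complex.Re (f x)) ->
  (forall x, D x -> complex.Im (F n x) @[n --> \oo] --> complex.Im (f x)) ->
  cmeas f.
Proof.
move=> mF fR fI; split.
  by apply: (measurable_fun_cvg (h := fun n x => complex.Re (F n x))) => // n; case: (mF n).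
by apply: (measurable_fun_cvg (h := fun n x => complex.Im (F n x))) => // n; case: (mF n).
Qed.

Lemma cintegrable_Re f : cintegrable f ->
  mu.-integrable D (EFin \o (fun x => complex.Re (f x))).
Proof.
move=> [[mR mI] i]; apply: le_integrable i => //; first exact/measurable_EFinP.
by move=> x _ /=; rewrite lee_fin (ger0_norm (cabs_ge0 _)) Re_le_cabs.
Qed.

Lemma cintegrable_Im f : cintegrable f ->
  mu.-integrable D (EFin \o (fun x => complex.Im (f x))).
Proof.
move=> [[mR mI] i]; apply: le_integrable i => //; first exact/measurable_EFinP.
by move=> x _ /=; rewrite lee_fin (ger0_norm (cabs_ge0 _)) Im_le_cabs.
Qed.

Lemma cintegrable_le f b : cmeas f -> (forall x, D x -> cabs (f x) <= b x) ->
  mu.-integrable D (EFin \o b) -> cintegrable f.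
Proof.
move=> mf fb ib; split=> //; apply: le_integrable ib => //.
  by apply/measurable_EFinP; exact: measurable_cabs.
move=> x Dx /=; rewrite lee_fin !ger0_norm ?cabs_ge0 ?fb //.
exact: le_trans (cabs_ge0 _) (fb _ Dx).
Qed.

Lemma cintegrableD f g : cintegrable f -> cintegrable g ->
  cintegrable (fun x => f x + g x).
Proof.
move=> [mf If] [mg ig]; apply: (@cintegrable_le _ (fun x => cabs (f x) + cabs (g x))).
- exact: cmeasD.
- by move=> x _; exact: cabsD.
- exact: integrableD If ig.
Qed.

Lemma cintegrableZ (c : R[i]) f : cintegrable f -> cintegrable (fun x => c * f x).
Proof.
move=> [mf If]; apply: (@cintegrable_le _ (fun x => cabs c * cabs (f x))).
- by apply: cmeasM => //; exact: cmeas_cst.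
- by move=> x _; rewrite cabsM.
- by have := integrableZl mD (cabs c) If; under eq_fun do rewrite -EFinM.
Qed.

Lemma cintegrable0 : cintegrable (fun _ => 0).
Proof.
split; first exact: cmeas_cst.
by under eq_fun do rewrite cabs0; exact: integrable0.
Qed.

Lemma cintegrable_sum (I : Type) (s : seq I) (F : I -> T -> R[i]) :
  (forall i, cintegrable (F i)) -> cintegrable (fun x => \sum_(i <- s) F i x).
Proof.
move=> mF; elim: s => [|i s IH].
  by under eq_fun do rewrite big_nil; exact: cintegrable0.
by under eq_fun do rewrite big_cons; exact: cintegrableD.
Qed.

Lemma CID f g : cintegrable f -> cintegrable g ->
  CI (fun x => f x + g x) = CI f + CI g.
Proof.
move=> If ig; apply: eq_Re_Im; rewrite /= ?ReD ?ImD /=.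
  under eq_Rintegral do rewrite ReD.
  by rewrite RintegralD //; exact: cintegrable_Re.
under eq_Rintegral do rewrite ImD.
by rewrite RintegralD //; exact: cintegrable_Im.
Qed.

Lemma CIZ (c : R[i]) f : cintegrable f -> CI (fun x => c * f x) = c * CI f.
Proof.
move=> If; have iR := cintegrable_Re If; have iI := cintegrable_Im If.
have iZ (r : R) (k : T -> R) : mu.-integrable D (EFin \o k) ->
    mu.-integrable D (EFin \o (fun x => r * k x)).
  by move=> ik; have := integrableZl mD r ik; under eq_fun do rewrite -EFinM.
apply: eq_Re_Im; rewrite /= ?ReM ?ImM /=.
  under eq_Rintegral do rewrite ReM.
  rewrite RintegralB //; [|exact: iZ|exact: iZ].
  by rewrite !RintegralZl.
under eq_Rintegral do rewrite ImM.
rewrite RintegralD //; [|exact: iZ|exact: iZ].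
by rewrite !RintegralZl.
Qed.

Lemma CI0 : CI (fun _ => 0) = 0.
Proof. by rewrite /CI /= !Rintegral_cst // !mul0r. Qed.

Lemma CI_sum (I : Type) (s : seq I) (F : I -> T -> R[i]) :
  (forall i, cintegrable (F i)) ->
  CI (fun x => \sum_(i <- s) F i x) = \sum_(i <- s) CI (F i).
Proof.
move=> mF; elim: s => [|i s IH].
  by under [in LHS]eq_fun do rewrite big_nil; rewrite big_nil CI0.
under [in LHS]eq_fun do rewrite big_cons.
by rewrite big_cons CID ?IH //; exact: cintegrable_sum.
Qed.

Lemma eq_CI f g : (forall x, D x -> f x = g x) -> CI f = CI g.
Proof.
move=> fg; apply: eq_Re_Im => /=; apply: eq_Rintegral => x;
  by rewrite inE => /fg ->.
Qed.

Lemma CI_real b : CI (fun x => (b x)%:C) = (\int[mu]_(x in D) b x)%:C.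
Proof.
by apply: eq_Re_Im => //=; rewrite /Rintegral integral0.
Qed.

(** Multiplying by the phase of the integral makes it real without enlarging the modulus of the
    integrand. *)
Lemma cabs_CI_le f : cintegrable f ->
  cabs (CI f) <= \int[mu]_(x in D) cabs (f x).
Proof.
move=> If; rewrite -[cabs _]/(complex.Re (cabs (CI f))%:C) -phaseP -CIZ //=.
apply: le_Rintegral => //; [exact: cintegrable_Re (cintegrableZ _ If)|by case: If|].
move=> x _; apply: le_trans (ler_norm _) _; apply: le_trans (Re_le_cabs _) _.
by rewrite cabsM ler_piMl ?cabs_ge0 // cabs_phase.
Qed.

Lemma Rintegral_dominated (F : nat -> T -> R) (f b : T -> R) :
  (forall n, measurable_fun D (F n)) ->
  (forall x, D x -> F n x @[n --> \oo] --> f x) ->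
  (forall n x, D x -> `|F n x| <= b x) -> mu.-integrable D (EFin \o b) ->
  \int[mu]_(x in D) F n x @[n --> \oo] --> \int[mu]_(x in D) f x.
Proof.
move=> mF Ff Fb ib; have mf : measurable_fun D f.
  exact: (measurable_fun_cvg (h := F)).
have [|||||If _ h] := @dominated_convergence _ _ _ mu D mD
    (fun n x => (F n x)%:E) (fun x => (f x)%:E) (EFin \o b).
- by move=> n; apply/measurable_EFinP.
- exact/measurable_EFinP.
- by apply: aeW => x Dx; apply: cvg_EFin; [exact: nearW|exact: Ff].
- by [].
- by apply: aeW => x n Dx; rewrite /= lee_fin Fb.
by apply: fine_cvg; rewrite fineK //; exact: integrable_fin_num.
Qed.

Lemma CI_dominated (F : nat -> T -> R[i]) f b : (forall n, cmeas (F n)) ->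
  (forall x, D x -> complex.Re (F n x) @[n --> \oo] --> complex.Re (f x)) ->
  (forall x, D x -> complex.Im (F n x) @[n --> \oo] --> complex.Im (f x)) ->
  (forall n x, D x -> cabs (F n x) <= b x) ->
  mu.-integrable D (EFin \o b) ->
  [/\ cmeas f, complex.Re (CI (F n)) @[n --> \oo] --> complex.Re (CI f) &
      complex.Im (CI (F n)) @[n --> \oo] --> complex.Im (CI f)].
Proof.
move=> mF fR fI Fb ib; have mf := cmeas_cvg mF fR fI; split=> //=.
- apply: (@Rintegral_dominated _ _ b) => //; first by move=> n; case: (mF n).
  by move=> n x Dx; exact: le_trans (Re_le_cabs _) (Fb _ _ Dx).
- apply: (@Rintegral_dominated _ _ b) => //; first by move=> n; case: (mF n).
  by move=> n x Dx; exact: le_trans (Im_le_cabs _) (Fb _ _ Dx).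
Qed.

End ComplexIntegral.

(** * Normalized area measure on the disc *)

Section PolarMeasure.
Variable R : realType.

Lemma bounded_integrable_finite d (T : measurableType d) (mu : {measure set T -> \bar R})
  (D : set T) (f : T -> R) (C : R) : measurable D -> (mu D < +oo)%E ->
  measurable_fun D f -> (forall x, D x -> `|f x| <= C) ->
  mu.-integrable D (EFin \o f).
Proof.
move=> mD muD mf fC; apply: measurable_bounded_integrable => //.
exists C; split; first exact: num_real.
by move=> M CM x Dx; exact: le_trans (fC _ Dx) (ltW CM).
Qed.

Lemma probability_lty d (T : measurableType d) (P : probability T R) :
  (P setT < +oo)%E.
Proof. by rewrite probability_setT ltry. Qed.

Lemma two_pi_gt0 : 0 < 2 * pi :> R.
Proof. by rewrite mulr_gt0 // pi_gt0. Qed.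

Local Notation MR := (measurableTypeR R).

Definition radial : probability MR R := uniform_prob (@ltr01 R).
Definition angular : probability MR R := uniform_prob two_pi_gt0.

Lemma angular_integral0 (f G : R -> R) : continuous f -> (forall x, `|f x| <= 1) ->
  (forall x : R, is_derive x 1 G (f x)) -> G (2 * pi) = G 0 ->
  (\int[angular]_x (f x)%:E = 0)%E.
Proof.
move=> cf f1 dG G0.
have mf : measurable_fun setT (f : MR -> R) by exact: continuous_measurable_fun.
(* Adding 1 gives the nonnegative integrand that the formula for the uniform law asks for; the 1 is
   subtracted at the end. *)
have f1' x : 0 <= 1 + f x by have := f1 x; rewrite ler_norml => /andP[? ?]; lra.
have mf1 : measurable_fun setT (fun x : MR => (1 + f x)%:E).
  by apply/measurable_EFinP; exact: measurable_funD.
have e1 : (\int[angular]_x (1 + f x)%:E = 1)%E.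
  rewrite integral_uniform //.
  rewrite (@FTC_everywhere R (fun x => x + G x) (fun x => 1 + f x) _ _ two_pi_gt0).
  - rewrite G0 subr0 -EFinM; congr _%:E.
    by rewrite add0r addrK mulVf // gt_eqF // two_pi_gt0.
  - by move=> x; apply: cvgD; [exact: cvg_cst|exact: cf].
have i1 : angular.-integrable setT (EFin \o (fun _ : MR => 1 : R)).
  by apply: (@bounded_integrable_finite _ _ _ _ _ 1) => //;
    [exact: probability_lty|move=> x _; rewrite normr1].
have i2 : angular.-integrable setT (EFin \o f).
  by apply: (@bounded_integrable_finite _ _ _ _ _ 1) => //; exact: probability_lty.
have h : (\int[angular]_x (1 + f x)%:E =
    \int[angular]_x (1 : R)%:E + \int[angular]_x (f x)%:E)%E.
  exact: (integralD measurableT i1 i2).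
have c1 : (\int[angular]_x (1 : R)%:E = 1)%E.
  by rewrite integral_cst // mul1e; exact: probability_setT.
have fn : (\int[angular]_x (f x)%:E)%E \is a fin_num := integrable_fin_num measurableT i2.
move: h; rewrite e1 c1 -(fineK fn) -EFinD => -[] h; congr _%:E; move: h; lra.
Qed.

(** For t uniform on [0, 1] the radius sqrt t has the area density 2 r dr. The value 0 for t >= 1, a
    null event, keeps every image point in the open disc. *)
Definition rho (t : MR) : R := if t < 1 then Num.sqrt t else 0.

Definition polar (x : MR * MR) : R * R := (rho x.1 * cos x.2, rho x.1 * sin x.2).

Lemma rho_ge0 t : 0 <= rho t.
Proof. by rewrite /rho; case: ifP => // _; exact: sqrtr_ge0. Qed.

Lemma rho_lt1 t : rho t < 1.
Proof.
rewrite /rho; case: ifP => // t1; have [t0|t0] := lerP 0 t.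
  by rewrite -sqrtr1 ltr_sqrt.
by rewrite ler0_sqrtr ?ltr01 // ltW.
Qed.

Lemma measurable_rho : measurable_fun setT rho.
Proof.
apply: measurable_fun_ifT.
- exact: measurable_fun_ltr.
- by apply: continuous_measurable_fun; exact: sqrt_continuous.
- exact: measurable_cst.
Qed.

Lemma measurable_cos_fun : measurable_fun setT (@cos R : MR -> R).
Proof. by apply: continuous_measurable_fun; exact: continuous_cos. Qed.

Lemma measurable_sin_fun : measurable_fun setT (@sin R : MR -> R).
Proof. by apply: continuous_measurable_fun; exact: continuous_sin. Qed.

Lemma measurable_polar : measurable_fun setT polar.
Proof.
apply/measurable_fun_pairP; split; apply: measurable_funM.
- exact: (measurableT_comp measurable_rho measurable_fst).
- exact: (measurableT_comp measurable_cos_fun measurable_snd).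
- exact: (measurableT_comp measurable_rho measurable_fst).
- exact: (measurableT_comp measurable_sin_fun measurable_snd).
Qed.

Lemma polar_disc x : (@disc R) (polar x).
Proof.
rewrite /disc /= !exprMn -mulrDr cos2Dsin2 mulr1.
by rewrite expr_lt1 ?rho_ge0 // rho_lt1.
Qed.

Lemma measurable_disc : measurable (@disc R).
Proof.
rewrite (_ : @disc R = setT `&` (fun p => p.1 ^+ 2 + p.2 ^+ 2 < 1) @^-1` [set true]).
  have : measurable_fun setT (fun p : R * R => p.1 ^+ 2 + p.2 ^+ 2 < 1).
    apply: measurable_fun_ltr; last exact: measurable_cst.
    by apply: measurable_funD; apply: measurable_funX;
      [exact: measurable_fst|exact: measurable_snd].
  by apply.
by apply/seteqP; split=> p /=; [|case].
Qed.

Lemma expi_pow (x : R) n : (cos x +i* sin x) ^+ n = cos (n%:R * x) +i* sin (n%:R * x).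
Proof.
elim: n => [|n IH]; first by rewrite expr0 mul0r cos0 sin0.
rewrite exprS IH -natr1 mulrDl mul1r addrC cosD sinD.
by apply: eq_Re_Im => //=; rewrite addrC.
Qed.

Lemma polar_monomial (x : MR * MR) m n :
  toC (polar x) ^+ m * conjc (toC (polar x)) ^+ n =
  (rho x.1 ^+ (m + n))%:C * (cos ((m%:R - n%:R) * x.2) +i* sin ((m%:R - n%:R) * x.2)).
Proof.
have -> : toC (polar x) = (rho x.1)%:C * (cos x.2 +i* sin x.2).
  by apply: eq_Re_Im => /=; ring.
rewrite conjcM (_ : conjc (rho x.1)%:C = (rho x.1)%:C); last by rewrite /= oppr0.
rewrite !exprMn -conjcX !expi_pow mulrACA -exprD rmorphXn; congr (_ * _).
rewrite mulrBl cosB sinB; apply: eq_Re_Im => /=; ring.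
Qed.

Lemma two_pi_period m n :
  cos ((m%:R - n%:R) * (2 * pi)) = 1 :> R /\ sin ((m%:R - n%:R) * (2 * pi)) = 0 :> R.
Proof.
have e k : cos (k%:R * (2 * pi)) = 1 :> R /\ sin (k%:R * (2 * pi)) = 0 :> R.
  have := expi_pow (2 * pi) k; rewrite mulr_natl cos2pi sin2pi => h.
  have : (1 +i* 0 : R[i]) ^+ k = 1 by rewrite expr1n.
  by rewrite h => -[].
have [[cm sm] [cn sn]] := (e m, e n).
by rewrite mulrBl cosB sinB cm sm cn sn; split; ring.
Qed.

Lemma angular_cos m n : m != n ->
  (\int[angular]_x (cos ((m%:R - n%:R) * x))%:E = 0)%E.
Proof.
move=> mn; have k0 : m%:R - n%:R != 0 :> R by rewrite subr_eq0 eqr_nat.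
have [_ s0] := two_pi_period m n; set k := m%:R - n%:R in k0 s0 *.
apply: (@angular_integral0 _ (fun x => k^-1 * sin (k * x))).
- move=> x; apply: (@continuous_comp _ _ _ (fun y => k * y) cos).
    by apply: cvgMl_tmp; exact: cvg_id.
  exact: continuous_cos.
- by move=> x; rewrite ler_norml cos_geN1 cos_le1.
- move=> x; have -> : (fun y => k^-1 * sin (k * y)) = k^-1 *: (sin \o (fun y => k * y)).
    by apply/funext => y.
  have dk : is_derive x 1 (fun y : R => k * y) k.
    have : is_derive x 1 (k *: (id : R -> R)) (k *: 1) by exact: is_deriveZ.
    by rewrite /GRing.scale /= mulr1.
  have := is_deriveZ k^-1 (is_derive1_comp (is_derive_sin (k * x)) dk).
  by rewrite /GRing.scale /= mulrCA mulVf // mulr1.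
- by rewrite s0 !mulr0 sin0 mulr0.
Qed.

Lemma angular_sin m n : (\int[angular]_x (sin ((m%:R - n%:R) * x))%:E = 0)%E.
Proof.
have [->|mn] := eqVneq m n.
  by under eq_integral do rewrite subrr mul0r sin0; rewrite integral0.
have k0 : m%:R - n%:R != 0 :> R by rewrite subr_eq0 eqr_nat.
have [c1 _] := two_pi_period m n; set k := m%:R - n%:R in k0 c1 *.
apply: (@angular_integral0 _ (fun x => - k^-1 * cos (k * x))).
- move=> x; apply: (@continuous_comp _ _ _ (fun y => k * y) sin).
    by apply: cvgMl_tmp; exact: cvg_id.
  exact: continuous_sin.
- by move=> x; rewrite ler_norml sin_geN1 sin_le1.
- move=> x; have -> : (fun y => - k^-1 * cos (k * y)) = (- k^-1) *: (cos \o (fun y => k * y)).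
    by apply/funext => y.
  have dk : is_derive x 1 (fun y : R => k * y) k.
    have : is_derive x 1 (k *: (id : R -> R)) (k *: 1) by exact: is_deriveZ.
    by rewrite /GRing.scale /= mulr1.
  have := is_deriveZ (- k^-1) (is_derive1_comp (is_derive_cos (k * x)) dk).
  by rewrite /GRing.scale /= !mulNr mulrN opprK mulrCA mulVf // mulr1.
- by rewrite c1 mulr0 cos0.
Qed.

Lemma radial_moment n : (\int[radial]_t (rho t ^+ (n + n))%:E = (n.+1%:R^-1)%:E)%E.
Proof.
have mr : measurable_fun setT (fun t => (rho t ^+ (n + n))%:E).
  by apply/measurable_EFinP; apply: measurable_funX; exact: measurable_rho.
rewrite integral_uniform //; last by move=> t; rewrite lee_fin exprn_ge0 // rho_ge0.
rewrite subr0 invr1 mul1e -integral_itv_bndo_bndc; last exact: measurable_funTS.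
transitivity (\int[@lebesgue_measure R]_(t in `[0%R, 1%R[) (t ^+ n)%:E)%E.
  apply: eq_integral => t; rewrite inE /= in_itv /= => /andP[t0 t1].
  by rewrite /rho t1 exprD -exprMn -expr2 sqr_sqrtr.
rewrite integral_itv_bndo_bndc; last first.
  by apply/measurable_EFinP; exact: measurable_funX.
have dF (x : R) : is_derive x 1 (fun t : R => n.+1%:R^-1 * t ^+ n.+1) (x ^+ n).
  have -> : (fun t : R => n.+1%:R^-1 * t ^+ n.+1) = n.+1%:R^-1 *: (id ^+ n.+1).
    by apply/funext => y; rewrite /GRing.scale /= exprfctE.
  have := is_deriveZ n.+1%:R^-1 (is_deriveX n.+1 (is_derive_id x (1 : R))).
  by rewrite /GRing.scale /= mulr1 mulKf // pnatr_eq0.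
rewrite (FTC_everywhere ltr01 (@exprn_continuous _ n) dF).
by rewrite expr1n expr0n mulr0 subr0 mulr1.
Qed.

Definition polar_prob : probability (MR * MR)%type R := (radial \x angular)%E.

(** Area measure divided by pi, as the image of two independent uniform laws. By Fubini a moment is
    a radial factor times the mean of exp(i (m - n) t), which is 0 for m <> n. Later arguments use
    only finiteness and these moments. *)
Lemma polar_measure : exists nu : {measure set (R * R)%type -> \bar R},
  (nu (@disc R) < +oo)%E /\
  forall m n, CI nu (@disc R) (fun p => toC p ^+ m * conjc (toC p) ^+ n) =
    if m == n then (n.+1%:R^-1)%:C else 0.
Proof.
pose nu0 : {measure set (R * R)%type -> \bar R} := pushforward polar_prob polar.
pose nu := nu0 measurable_polar.
have preT : polar @^-1` (@disc R) = setT.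
  by apply/seteqP; split=> x // _; exact: polar_disc.
exists nu; split.
  by rewrite /nu /nu0 /= /pushforward preT probability_setT ltry.
have push (f : R * R -> R) : measurable_fun setT f -> (forall x, `|f (polar x)| <= 1) ->
    \int[nu]_(p in @disc R) f p = \int[polar_prob]_x f (polar x).
  move=> mf f1; have bi : polar_prob.-integrable setT (EFin \o (f \o polar)).
    apply: (@bounded_integrable_finite _ _ _ _ (f \o polar) 1) => //.
      exact: probability_lty.
      exact: (measurableT_comp mf measurable_polar).
    by move=> x _; exact: f1.
  rewrite /Rintegral; congr fine.
  have mf' : measurable_fun setT (EFin \o f) by exact/measurable_EFinP.
  rewrite -preT in bi.
  apply: etrans (integral_pushforward measurable_polar mf' bi measurable_disc) _.
  by rewrite preT.
have prod (g k : MR -> R) : measurable_fun setT g -> measurable_fun setT k ->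
    (forall x, `|g x| <= 1) -> (forall x, `|k x| <= 1) ->
    (\int[polar_prob]_x (g x.1 * k x.2)%:E =
      (\int[radial]_t (g t)%:E) * (\int[angular]_x (k x)%:E))%E.
  move=> mg mk g1 k1.
  have mgk : measurable_fun setT (fun x : MR * MR => g x.1 * k x.2).
    apply: measurable_funM.
      exact: (measurableT_comp mg measurable_fst).
    exact: (measurableT_comp mk measurable_snd).
  have ik : angular.-integrable setT (EFin \o k).
    by apply: (@bounded_integrable_finite _ _ _ _ k 1) => //; exact: probability_lty.
  have ig : radial.-integrable setT (EFin \o g).
    by apply: (@bounded_integrable_finite _ _ _ _ g 1) => //; exact: probability_lty.
  have igk : polar_prob.-integrable setT (EFin \o (fun x : MR * MR => g x.1 * k x.2)).
    apply: (@bounded_integrable_finite _ _ _ _ _ 1) => //; first exact: probability_lty.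
    by move=> x _; rewrite normrM mulr_ile1 ?g1 ?k1.
  apply: etrans (esym (integral12_prod_meas1 igk)) _.
  have fk : (\int[angular]_x (k x)%:E)%E \is a fin_num := integrable_fin_num measurableT ik.
  transitivity (\int[radial]_t (fine (\int[angular]_x (k x)%:E)%E * g t)%:E)%E.
    apply: eq_integral => t _; apply: etrans (integralZl measurableT ik (g t)) _.
    by rewrite mulrC EFinM fineK.
  by apply: etrans (integralZl measurableT ig _) _; rewrite fineK // muleC.
move=> m n.
have mz : cmeas setT (fun p : R * R => toC p ^+ m * conjc (toC p) ^+ n).
  have mt : cmeas setT (fun p : R * R => toC p).
    by split; [exact: measurable_fst|exact: measurable_snd].
  by apply: cmeasM; apply: cmeasX => //; exact: cmeas_conj.
have z1 x : cabs (toC (polar x) ^+ m * conjc (toC (polar x)) ^+ n) <= 1.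
  rewrite cabsM !cabsX cabs_conj -exprD exprn_ile1 ?cabs_ge0 //.
  rewrite -sqrtr1 /cabs ler_wsqrtr //= ltW //; exact: (polar_disc x).
have rho1 t : `|rho t ^+ (m + n)| <= 1.
  by rewrite ger0_norm ?exprn_ge0 ?rho_ge0 // exprn_ile1 ?rho_ge0 // ltW // rho_lt1.
have mrho : measurable_fun setT (fun t => rho t ^+ (m + n)).
  by apply: measurable_funX; exact: measurable_rho.
pose k : R := m%:R - n%:R.
have ck : continuous (fun x : R => k * x) by move=> x; apply: cvgMl_tmp; exact: cvg_id.
have mcos : measurable_fun setT (fun x : MR => cos (k * x)).
  by apply: continuous_measurable_fun => x; apply: (continuous_comp (ck x));
    exact: continuous_cos.
have msin : measurable_fun setT (fun x : MR => sin (k * x)).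
  by apply: continuous_measurable_fun => x; apply: (continuous_comp (ck x));
    exact: continuous_sin.
have cos1 x : `|cos (k * x)| <= 1 by rewrite ler_norml cos_geN1 cos_le1.
have sin1 x : `|sin (k * x)| <= 1 by rewrite ler_norml sin_geN1 sin_le1.
have ReE : complex.Re (CI nu (@disc R) (fun p => toC p ^+ m * conjc (toC p) ^+ n)) =
   fine ((\int[radial]_t (rho t ^+ (m + n))%:E) * (\int[angular]_x (cos (k * x))%:E))%E.
  rewrite /CI /= push; [|by case: mz|by move=> x; exact: le_trans (Re_le_cabs _) (z1 x)].
  rewrite -prod // /Rintegral; congr fine; apply: eq_integral => x _.
  by rewrite polar_monomial ReM /= mul0r subr0.
have ImE : complex.Im (CI nu (@disc R) (fun p => toC p ^+ m * conjc (toC p) ^+ n)) =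
   fine ((\int[radial]_t (rho t ^+ (m + n))%:E) * (\int[angular]_x (sin (k * x))%:E))%E.
  rewrite /CI /= push; [|by case: mz|by move=> x; exact: le_trans (Im_le_cabs _) (z1 x)].
  rewrite -prod // /Rintegral; congr fine; apply: eq_integral => x _.
  by rewrite polar_monomial ImM /= mul0r addr0.
apply: eq_Re_Im; rewrite ?ReE ?ImE.
  case: eqVneq => [mn|mn]; last by rewrite angular_cos // mule0.
  subst n; rewrite radial_moment.
  under eq_integral do rewrite /k subrr mul0r cos0.
  have -> : (\int[angular]__ (1 : R)%:E = 1)%E.
    by rewrite integral_cst // mul1e; exact: probability_setT.
  by rewrite mule1.
rewrite angular_sin mule0; by case: eqVneq.
Qed.

End PolarMeasure.

(** * Fatou and Cauchy-Schwarz for real integrals *)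

Section FatouCauchySchwarz.
Context d (T : measurableType d) (R : realType).
Variables (mu : {measure set T -> \bar R}) (D : set T).
Hypothesis mD : measurable D.

(** Integrability of the limit is part of the conclusion; this is how both the density and its
    dominating function are seen to be in L^1. *)
Lemma fatou_real (F : nat -> T -> R) (f : T -> R) (C : R) :
  (forall n, measurable_fun D (F n)) -> (forall n x, D x -> 0 <= F n x) ->
  (forall x, D x -> F n x @[n --> \oo] --> f x) ->
  (forall n, (\int[mu]_(x in D) (F n x)%:E <= C%:E)%E) ->
  mu.-integrable D (EFin \o f) /\ \int[mu]_(x in D) f x <= C.
Proof.
move=> mF F0 Ff FC; have mf : measurable_fun D f.
  exact: (measurable_fun_cvg (h := F)).
have f0 x : D x -> 0 <= f x.
  move=> Dx; rewrite -(cvg_lim (@Rhausdorff R) (Ff x Dx)); apply: limr_ge.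
    exact: cvgP (Ff x Dx).
  by apply: nearW => n; exact: F0.
have le : (\int[mu]_(x in D) (f x)%:E <= C%:E)%E.
  have mF' n : measurable_fun D (fun x => (F n x)%:E) by apply/measurable_EFinP.
  have F0' n x : D x -> (0 <= (F n x)%:E)%E by move=> Dx; rewrite lee_fin F0.
  have := fatou mu mD mF' F0'.
  have -> : (\int[mu]_(x in D) limn_einf (fun n => (F n x)%:E) = \int[mu]_(x in D) (f x)%:E)%E.
    apply: eq_integral => x; rewrite inE => Dx.
    have h : (F n x)%:E @[n --> \oo] --> (f x)%:E by apply: cvg_EFin; [exact: nearW|exact: Ff].
    by rewrite is_cvg_limn_einfE; [exact: cvg_lim h|exact: cvgP h].
  move=> /le_trans; apply; rewrite limn_einf_lim; apply: lime_le.
    exact: is_cvg_einfs.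
  apply: nearW => n; apply: le_trans (FC n); apply: ereal_inf_lbound.
  by exists n => /=.
have i : mu.-integrable D (EFin \o f).
  apply/integrableP; split; first exact/measurable_EFinP.
  rewrite (eq_integral (fun x => (f x)%:E)); first exact: le_lt_trans le (ltry _).
  by move=> x; rewrite inE => Dx /=; rewrite ger0_norm ?f0.
by split=> //; rewrite -lee_fin /Rintegral fineK // integrable_fin_num.
Qed.

(** Integrate f g <= b/(2a) f^2 + a/(2b) g^2 for positive a >= al, b >= be. As [al] or [be] may
    vanish, they are approached from above. *)
Lemma integral_cauchy_schwarz (f g : T -> R) (al be : R) :
  measurable_fun D f -> measurable_fun D g ->
  mu.-integrable D (EFin \o (fun x => f x ^+ 2)) ->
  mu.-integrable D (EFin \o (fun x => g x ^+ 2)) ->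
  mu.-integrable D (EFin \o (fun x => f x * g x)) ->
  0 <= al -> 0 <= be ->
  \int[mu]_(x in D) f x ^+ 2 <= al ^+ 2 -> \int[mu]_(x in D) g x ^+ 2 <= be ^+ 2 ->
  \int[mu]_(x in D) (f x * g x) <= al * be.
Proof.
move=> mf mg If ig ifg al0 be0 fa gb.
have pos (a b : R) : 0 < a -> 0 < b -> al <= a -> be <= b ->
    \int[mu]_(x in D) (f x * g x) <= a * b.
  move=> a0 b0 ala beb.
  have iZ (r : R) (k : T -> R) : mu.-integrable D (EFin \o k) ->
      mu.-integrable D (EFin \o (fun x => r * k x)).
    by move=> ik; have := integrableZl mD r ik; under eq_fun do rewrite -EFinM.
  apply: (@le_trans _ _ (\int[mu]_(x in D) (b / (2 * a) * f x ^+ 2 + a / (2 * b) * g x ^+ 2))).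
    apply: le_Rintegral => //.
      exact: integrableD (iZ _ _ If) (iZ _ _ ig).
    move=> x _; rewrite -subr_ge0.
    rewrite (_ : _ - _ = (b * f x - a * g x) ^+ 2 / (2 * a * b)); last first.
      by field; rewrite !gt_eqF.
    by rewrite divr_ge0 ?sqr_ge0 // !mulr_ge0 // ltW.
  rewrite RintegralD //; [|exact: iZ|exact: iZ].
  rewrite !RintegralZl // (_ : a * b = b / (2 * a) * a ^+ 2 + a / (2 * b) * b ^+ 2); last first.
    by field; rewrite !gt_eqF.
  have H (u v : R) : 0 <= u -> u <= v -> u ^+ 2 <= v ^+ 2 by move=> *;
    rewrite lerXn2r ?nnegrE //; apply: le_trans; eauto.
  apply: lerD; apply: ler_wpM2l.
  - by rewrite divr_ge0 ?mulr_ge0 // ltW.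
  - by apply: le_trans fa _; exact: H.
  - by rewrite divr_ge0 ?mulr_ge0 // ltW.
  - by apply: le_trans gb _; exact: H.
apply/ler_addgt0Pr => e e0.
(* t <= 1 gives t^2 <= t, hence (al + t)(be + t) <= al be + t (al + be + 1) <= al be + e. *)
pose t := Num.min 1 (e / (al + be + 1)).
have ab1 : 0 < al + be + 1 by lra.
have t0 : 0 < t by rewrite lt_min ltr01 divr_gt0.
have t1 : t <= 1 by rewrite ge_min lexx.
have te : t * (al + be + 1) <= e by rewrite -ler_pdivlMr // ge_min lexx orbT.
apply: le_trans (pos (al + t) (be + t) _ _ _ _) _; try lra.
have : t * t <= t by rewrite ler_piMr // ltW.
move: te; rewrite !mulrDr !mulrDl mulr1; lra.
Qed.

End FatouCauchySchwarz.

(** * The density attached to a Hankel symbol *)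

Lemma wallis_le (R : realType) n : wallis R n <= n.+1%:R.
Proof.
elim: n => [|n IH]; first by rewrite wallis0.
rewrite wallisS; apply: (@le_trans _ _ (n.+1%:R * ((n.*2 + 3)%:R / (n.*2 + 2)%:R))).
  by rewrite ler_wpM2r // divr_ge0 ?ler0n.
rewrite mulrA ler_pdivrMr ?ltr0n ?addnS // -!natrM ler_nat; nia.
Qed.

Lemma geometric_derivative_le (R : realType) (t : R) M : 0 <= t -> t < 1 ->
  \sum_(0 <= i < M) i.+1%:R * t ^+ i <= ((1 - t) ^+ 2)^-1.
Proof.
move=> t0 t1; have d0 : 0 < (1 - t) ^+ 2 by rewrite exprn_gt0 // subr_gt0.
rewrite -[leRHS]mul1r ler_pdivlMr //.
have -> : (\sum_(0 <= i < M) i.+1%:R * t ^+ i) * (1 - t) ^+ 2 =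
    1 - t ^+ M * (M.+1%:R - M%:R * t).
  elim: M => [|M IH]; first by rewrite big_geq // mul0r expr0 mul0r subr0 mulr1 subrr.
  rewrite big_nat_recr //= mulrDl IH (exprSr t M).
  have m2 : M.+2%:R = M%:R + 2 :> R by rewrite -addn2 natrD.
  have m1 : M.+1%:R = M%:R + 1 :> R by rewrite -natr1.
  by rewrite m2 m1; move: (M%:R) (t ^+ M) => a b; ring.
rewrite gerBl mulr_ge0 ?exprn_ge0 // subr_ge0 -natr1.
apply: le_trans (_ : M%:R <= _); last by rewrite lerDl.
by rewrite ler_piMr ?ler0n // ltW.
Qed.

Section SymbolDensity.
Variable R : realType.
Variable nu : {measure set (R * R)%type -> \bar R}.
Notation D := (@disc R).
Hypothesis nuD : (nu D < +oo)%E.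
Hypothesis nu_moment : forall m n,
  CI nu D (fun p => toC p ^+ m * conjc (toC p) ^+ n) =
    if m == n then (n.+1%:R^-1)%:C else 0.

Let mD : measurable D := @measurable_disc R.
Notation z p := (toC p).
Notation zb p := (conjc (toC p)).
Notation r p := (cabs (toC p)).

Lemma disc_lt1 (p : R * R) : D p -> r p < 1.
Proof. by move=> Dp; rewrite /cabs -sqrtr1 ltr_sqrt. Qed.

Lemma disc_le1 (p : R * R) : D p -> r p <= 1.
Proof. by move=> /disc_lt1/ltW. Qed.

Lemma cmeas_toC : cmeas D (fun p : R * R => z p).
Proof.
by split; apply: measurable_funTS; [exact: measurable_fst|exact: measurable_snd].
Qed.

Lemma cmeas_toCb : cmeas D (fun p : R * R => zb p).
Proof. exact: cmeas_conj cmeas_toC. Qed.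

Lemma cintegrable_bounded (f : R * R -> R[i]) (C : R) : cmeas D f ->
  (forall p, D p -> cabs (f p) <= C) -> cintegrable nu D f.
Proof.
move=> mf fC; split=> //; apply: (@bounded_integrable_finite R _ _ nu D (fun p => cabs (f p))
  C) => //.
  exact: measurable_cabs.
by move=> p Dp; rewrite ger0_norm ?cabs_ge0 ?fC.
Qed.

Lemma cmeas_monomial m n : cmeas D (fun p => z p ^+ m * zb p ^+ n).
Proof. by apply: cmeasM; apply: cmeasX; [exact: cmeas_toC|exact: cmeas_toCb]. Qed.

Lemma cintegrable_monomial m n : cintegrable nu D (fun p => z p ^+ m * zb p ^+ n).
Proof.
apply: (@cintegrable_bounded _ 1); first exact: cmeas_monomial.
move=> p Dp; rewrite cabsM !cabsX cabs_conj -exprD exprn_ile1 ?cabs_ge0 //.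
exact: disc_le1.
Qed.

Definition wpoly (s : seq nat) (x : nat -> R[i]) p : R[i] :=
  \sum_(i <- s) (wallis R i)%:C * x i * zb p ^+ i.

Lemma cmeas_wpoly s x : cmeas D (wpoly s x).
Proof.
apply: cmeas_sum => i; apply: cmeasM; first exact: cmeas_cst.
exact: cmeasX cmeas_toCb.
Qed.

Lemma wpoly_bounded s x : exists C, forall p, D p -> cabs (wpoly s x p) <= C.
Proof.
exists (\sum_(i <- s) cabs ((wallis R i)%:C * x i)) => p Dp.
apply: le_trans (cabs_sum _ _) _; apply: ler_sum => i _.
rewrite [leLHS]cabsM cabsX cabs_conj ler_piMr ?cabs_ge0 // exprn_ile1 ?cabs_ge0 //.
exact: disc_le1.
Qed.

(** The monomials are orthogonal with squared norms 1/(i+1), so the integral is the sum of c_i^2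
    |x_i|^2 / (i+1), and Wallis' inequality bounds each weight. *)
Lemma wpoly_sqr_integral s x : uniq s ->
  \int[nu]_(p in D) cabs (wpoly s x p) ^+ 2 <= 4 / pi * \sum_(i <- s) cabs (x i) ^+ 2.
Proof.
move=> us.
have E : (\int[nu]_(p in D) cabs (wpoly s x p) ^+ 2)%:C =
    (\sum_(i <- s) wallis R i ^+ 2 * cabs (x i) ^+ 2 / i.+1%:R)%:C.
  rewrite -CI_real.
  transitivity (CI nu D (fun p => \sum_(i <- s) \sum_(j <- s)
     (conjc ((wallis R i)%:C * x i) * ((wallis R j)%:C * x j)) * (z p ^+ i * zb p ^+ j))).
    apply: eq_CI => // p _; rewrite -mul_conj conjc_sum big_distrlr.
    apply: eq_bigr => i _; apply: eq_bigr => j _.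
    transitivity (conjc ((wallis R i)%:C * x i * zb p ^+ i) *
      ((wallis R j)%:C * x j * zb p ^+ j)); first by [].
    by rewrite (conjcM _ (zb p ^+ i)) conjcX conjcK; ring.
  have cI i j : cintegrable nu D (fun p => conjc ((wallis R i)%:C * x i) *
      ((wallis R j)%:C * x j) * (z p ^+ i * zb p ^+ j)).
    exact: cintegrableZ (cintegrable_monomial i j).
  rewrite CI_sum //; last by move=> i; exact: cintegrable_sum.
  rewrite rmorph_sum /=; apply: eq_big_seq => i si; rewrite CI_sum //.
  transitivity (\sum_(j <- s) (i == j)%:R *
      (conjc ((wallis R i)%:C * x i) * ((wallis R j)%:C * x j) * (j.+1%:R^-1)%:C)).
    apply: eq_bigr => j _; rewrite CIZ ?nu_moment //; last exact: cintegrable_monomial.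
    by case: eqP => _; rewrite ?mul1r ?mul0r ?mulr0.
  rewrite sum_eqr // mul_conj -rmorphM /= cabsM cabs_real ger0_norm ?wallis_ge0 //.
  by rewrite exprMn.
have -> : \int[nu]_(p in D) cabs (wpoly s x p) ^+ 2 =
   \sum_(i <- s) wallis R i ^+ 2 * cabs (x i) ^+ 2 / i.+1%:R by exact: complexI E.
rewrite mulr_sumr; apply: ler_sum => i _.
rewrite mulrAC ler_wpM2r ?sqr_ge0 // ler_pdivrMr ?ltr0n // mulrAC.
by rewrite ler_pdivlMr ?pi_gt0 // wallis_sqr_le.
Qed.

Definition test_matrix (th : R * R -> R[i]) i j : R[i] :=
  (pi / 8)%:C * CI nu D (fun p => th p * ((2 * wallis R i * wallis R j)%:C * zb p ^+ (i + j))).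

Lemma cintegrable_test_matrix th i j : cmeas D th -> (forall p, cabs (th p) <= 1) ->
  cintegrable nu D (fun p => th p * ((2 * wallis R i * wallis R j)%:C * zb p ^+ (i + j))).
Proof.
move=> mth th1; apply: (@cintegrable_bounded _ (2 * wallis R i * wallis R j)).
  apply: cmeasM => //; apply: cmeasM; first exact: cmeas_cst.
  exact: cmeasX cmeas_toCb.
move=> p Dp; rewrite !cabsM cabs_real ger0_norm ?mulr_ge0 ?wallis_ge0 //.
rewrite cabsX cabs_conj.
have w0 : 0 <= 2 * wallis R i * wallis R j by rewrite !mulr_ge0 ?wallis_ge0.
have r1 : r p ^+ (i + j) <= 1 by rewrite exprn_ile1 ?cabs_ge0 // disc_le1.
have r0 : 0 <= r p ^+ (i + j) by rewrite exprn_ge0 // cabs_ge0.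
rewrite -[leRHS]mul1r; apply: ler_pM; [exact: cabs_ge0|exact: mulr_ge0|exact: th1|].
by rewrite ler_piMr.
Qed.

(** The form factors as pi/4 times the integral of theta P Q, with P and Q the weighted polynomials
    of conj u and v. Cauchy-Schwarz and the bound 4/pi for their squared norms cancel the
    prefactor. *)
Lemma test_matrix_bounded th : cmeas D th -> (forall p, cabs (th p) <= 1) ->
  mx_bounded_by (test_matrix th) 1.
Proof.
move=> mth th1; split=> // s u v /NoDup_uniq us; rewrite mul1r.
rewrite -/(nrm s u) -/(nrm s v).
pose ub i := conjc (u i).
have -> : \sum_(i <- s) \sum_(j <- s) conjc (u i) * test_matrix th i j * v j =
    (pi / 4)%:C * CI nu D (fun p => th p * (wpoly s ub p * wpoly s v p)).
  transitivity ((pi / 4)%:C * CI nu D (fun p => \sum_(i <- s) \sum_(j <- s)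
      (ub i * v j / 2) * (th p * ((2 * wallis R i * wallis R j)%:C * zb p ^+ (i + j))))).
    rewrite CI_sum //; last first.
      by move=> i; apply: cintegrable_sum => // j; apply: cintegrableZ => //;
        exact: cintegrable_test_matrix.
    rewrite mulr_sumr; apply: eq_bigr => i _; rewrite CI_sum //; last first.
      by move=> j; apply: cintegrableZ => //; exact: cintegrable_test_matrix.
    rewrite mulr_sumr; apply: eq_bigr => j _; rewrite CIZ //;
      last exact: cintegrable_test_matrix.
    rewrite /test_matrix (_ : (pi / 4)%:C = (pi / 8)%:C * 2 :> R[i]).
      by rewrite -/(ub i); field.
    by rewrite -(rmorph_nat (real_complex R)) -rmorphM /=; congr (_%:C); field.
  congr (_ * _); apply: eq_CI => // p _; rewrite /wpoly big_distrlr mulr_sumr /=.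
  apply: eq_bigr => i _; rewrite mulr_sumr; apply: eq_bigr => j _.
  by rewrite !rmorphM /= rmorph_nat exprD; field.
rewrite cabsM cabs_real ger0_norm ?divr_ge0 ?pi_ge0 //.
have [C1 b1] := wpoly_bounded s ub; have [C2 b2] := wpoly_bounded s v.
have bb (f g : R * R -> R[i]) (a b : R) : cmeas D f -> cmeas D g ->
    (forall p, D p -> cabs (f p) <= a) -> (forall p, D p -> cabs (g p) <= b) ->
    nu.-integrable D (EFin \o (fun p => cabs (f p) * cabs (g p))).
  move=> mf mg fa gb; have [_] : cintegrable nu D (fun p => f p * g p).
    apply: (@cintegrable_bounded _ (a * b)); first exact: cmeasM.
    by move=> p Dp; rewrite cabsM ler_pM ?cabs_ge0 ?fa ?gb.
  by under eq_fun do rewrite cabsM.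
have mu' := cmeas_wpoly s ub; have mv := cmeas_wpoly s v.
have up : cabs (CI nu D (fun p => th p * (wpoly s ub p * wpoly s v p))) <=
    \int[nu]_(p in D) (cabs (wpoly s ub p) * cabs (wpoly s v p)).
  apply: le_trans (cabs_CI_le _ _) _ => //.
    apply: (@cintegrable_le _ _ _ _ _ _ _ (fun p => cabs (wpoly s ub p) * cabs (wpoly s v p)))
      => //.
    - by apply: cmeasM => //; exact: cmeasM.
    - by move=> p _; rewrite !cabsM ler_piMl ?mulr_ge0 ?cabs_ge0.
    - exact: (bb _ _ _ _ mu' mv b1 b2).
  apply: le_Rintegral => //.
  - have [_] : cintegrable nu D (fun p => th p * (wpoly s ub p * wpoly s v p)).
      apply: (@cintegrable_le _ _ _ _ _ _ _ (fun p => cabs (wpoly s ub p) * cabs (wpoly s v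
        p))) => //.
      + by apply: cmeasM => //; exact: cmeasM.
      + by move=> p _; rewrite !cabsM ler_piMl ?mulr_ge0 ?cabs_ge0.
      + exact: (bb _ _ _ _ mu' mv b1 b2).
    by [].
  - exact: (bb _ _ _ _ mu' mv b1 b2).
  - by move=> p _; rewrite !cabsM ler_piMl ?mulr_ge0 ?cabs_ge0.
have nub : nrm s ub = nrm s u.
  by rewrite /nrm; congr Num.sqrt; apply: eq_bigr => i _; rewrite cabs_conj.
have pi0 : 0 < pi :> R := pi_gt0 R.
have s4 : Num.sqrt (4 / pi) ^+ 2 = 4 / pi :> R by rewrite sqr_sqrtr ?divr_ge0 ?pi_ge0.
have cs : \int[nu]_(p in D) (cabs (wpoly s ub p) * cabs (wpoly s v p)) <=
    (Num.sqrt (4 / pi) * nrm s u) * (Num.sqrt (4 / pi) * nrm s v).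
  apply: integral_cauchy_schwarz => //.
  - exact: measurable_cabs.
  - exact: measurable_cabs.
  - by under eq_fun do rewrite expr2; exact: (bb _ _ _ _ mu' mu' b1 b1).
  - by under eq_fun do rewrite expr2; exact: (bb _ _ _ _ mv mv b2 b2).
  - exact: (bb _ _ _ _ mu' mv b1 b2).
  - by rewrite mulr_ge0 ?sqrtr_ge0 // nrm_ge0.
  - by rewrite mulr_ge0 ?sqrtr_ge0 // nrm_ge0.
  - by rewrite exprMn s4 -nub sqr_nrm; exact: wpoly_sqr_integral.
  - by rewrite exprMn s4 sqr_nrm; exact: wpoly_sqr_integral.
apply: le_trans (ler_wpM2l _ (le_trans up cs)) _; first by rewrite divr_ge0 ?pi_ge0.
rewrite [X in _ * X]mulrACA -[Num.sqrt _ * _]expr2 s4 [leLHS]mulrA (_ : pi / 4 * (4 / pi) =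
  1) ?mul1r //.
by rewrite mulrA divfK ?divff ?pnatr_eq0 // gt_eqF.
Qed.

Variables (h : nat -> R[i]) (N C : R).
Hypothesis hB : forall M B, mx_bounded_by B 1 ->
  cabs (\sum_(0 <= i < M) \sum_(0 <= j < M) B i j * h (i + j)%N) <= N.
Hypothesis hC : forall n, \sum_(0 <= k < n) cabs (h k) <= C.

(* As M grows this tends to the sum over n of (n + 1)(n + 2) h_n zb^n. Summing
   over a square, and splitting (n + 1)(n + 2) symmetrically by [wallis_conv], makes
   its pairing with a test function a Hankel functional of h. *)
Definition density_sum M p : R[i] := \sum_(0 <= i < M) \sum_(0 <= j < M)
  h (i + j)%N * ((2 * wallis R i * wallis R j)%:C * zb p ^+ (i + j)).

Lemma cmeas_density_sum M : cmeas D (density_sum M).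
Proof.
apply: cmeas_sum => i; apply: cmeas_sum => j; apply: cmeasM; first exact: cmeas_cst.
by apply: cmeasM; [exact: cmeas_cst|exact: cmeasX cmeas_toCb].
Qed.

Lemma cmeas_phase (f : R * R -> R[i]) : cmeas D f -> cmeas D (fun p => phase (f p)).
Proof.
move=> mf; apply: cmeasM; last exact: cmeas_conj.
have : cmeas D (fun p => ((cabs (f p))%:C)^-1).
  by apply: cmeas_inv => //; apply: cmeas_real; exact: measurable_cabs.
by under eq_fun do rewrite -fmorphV.
Qed.

(** The moduli of the terms of [density_sum]: increasing in M, with increments dominating those of
    the sum. *)
Definition majorant M p : R := \sum_(0 <= i < M) \sum_(0 <= j < M)
  cabs (h (i + j)%N) * (2 * wallis R i * wallis R j * r p ^+ (i + j)).

Lemma square_step (V : nmodType) (F : nat -> nat -> V) M :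
  \sum_(0 <= i < M.+1) \sum_(0 <= j < M.+1) F i j =
  \sum_(0 <= i < M) \sum_(0 <= j < M) F i j +
  (\sum_(0 <= i < M) F i M + \sum_(0 <= j < M.+1) F M j).
Proof.
rewrite big_nat_recr //= addrA; congr (_ + _); rewrite -big_split /=.
by apply: eq_bigr => i _; rewrite big_nat_recr.
Qed.

Lemma majorant_term_ge0 p i j : 0 <= cabs (h (i +
  j)%N) * (2 * wallis R i * wallis R j * r p ^+ (i + j)).
Proof. by rewrite !mulr_ge0 ?cabs_ge0 ?wallis_ge0 ?exprn_ge0 ?cabs_ge0. Qed.

Lemma density_sum_term p i j : cabs (h (i +
  j)%N * ((2 * wallis R i * wallis R j)%:C * zb p ^+ (i + j)))
  = cabs (h (i + j)%N) * (2 * wallis R i * wallis R j * r p ^+ (i + j)).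
Proof.
by rewrite !cabsM cabsX cabs_conj cabs_real ger0_norm // !mulr_ge0 ?wallis_ge0.
Qed.

Lemma density_sum_step p M : cabs (density_sum M.+1 p - density_sum M p) <= majorant M.+1 p -
  majorant M p.
Proof.
rewrite /density_sum /majorant !square_step ![_ + _ - _]addrAC !subrr !add0r.
apply: le_trans (cabsD _ _) _; apply: lerD; apply: le_trans (cabs_sum _ _) _;
  by apply: ler_sum => i _; rewrite density_sum_term.
Qed.

Lemma majorant_ge0 p M : 0 <= majorant M p.
Proof. by apply: sumr_ge0 => i _; apply: sumr_ge0 => j _; exact: majorant_term_ge0. Qed.

Lemma majorant_step p M : majorant M p <= majorant M.+1 p.
Proof. by rewrite -subr_ge0; apply: le_trans (density_sum_step p M); exact: cabs_ge0. Qed.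

Lemma density_sum_le_majorant p M : cabs (density_sum M p) <= majorant M p.
Proof.
elim: M => [|M IH]; first by rewrite /density_sum /majorant !big_geq // cabs0.
rewrite -[density_sum M.+1 p](subrK (density_sum M p)); apply: le_trans (cabsD _ _) _.
by have := density_sum_step p M; lra.
Qed.

Lemma h_le n : cabs (h n) <= C.
Proof.
by apply: le_trans (hC n.+1); rewrite big_nat_recr //= lerDr sumr_ge0 // => *; exact: cabs_ge0.
Qed.

Lemma C_ge0 : 0 <= C.
Proof. exact: le_trans (cabs_ge0 _) (h_le 0). Qed.

(** With |h| <= C and c_i <= i + 1 the square sum is at most 2 C times the square of sum_i (i+1)
    r^i. *)
Lemma majorant_bounded p : D p -> exists K, forall M, majorant M p <= K.
Proof.
move=> Dp; pose S := ((1 - r p) ^+ 2)^-1.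
have r0 := cabs_ge0 (toC p); have r1 := disc_lt1 Dp.
exists (2 * C * (S * S)) => M.
apply: (@le_trans _ _ (\sum_(0 <= i < M) \sum_(0 <= j < M)
  2 * C * ((i.+1%:R * r p ^+ i) * (j.+1%:R * r p ^+ j)))).
  apply: ler_sum => i _; apply: ler_sum => j _.
  rewrite [leRHS](_ : _ = C * (2 * i.+1%:R * j.+1%:R * r p ^+ (i + j)));
    last by rewrite exprD; ring.
  apply: ler_pM; rewrite ?cabs_ge0 ?h_le //.
    by rewrite !mulr_ge0 ?wallis_ge0 ?exprn_ge0.
  rewrite ler_wpM2r ?exprn_ge0 // -!mulrA ler_wpM2l //.
  by apply: ler_pM; rewrite ?wallis_ge0 ?wallis_le.
under eq_bigr do rewrite -mulr_sumr -mulr_sumr.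
rewrite -mulr_sumr -mulr_suml ler_wpM2l ?mulr_ge0 ?C_ge0 //.
have s0 : 0 <= \sum_(0 <= i < M) i.+1%:R * r p ^+ i.
  by apply: sumr_ge0 => i _; rewrite mulr_ge0 ?ler0n ?exprn_ge0.
by apply: ler_pM => //; exact: geometric_derivative_le.
Qed.

(** Pairing with its own phase realizes the L^1 norm, and this pairing is 8/pi times the Hankel
    functional of a contraction. *)
Lemma density_sum_integral_le M : \int[nu]_(p in D) cabs (density_sum M p) <= 8 / pi * N.
Proof.
pose th p := phase (density_sum M p).
have mth : cmeas D th by exact: cmeas_phase (cmeas_density_sum M).
have th1 p : cabs (th p) <= 1 by exact: cabs_phase.
have E : (\int[nu]_(p in D) cabs (density_sum M p))%:C = (8 / pi)%:C *
    \sum_(0 <= i < M) \sum_(0 <= j < M) test_matrix th i j * h (i + j)%N.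
  rewrite -CI_real; transitivity (CI nu D (fun p => \sum_(0 <= i < M) \sum_(0 <= j < M)
      h (i + j)%N * (th p * ((2 * wallis R i * wallis R j)%:C * zb p ^+ (i + j))))).
    apply: eq_CI => // p _; rewrite -phaseP -/(th p) mulr_sumr.
    apply: eq_bigr => i _; rewrite mulr_sumr; apply: eq_bigr => j _; ring.
  rewrite CI_sum //; last first.
    by move=> i; apply: cintegrable_sum => // j; apply: cintegrableZ => //;
      exact: cintegrable_test_matrix.
  rewrite mulr_sumr; apply: eq_bigr => i _; rewrite CI_sum //; last first.
    by move=> j; apply: cintegrableZ => //; exact: cintegrable_test_matrix.
  rewrite mulr_sumr; apply: eq_bigr => j _; rewrite CIZ //; last exact: cintegrable_test_matrix.
  have e : (8 / pi)%:C * (pi / 8)%:C = 1 :> R[i].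
    rewrite -rmorphM /= (_ : 8 / pi * (pi / 8) = 1) //.
    have pi0 : pi != 0 :> R := lt0r_neq0 (pi_gt0 R).
    by rewrite mulrA divfK ?divff ?pnatr_eq0.
  by rewrite /test_matrix; set I := CI _ _ _; rewrite mulrC -[LHS]mul1r -e; ring.
have I0 : 0 <= \int[nu]_(p in D) cabs (density_sum M p).
  by apply: Rintegral_ge0 => p _; exact: cabs_ge0.
rewrite -[leLHS]ger0_norm // -cabs_real E cabsM cabs_real ger0_norm ?divr_ge0 ?pi_ge0 //.
by rewrite ler_wpM2l ?divr_ge0 ?pi_ge0 // hB //; exact: test_matrix_bounded.
Qed.

End SymbolDensity.

(** * Convergence criteria and sums over antidiagonals *)

Lemma epsilon_cvg (R : realType) (u : nat -> R) (l : R) :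
  (forall e, 0 < e -> exists n0, forall n, (n0 <= n)%N -> `|u n - l| <= e) ->
  u n @[n --> \oo] --> l.
Proof.
move=> H; apply/cvgrPdist_le => e e0; have [n0 hn] := H e e0.
by exists n0 => // n /= n0n; rewrite distrC hn.
Qed.

Lemma cabs_dist (R : realType) (a b : R[i]) : `|cabs a - cabs b| <= cabs (a - b).
Proof.
have h (x y : R[i]) : cabs x - cabs y <= cabs (x - y).
  by rewrite lerBlDr -{1}[x](subrK y) cabsD.
rewrite ler_norml h andbT lerNl opprB; apply: le_trans (h _ _) _.
by rewrite -cabsN opprB.
Qed.

Lemma Rintegral_EFin d (T : measurableType d) (R : realType)
    (mu : {measure set T -> \bar R}) (D : set T) (f : T -> R) : measurable D ->
  mu.-integrable D (EFin \o f) ->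
  (\int[mu]_(x in D) (f x)%:E)%E = (\int[mu]_(x in D) f x)%:E.
Proof. by move=> mD If; rewrite /Rintegral fineK //; exact: (integrable_fin_num mD If). Qed.

Section Antidiagonals.
Variables (V : nmodType) (F : nat -> nat -> V).

Lemma antidiagonal_row i n M : \sum_(0 <= j < M) (if (i + j)%N == n then F i j else 0) =
  if (i <= n)%N && (n - i < M)%N then F i (n - i)%N else 0.
Proof.
rewrite -big_mkcond /=; case: (leqP i n) => ni /=.
  have E j : ((i + j)%N == n) = (j == n - i)%N by lia.
  under eq_bigl do rewrite E.
  by rewrite big_nat1_eq.
by apply: big_pred0 => j; lia.
Qed.

Lemma antidiagonal_sum n M : (n < M)%N ->
  \sum_(0 <= i < M) \sum_(0 <= j < M) (if (i + j)%N == n then F i j else 0) =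
  \sum_(0 <= i < n.+1) F i (n - i)%N.
Proof.
move=> nM; under eq_bigr do rewrite antidiagonal_row.
rewrite (big_cat_nat (n := n.+1)) //= [X in _ + X]big1_seq ?addr0; last first.
  by move=> i /=; rewrite mem_index_iota => /andP[ni _]; rewrite leqNgt ni.
apply: eq_big_nat => i /andP[_ iN]; rewrite -ltnS iN /= ifT //.
exact: leq_ltn_trans (leq_subr _ _) nM.
Qed.
End Antidiagonals.

(** The square of side M lies in the triangle i + j < 2 M. *)
Lemma square_le_antidiagonals (R : numDomainType) (F : nat -> nat -> R) M :
  (forall i j, 0 <= F i j) ->
  \sum_(0 <= i < M) \sum_(0 <= j < M) F i j <=
  \sum_(0 <= n < M + M) \sum_(0 <= i < n.+1) F i (n - i)%N.
Proof.
move=> F0; have widen (G : nat -> R) : (forall i, 0 <= G i) ->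
    \sum_(0 <= i < M) G i <= \sum_(0 <= i < M + M) G i.
  move=> G0; rewrite [leRHS](big_cat_nat (n := M)) ?leq_addr //=.
  by rewrite lerDl sumr_ge0.
have c0 i j n : 0 <= (if (i + j)%N == n then F i j else 0) by case: ifP.
apply: (@le_trans _ _ (\sum_(0 <= n < M + M) \sum_(0 <= i < M) \sum_(0 <= j < M)
    (if (i + j)%N == n then F i j else 0))); last first.
  rewrite big_nat [leRHS]big_nat; apply: ler_sum => n /andP[_ nM].
  rewrite -(antidiagonal_sum F nM); apply: le_trans (widen _ _).
    by apply: ler_sum => i _; exact: widen.
  by move=> i; exact: sumr_ge0.
rewrite le_eqVlt; apply/orP; left; apply/eqP; rewrite [RHS]exchange_big_nat //=.
rewrite big_nat [RHS]big_nat; apply: eq_bigr => i /andP[_ iM].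
rewrite [RHS]exchange_big_nat //= big_nat [RHS]big_nat; apply: eq_bigr => j /andP[_ jM].
rewrite -big_mkcond /=; under eq_bigl => n do rewrite eq_sym.
by rewrite big_nat1_eq /= ifT //; lia.
Qed.

(** * The limit density and its moments *)

Section Density.
Variable R : realType.
Variable nu : {measure set (R * R)%type -> \bar R}.
Notation D := (@disc R).
Hypothesis nuD : (nu D < +oo)%E.
Hypothesis nu_moment : forall m n,
  CI nu D (fun p => toC p ^+ m * conjc (toC p) ^+ n) =
    if m == n then (n.+1%:R^-1)%:C else 0.
Variables (h : nat -> R[i]) (N C : R).
Hypothesis hB : forall M B, mx_bounded_by B 1 ->
  cabs (\sum_(0 <= i < M) \sum_(0 <= j < M) B i j * h (i + j)%N) <= N.
Hypothesis hC : forall n, \sum_(0 <= k < n) cabs (h k) <= C.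

Let mD : measurable D := @measurable_disc R.
Notation z p := (toC p).
Notation zb p := (conjc (toC p)).
Notation r p := (cabs (toC p)).
Notation w p := (1 - cabs (toC p) ^+ 2).

Lemma w_ge0 p : D p -> 0 <= w p.
Proof. by move=> Dp; rewrite subr_ge0 exprn_ile1 ?cabs_ge0 // disc_le1. Qed.

Lemma w_le1 (p : R * R) : w p <= 1.
Proof. by rewrite gerBl sqr_ge0. Qed.

Lemma wE (p : R * R) : (w p)%:C = 1 - zb p * z p.
Proof. by rewrite mul_conj rmorphB rmorph1. Qed.

Lemma mul_conjX (p : R * R) m : z p ^+ m * zb p ^+ m = (r p ^+ m.*2)%:C.
Proof. by rewrite -exprMn (mulrC (z p)) mul_conj -rmorphXn -exprM mul2n. Qed.

Lemma density_sum_limit : exists g, forall p, D p -> forall e, 0 < e ->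
  exists n0, forall n, (n0 <= n)%N -> cabs (density_sum h n p - g p) <= e.
Proof.
have H p : exists L, D p -> forall e, 0 < e ->
    exists n0, forall n, (n0 <= n)%N -> cabs (density_sum h n p - L) <= e.
  have [Dp|nDp] := pselect (D p); last by exists 0.
  have [K HK] := majorant_bounded hC Dp.
  have [|L HL] := @summable_diff_cvg _ (fun n => density_sum h n p) K; last by exists L.
  move=> n; apply: le_trans (HK n); elim: n => [|n IH].
    by rewrite big_geq // majorant_ge0.
  by rewrite big_nat_recr //=; have := density_sum_step h p n; lra.
exists (fun p => sval (cid (H p))) => p Dp.
exact: (svalP (cid (H p)) Dp).
Qed.

Lemma cintegrable_density_sum M : cintegrable nu D (density_sum h M).
Proof.
apply: cintegrable_sum => // i; apply: cintegrable_sum => // j.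
apply: cintegrableZ => //.
have := @cintegrable_test_matrix R nu nuD (fun=> 1) i j (cmeas_cst _ _).
by under eq_fun do rewrite mul1r; apply => p; rewrite cabs1.
Qed.

Lemma cmeas_w : cmeas D (fun p : R * R => (w p)%:C).
Proof.
apply: cmeas_real; apply: measurable_funB; first exact: measurable_cst.
apply: measurable_funX; apply: measurable_cabs; exact: cmeas_toC.
Qed.

(** The weight subtracts consecutive moments, and 1/(n+1) - 1/(n+2) = 1/((n+1)(n+2)) is the inverse
    of the coefficient in the density. *)
Lemma weighted_moment n k : CI nu D (fun p => (w p)%:C * (z p ^+ n * zb p ^+ k)) =
  if k == n then ((n.+1%:R * n.+2%:R)^-1)%:C else 0.
Proof.
have cm := cintegrable_monomial nuD.
transitivity (CI nu D (fun p => z p ^+ n * zb p ^+ k + (-1) * (z p ^+ n.+1 * zb p ^+ k.+1))).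
  by apply: eq_CI => // p _; rewrite wE !exprS; ring.
rewrite CID //; last exact: cintegrableZ.
rewrite CIZ // !nu_moment eqSS eq_sym; case: eqP => [->|_]; last by rewrite mulr0 addr0.
rewrite mulN1r -rmorphB /=; congr (_%:C).
have : n.+1%:R != 0 :> R by rewrite pnatr_eq0.
have : n.+2%:R != 0 :> R by rewrite pnatr_eq0.
rewrite -[n.+2%:R]natr1; move: (n.+1%:R) => a a1 a0; field.
by rewrite a1 a0.
Qed.

Lemma cintegrable_weighted_monomial n k :
  cintegrable nu D (fun p => (w p)%:C * (z p ^+ n * zb p ^+ k)).
Proof.
apply: (@cintegrable_bounded _ _ nuD _ 1).
  by apply: cmeasM; [exact: cmeas_w|exact: cmeas_monomial].
move=> p Dp; rewrite !cabsM !cabsX cabs_conj cabs_real ger0_norm ?w_ge0 //.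
rewrite mulr_ile1 ?w_ge0 ?w_le1 ?mulr_ge0 ?exprn_ge0 ?cabs_ge0 //.
by rewrite -exprD exprn_ile1 ?cabs_ge0 // disc_le1.
Qed.

(** Orthogonality keeps the antidiagonal i + j = n, which lies wholly in the square when n < M;
    [wallis_conv] then makes its total weight 1. So each moment is eventually constant in M. *)
Lemma density_sum_moment M n : (n < M)%N ->
  CI nu D (fun p => z p ^+ n * (density_sum h M p * (w p)%:C)) = h n.
Proof.
move=> nM; transitivity (CI nu D (fun p => \sum_(0 <= i < M) \sum_(0 <= j < M)
    (h (i + j)%N * (2 * wallis R i * wallis R j)%:C) * ((w p)%:C * (z p ^+ n * zb p ^+ (i +
      j))))).
  apply: eq_CI => // p _; rewrite mulrC /density_sum -mulrA mulr_suml; apply: eq_bigr => i _.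
  by rewrite mulr_suml; apply: eq_bigr => j _; ring.
have ci a b := cintegrableZ mD a (cintegrable_weighted_monomial n b).
rewrite CI_sum //; last by move=> i; apply: cintegrable_sum => // j; exact: ci.
transitivity (\sum_(0 <= i < M) \sum_(0 <= j < M) if (i + j)%N == n then
   h (i + j)%N * (2 * wallis R i * wallis R j)%:C * ((n.+1%:R * n.+2%:R)^-1)%:C else 0).
  apply: eq_bigr => i _; rewrite CI_sum //.
  apply: eq_bigr => j _; rewrite CIZ // ?weighted_moment //;
    last exact: cintegrable_weighted_monomial.
  by case: eqP; rewrite ?mulr0.
rewrite antidiagonal_sum //.
transitivity (\sum_(0 <= i < n.+1) h n * (2 / (n.+1%:R * n.+2%:R))%:C * (wallis R i * wallis R
  (n - i))%:C).
  apply: eq_big_nat => i /andP[_ iN]; rewrite subnKC // !rmorphM /=; ring.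
rewrite -mulr_sumr -rmorph_sum /= wallis_conv -mulrA -rmorphM /=.
rewrite (_ : _ / _ * _ = 1 :> R) ?mulr1 //.
have : n.+1%:R != 0 :> R by rewrite pnatr_eq0.
have : n.+2%:R != 0 :> R by rewrite pnatr_eq0.
move: (n.+2%:R) (n.+1%:R) => b a b0 a0.
by field; rewrite b0 a0.
Qed.

(** The price of rounding the exponent of |z|^k down to an even number, where the weighted moment is
    known. *)
Lemma half_moment_le k : ((k./2.+1%:R * k./2.+2%:R)^-1 : R) <= 4 / (k.+1%:R * k.+2%:R).
Proof.
rewrite ler_pdivlMr ?mulr_gt0 ?ltr0n // mulrC ler_pdivrMr ?mulr_gt0 ?ltr0n //.
rewrite -!natrM ler_nat.
have := odd_double_half k; have : (odd k <= 1)%N by case: (odd k).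
move: (k./2) (odd k : nat) => m o o1 <-; nia.
Qed.

(** After rounding exponents down to even ones, each term is a known moment up to a factor 4.
    Summing c_i c_j over antidiagonals cancels 1/((n+1)(n+2)) and leaves 4 sum |h_n|, uniformly in
    M. *)
Lemma majorant_weighted_le M :
  (\int[nu]_(p in D) (majorant h M p * w p)%:E <= (4 * C)%:E)%E.
Proof.
pose a i j : R := cabs (h (i + j)%N) * (2 * wallis R i * wallis R j).
have a0 i j : 0 <= a i j by rewrite !mulr_ge0 ?cabs_ge0 ?wallis_ge0.
pose m i j := (i + j)./2.
pose B p : R[i] := \sum_(0 <= i < M) \sum_(0 <= j < M)
  (a i j)%:C * ((w p)%:C * (z p ^+ m i j * zb p ^+ m i j)).
pose b p : R := \sum_(0 <= i < M) \sum_(0 <= j < M) a i j * (w p * r p ^+ (m i j).*2).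
have Bb p : B p = (b p)%:C.
  rewrite rmorph_sum; apply: eq_bigr => i _; rewrite rmorph_sum; apply: eq_bigr => j _.
  by rewrite mul_conjX -!rmorphM.
have ci i j := cintegrableZ mD (a i j)%:C (cintegrable_weighted_monomial (m i j) (m i j)).
have cB : cintegrable nu D B.
  by apply: cintegrable_sum => // i; apply: cintegrable_sum => // j; exact: ci.
have b0 p : D p -> 0 <= b p.
  move=> Dp; apply: sumr_ge0 => i _; apply: sumr_ge0 => j _.
  apply: mulr_ge0; first exact: a0.
  by apply: mulr_ge0; [exact: w_ge0|apply: exprn_ge0; exact: cabs_ge0].
have Ib : nu.-integrable D (EFin \o b).
  case: cB => _; apply: eq_integrable => // p; rewrite inE => Dp /=.
  by rewrite Bb cabs_real ger0_norm ?b0.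
have mr : measurable_fun D (fun p : R * R => r p) by apply: measurable_cabs; exact: cmeas_toC.
have mw : measurable_fun D (fun p : R * R => w p).
  by apply: measurable_funB; [exact: measurable_cst|exact: measurable_funX].
apply: (@le_trans _ _ (\int[nu]_(p in D) (b p)%:E)%E).
  apply: ge0_le_integral => //.
  - by move=> p Dp; rewrite lee_fin mulr_ge0 ?w_ge0 // majorant_ge0.
  - apply/measurable_EFinP; apply: measurable_funM => //.
    apply: measurable_sum => i; apply: measurable_sum => j.
    apply: measurable_funM; first exact: measurable_cst.
    by apply: measurable_funM; [exact: measurable_cst|exact: measurable_funX].
  - exact: measurable_int Ib.
  - move=> p Dp; rewrite lee_fin mulr_suml; apply: ler_sum => i _.
    rewrite mulr_suml; apply: ler_sum => j _.
    rewrite [leLHS](_ : _ = a i j * (w p * r p ^+ (i + j))); last by rewrite /a; ring.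
    rewrite ler_wpM2l // ler_wpM2l ?w_ge0 //.
    apply: ler_wiXn2l; [exact: cabs_ge0|exact: disc_le1|].
    by rewrite /m -{2}(odd_double_half (i + j)) leq_addl.
rewrite Rintegral_EFin // lee_fin.
have -> : \int[nu]_(p in D) b p =
    \sum_(0 <= i < M) \sum_(0 <= j < M) a i j * ((m i j).+1%:R * (m i j).+2%:R)^-1.
  apply: complexI; rewrite -CI_real; under eq_CI => p _ do rewrite -Bb.
  rewrite CI_sum //; last by move=> i; apply: cintegrable_sum => // j; exact: ci.
  rewrite rmorph_sum; apply: eq_bigr => i _; rewrite rmorph_sum CI_sum //.
  apply: eq_bigr => j _; rewrite CIZ //; last exact: cintegrable_weighted_monomial.
  by rewrite weighted_moment eqxx [RHS]rmorphM.
apply: (@le_trans _ _ (\sum_(0 <= i < M) \sum_(0 <= j < M)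
   a i j * (4 / ((i + j).+1%:R * (i + j).+2%:R)))).
  by apply: ler_sum => i _; apply: ler_sum => j _; rewrite ler_wpM2l // half_moment_le.
apply: le_trans (square_le_antidiagonals _ _) _.
  by move=> i j; rewrite mulr_ge0 // divr_ge0 // mulr_ge0 ?ler0n.
apply: le_trans (ler_wpM2l _ (hC (M + M))) => //; rewrite mulr_sumr.
apply: ler_sum => n _; rewrite le_eqVlt; apply/orP; left; apply/eqP.
transitivity (\sum_(0 <= i < n.+1)
    cabs (h n) * (8 / (n.+1%:R * n.+2%:R)) * (wallis R i * wallis R (n - i))).
  by apply: eq_big_nat => i /andP[_ iN]; rewrite /a subnKC //; ring.
rewrite -mulr_sumr wallis_conv.
have : n.+1%:R != 0 :> R by rewrite pnatr_eq0.
have : n.+2%:R != 0 :> R by rewrite pnatr_eq0.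
move: (n.+2%:R) (n.+1%:R) => e f e0 f0.
by field; rewrite e0 f0.
Qed.

(** Fatou gives the L^1 bound. The moments pass to the limit by dominated convergence, with
    dominating function Q (1 - |z|^2), where [Q] is the limit of the majorants; the weight in the
    moments is what makes this integrable. *)
Lemma symbol_density : exists g,
  [/\ cintegrable nu D g, \int[nu]_(p in D) cabs (g p) <= 8 / pi * N &
      forall n, CI nu D (fun p => z p ^+ n * (g p * (w p)%:C)) = h n].
Proof.
have [g Hg] := density_sum_limit; exists g.
have gRe p : D p -> complex.Re (density_sum h n p) @[n --> \oo] --> complex.Re (g p).
  move=> Dp; apply: epsilon_cvg => e e0; have [n0 H] := Hg p Dp e e0.
  exists n0 => n /H; apply: le_trans; apply: le_trans (Re_le_cabs _).
  by rewrite raddfB.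
have gIm p : D p -> complex.Im (density_sum h n p) @[n --> \oo] --> complex.Im (g p).
  move=> Dp; apply: epsilon_cvg => e e0; have [n0 H] := Hg p Dp e e0.
  exists n0 => n /H; apply: le_trans; apply: le_trans (Im_le_cabs _).
  by rewrite raddfB.
have mg : cmeas D g by exact: cmeas_cvg (@cmeas_density_sum _ h) gRe gIm.
have [Ig bg] : nu.-integrable D (EFin \o (fun p => cabs (g p))) /\
    \int[nu]_(p in D) cabs (g p) <= 8 / pi * N.
  apply: (@fatou_real _ _ _ nu D mD (fun n p => cabs (density_sum h n p))).
  - by move=> n; apply: measurable_cabs; exact: cmeas_density_sum.
  - by move=> n p _; exact: cabs_ge0.
  - move=> p Dp; apply: epsilon_cvg => e e0; have [n0 H] := Hg p Dp e e0.
    by exists n0 => n /H; apply: le_trans; exact: cabs_dist.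
  - move=> n; rewrite Rintegral_EFin //; last by case: (cintegrable_density_sum n).
    by rewrite lee_fin; exact: (density_sum_integral_le nuD nu_moment hB).
split=> // n.
pose Q p : R := limn (fun M => majorant h M p).
have cQ p : D p -> cvgn (fun M => majorant h M p).
  move=> Dp; have [K HK] := majorant_bounded hC Dp; apply: nondecreasing_is_cvgn.
    by apply/nondecreasing_seqP => M; exact: majorant_step.
  by exists K => _ [M _ <-].
have QQ p M : D p -> majorant h M p <= Q p.
  move=> Dp; apply: nondecreasing_cvgn_le (cQ p Dp) M.
  by apply/nondecreasing_seqP => k; exact: majorant_step.
have mr : measurable_fun D (fun p : R * R => r p) by apply: measurable_cabs; exact: cmeas_toC.
have mw : measurable_fun D (fun p : R * R => w p).
  by apply: measurable_funB; [exact: measurable_cst|exact: measurable_funX].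
have [IQ _] : nu.-integrable D (EFin \o (fun p => Q p * w p)) /\
    \int[nu]_(p in D) (Q p * w p) <= 4 * C.
  apply: (@fatou_real _ _ _ nu D mD (fun M p => majorant h M p * w p)).
  - move=> M; apply: measurable_funM => //.
    apply: measurable_sum => i; apply: measurable_sum => j.
    apply: measurable_funM; first exact: measurable_cst.
    by apply: measurable_funM; [exact: measurable_cst|exact: measurable_funX].
  - by move=> M p Dp; rewrite mulr_ge0 ?w_ge0 // majorant_ge0.
  - by move=> p Dp; apply: cvgMr_tmp; exact: cQ.
  - exact: majorant_weighted_le.
pose F M p := z p ^+ n * (density_sum h M p * (w p)%:C).
pose f p := z p ^+ n * (g p * (w p)%:C).
have rn p : D p -> cabs (z p ^+ n) <= 1.
  by move=> Dp; rewrite cabsX exprn_ile1 ?cabs_ge0 // disc_le1.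
have le1 p (x : R[i]) : D p -> cabs (z p ^+ n * (x * (w p)%:C)) <= cabs x * w p.
  move=> Dp; rewrite !cabsM cabs_real (ger0_norm (w_ge0 Dp)).
  by rewrite ler_piMl ?rn // mulr_ge0 ?cabs_ge0 ?w_ge0.
have le2 M p : D p -> cabs (F M p - f p) <= cabs (density_sum h M p - g p).
  move=> Dp; rewrite /F /f -mulrBr -mulrBl; apply: le_trans (le1 _ _ Dp) _.
  by rewrite ler_piMr ?cabs_ge0 ?w_le1.
have [|p Dp|p Dp|M p Dp||_ cR cI] := @CI_dominated _ _ _ nu D mD F f (fun p => Q p * w p).
- move=> M; apply: cmeasM; first by apply: cmeasX; exact: cmeas_toC.
  by apply: cmeasM; [exact: cmeas_density_sum|exact: cmeas_w].
- apply: epsilon_cvg => e e0; have [n0 H] := Hg p Dp e e0.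
  exists n0 => M /H; apply: le_trans; apply: le_trans (le2 _ _ Dp).
  by rewrite -raddfB; exact: Re_le_cabs.
- apply: epsilon_cvg => e e0; have [n0 H] := Hg p Dp e e0.
  exists n0 => M /H; apply: le_trans; apply: le_trans (le2 _ _ Dp).
  by rewrite -raddfB; exact: Im_le_cabs.
- apply: le_trans (le1 _ _ Dp) _; rewrite ler_wpM2r ?w_ge0 //.
  exact: le_trans (density_sum_le_majorant _ _ _) (QQ _ _ Dp).
- exact: IQ.
apply: eq_Re_Im.
  apply: (@cvg_unique _ _ _ _ _ _ cR) => //; apply: cvg_near_cst.
  by exists n.+1 => // M nM; exact: (congr1 (@complex.Re R) (density_sum_moment nM)).
apply: (@cvg_unique _ _ _ _ _ _ cI) => //; apply: cvg_near_cst.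
by exists n.+1 => // M nM; exact: (congr1 (@complex.Im R) (density_sum_moment nM)).
Qed.

End Density.

(** * Upper and lower bounds for the Schur norm *)

Lemma disc_weightE (R : realType) (p : R * R) :
  disc_weight p = cabs (1 - toC p ^+ 2) / (1 - cabs (toC p) ^+ 2).
Proof. by rewrite /disc_weight sqr_cabs. Qed.

Lemma disc_gt0 (R : realType) (p : R * R) : @disc R p -> 0 < 1 - cabs (toC p) ^+ 2.
Proof. by move=> Dp; rewrite subr_gt0 expr_lt1 ?cabs_ge0 // disc_lt1. Qed.

Lemma disc_le_cabs (R : realType) (p : R * R) :
  1 - cabs (toC p) ^+ 2 <= cabs (1 - toC p ^+ 2).
Proof.
rewrite lerBlDr -cabsX -{1}(@cabs1 R) -{1}[1](subrK (toC p ^+ 2)); exact: cabsD.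
Qed.

Lemma disc_neq0 (R : realType) (p : R * R) : @disc R p -> 1 - toC p ^+ 2 != 0.
Proof.
move=> Dp; apply/eqP => E; have := disc_le_cabs p.
by rewrite E cabs0 leNgt disc_gt0.
Qed.

Lemma disc_weight_ge1 (R : realType) (p : R * R) : @disc R p -> 1 <= disc_weight p.
Proof.
by move=> Dp; rewrite disc_weightE ler_pdivlMr ?disc_gt0 // mul1r disc_le_cabs.
Qed.

Lemma cmeas_disc_weight (R : realType) : measurable_fun (@disc R) (@disc_weight R).
Proof.
have [m _] : cmeas (@disc R) (fun p => (cabs (1 - toC p ^+ 2))%:C * ((1 - cabs (toC p) ^+
  2)%:C)^-1).
  apply: cmeasM; last by apply: cmeas_inv; exact: cmeas_w.
  apply: cmeas_real; apply: measurable_cabs.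
  have : cmeas (@disc R) (fun p => 1 + (-1) * toC p ^+ 2).
    apply: cmeasD; first exact: cmeas_cst.
    by apply: cmeasM; [exact: cmeas_cst|apply: cmeasX; exact: cmeas_toC].
  by under eq_fun do rewrite mulN1r.
apply: eq_measurable_fun m => p _.
by rewrite -fmorphV -rmorphM disc_weightE.
Qed.

Lemma closed_superlist (X : eqType) (x0 : X) (p : X -> X) (depth : X -> nat) :
  (forall x, x != x0 -> depth x = (depth (p x)).+1) ->
  forall s : seq X, exists W, [/\ uniq W, {subset s <= W} &
    forall x, x \in W -> x != x0 -> p x \in W].
Proof.
move=> depth_p s; suff [W [sW pW]] : exists W : seq X, {subset s <= W} /\
    forall x, x \in W -> x != x0 -> p x \in W.
  exists (undup W); split; first exact: undup_uniq.
    by move=> x /sW; rewrite mem_undup.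
  by move=> x; rewrite !mem_undup; exact: pW.
have one x : exists W : seq X, x \in W /\ forall y, y \in W -> y != x0 -> p y \in W.
  have [n] := ubnP (depth x); elim: n x => // n IH x xn.
  have [->|nx] := eqVneq x x0.
    by exists [:: x0]; split; [rewrite inE|move=> y; rewrite inE => ->].
  have [|W [pxW WW]] := IH (p x); first by rewrite -ltnS -depth_p.
  exists (x :: W); split=> [|y]; rewrite ?mem_head // !inE => /orP[/eqP ->|yW] ny.
    by rewrite pxW orbT.
  by rewrite WW ?orbT.
elim: s => [|x s [W [sW WW]]]; first by exists [::].
have [V [xV VV]] := one x; exists (V ++ W); split=> y; rewrite ?mem_cat ?inE.
  by move=> /orP[/eqP ->|/sW ->]; rewrite ?xV ?orbT.
by move=> /orP[yV|yW] ny; rewrite ?(VV y yV ny) // (WW y yW ny) orbT.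
Qed.

(** * Bounds for kernels on the tree, above and below *)

Section Tree.
Variables (R : realType) (X : Type) (adj : X -> X -> Prop) (x0 : X) (d : X -> X -> nat).
Hypothesis tree_adj : is_tree adj.
Hypothesis distance_d : is_graph_distance adj d.

Lemma power_kernel_bound (z a b : R[i]) (C : R) (A : X -> X -> R[i]) M s u v :
  1 <= C -> a * b = 1 - z ^+ 2 ->
  cabs a ^+ 2 + cabs z ^+ 2 * C <= C -> cabs b ^+ 2 + cabs z ^+ 2 * C <= C ->
  mx_bounded_by A M -> List.NoDup s ->
  cabs (form (schur_mult (fun x y => z ^+ d x y) A) s u v) <=
    C * M * nrm s u * nrm s v.
Proof.
(* Classical equality makes the bare type of vertices an [eqType], as the Gram factorization
   requires. *)
move=> C1 ab aC bC AM us; pose Y : eqType := {classic X}.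
have [p parentP] := parent_exists tree_adj distance_d x0.
have depth_p (x : Y) : x != x0 :> Y -> d x0 x = (d x0 (p x)).+1.
  by move=> /eqP/parentP[].
have dist_p (x y : Y) : x != y -> (d x0 y <= d x0 x)%N -> d x y = (d (p x) y).+1.
  by move=> /eqP; exact: (dist_parent tree_adj distance_d parentP).
have [W [uW sW WW]] := closed_superlist depth_p (s : seq Y).
have Hs (x : Y) : List.In x s -> x \in W.
  by move=> xs; apply: sW; elim: (s : seq Y) xs => //= y t IH [->|/IH];
    rewrite inE ?eqxx // => ->; rewrite orbT.
have dxx := dist_xx distance_d; have dC := dist_sym tree_adj distance_d.
apply: (@gram_form_le R X Y _ A M C s W
  (fun x w => @xi R Y d x0 p z a x w) (fun x w => @xi R Y d x0 p z b x w)) => //.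
- exact: le_trans C1.
- move=> x y xs ys; rewrite (@xi_gram R Y d x0 p dxx dC depth_p dist_p z W uW WW) //.
    exact: Hs.
  exact: Hs.
- by move=> x xs; apply: (@xi_norm R Y d x0 p dxx dC depth_p z W uW WW) => //; exact: Hs.
- by move=> x xs; apply: (@xi_norm R Y d x0 p dxx dC depth_p z W uW WW) => //; exact: Hs.
Qed.

(** Taking b = |t|^(1/2) and a = t / b, for t = 1 - z^2, gives a b = t and |a|^2 = |b|^2 = |t| with
    a real square root only; the disc weight solves C = |t| + |z|^2 C. *)
Lemma disc_kernel_bound (q : R * R) (A : X -> X -> R[i]) M s u v :
  @disc R q -> mx_bounded_by A M -> List.NoDup s ->
  cabs (form (schur_mult (fun x y => toC q ^+ d x y) A) s u v) <=
    disc_weight q * M * nrm s u * nrm s v.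
Proof.
move=> Dq AM us; pose t := 1 - toC q ^+ 2; pose b : R[i] := (Num.sqrt (cabs t))%:C.
have t0 : 0 < cabs t by apply: cabs_gt0; exact: disc_neq0.
have b2 : cabs b ^+ 2 = cabs t.
  by rewrite cabs_real ger0_norm ?sqrtr_ge0 // sqr_sqrtr ?ltW.
have b0 : b != 0.
  by apply/eqP => E; move: t0; rewrite -b2 E cabs0 expr0n ltxx.
have key : cabs t + cabs (toC q) ^+ 2 * disc_weight q <= disc_weight q.
  rewrite -lerBrDr -{1}[disc_weight q]mul1r -mulrBl disc_weightE mulrC divfK //.
  by rewrite gt_eqF ?disc_gt0.
apply: (@power_kernel_bound _ (t / b) b) => //.
- exact: disc_weight_ge1.
- by rewrite divfK.
- rewrite cabsM cabsV exprMn exprVn b2 expr2 mulfK //.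
  by rewrite gt_eqF.
- by rewrite b2.
Qed.

(** For z = 1 and z = -1 one may take a = b = 0 and C = 1: each vector is then a power of z times
    the delta at the root. *)
Lemma sign_kernel_bound (z : R[i]) (A : X -> X -> R[i]) M s u v :
  z ^+ 2 = 1 -> mx_bounded_by A M -> List.NoDup s ->
  cabs (form (schur_mult (fun x y => z ^+ d x y) A) s u v) <= M * nrm s u * nrm s v.
Proof.
move=> z2 AM us; rewrite -[M]mul1r.
have z1 : cabs z ^+ 2 <= 1 by rewrite -cabsX z2 cabs1.
by apply: (@power_kernel_bound _ 0 0) => //;
  rewrite ?z2 ?mul0r ?subrr // cabs0 expr0n add0r mulr1.
Qed.

Lemma rep_norm_ge0 (cp cm : R[i]) nu h : 0 <= rep_norm cp cm nu h.
Proof.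
rewrite !addr_ge0 ?cabs_ge0 // fine_ge0 // integral_ge0 // => p Dp.
by rewrite lee_fin mulr_ge0 ?cabs_ge0 // (le_trans _ (disc_weight_ge1 Dp)).
Qed.

(** On finite test vectors the form is a finite sum and commutes with the integral. The bounds for z
    = 1, z = -1 and z in the disc then add up with weights |c_+|, |c_-| and |h|. *)
Lemma representation_bound (phi : nat -> R[i]) cp cm nu h :
  admissible_rep phi cp cm nu h ->
  forall A M, mx_bounded_by A M ->
    mx_bounded_by (schur_mult (fun x y => phi (d x y)) A) (rep_norm cp cm nu h * M).
Proof.
move=> [[mR mI Ih] wv rep] A M AM; have mD := @measurable_disc R.
have wh0 p : @disc R p -> 0 <= disc_weight p * cabs (h p).
  by move=> Dp; rewrite mulr_ge0 ?cabs_ge0 // (le_trans _ (disc_weight_ge1 Dp)).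
have Iwh : nu.-integrable (@disc R) (EFin \o (fun p => disc_weight p * cabs (h p))).
  apply/integrableP; split.
    apply/measurable_EFinP; apply: measurable_funM; first exact: cmeas_disc_weight.
    exact: measurable_cabs.
  rewrite (eq_integral (fun p => (disc_weight p * cabs (h p))%:E)) //.
  by move=> p; rewrite inE => Dp /=; rewrite ger0_norm ?wh0.
have M0 : 0 <= M by case: AM.
split; first by rewrite mulr_ge0 ?rep_norm_ge0.
move=> s u v us; rewrite -/(form _ s u v) -/(nrm s u) -/(nrm s v).
pose K z := form (schur_mult (fun x y => z ^+ d x y) A) s u v.
have ch n : cintegrable nu (@disc R) (fun p => toC p ^+ n * h p).
  apply: (@cintegrable_le _ _ _ _ _ _ _ (fun p => cabs (h p))) => //.
    by apply: cmeasM; [apply: cmeasX; exact: cmeas_toC|split].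
  move=> p Dp; rewrite cabsM cabsX ler_piMl ?cabs_ge0 // exprn_ile1 ?cabs_ge0 //.
  exact: disc_le1.
pose cf x y := conjc (u x) * A x y * v y.
have KE : form (schur_mult (fun x y => phi (d x y)) A) s u v =
    cp * K 1 + cm * K (-1) + CI nu (@disc R) (fun p => h p * K (toC p)).
  transitivity (cp * K 1 + cm * K (-1) + CI nu (@disc R)
      (fun p => \sum_(x <- s) \sum_(y <- s) cf x y * (toC p ^+ d x y * h p))).
    rewrite CI_sum //; last by move=> x; apply: cintegrable_sum => // y; exact: cintegrableZ.
    rewrite /K /form !mulr_sumr -!big_split /=; apply: eq_bigr => x _.
    rewrite CI_sum //; last by move=> y; exact: cintegrableZ.
    rewrite !mulr_sumr -!big_split /=; apply: eq_bigr => y _.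
    rewrite CIZ // /schur_mult rep /cf expr1n.
    rewrite -[cintegral nu h _]/(CI nu (@disc R) (fun p => toC p ^+ d x y * h p)).
    by move: (CI nu (@disc R) _) => I; ring.
  congr (_ + _); apply: eq_CI => // p _; rewrite mulr_sumr; apply: eq_bigr => x _.
  by rewrite mulr_sumr; apply: eq_bigr => y _; rewrite /cf /schur_mult; ring.
pose B := M * nrm s u * nrm s v.
have B0 : 0 <= B by rewrite !mulr_ge0 ?nrm_ge0.
have KB p : @disc R p -> cabs (h p * K (toC p)) <= disc_weight p * cabs (h p) * B.
  move=> Dp; rewrite cabsM mulrC [leRHS](_ : _ =
    (disc_weight p * M * nrm s u * nrm s v) * cabs (h p)).
    by rewrite ler_wpM2r ?cabs_ge0 // disc_kernel_bound.
  by rewrite /B; ring.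
have IB : nu.-integrable (@disc R) (EFin \o (fun p => disc_weight p * cabs (h p) * B)).
  by have := integrableZr mD B Iwh; under eq_fun do rewrite -EFinM.
have cK : cintegrable nu (@disc R) (fun p => h p * K (toC p)).
  apply: (@cintegrable_le _ _ _ _ _ _ _ (fun p => disc_weight p * cabs (h p) * B)) => //.
  apply: cmeasM; first by [].
  apply: cmeas_sum => x; apply: cmeas_sum => y.
  apply: cmeasM; last exact: cmeas_cst.
  apply: cmeasM; first exact: cmeas_cst.
  by apply: cmeasM; [apply: cmeasX; exact: cmeas_toC|exact: cmeas_cst].
have cIK : cabs (CI nu (@disc R) (fun p => h p * K (toC p))) <=
    fine (weighted_variation nu h) * B.
  apply: le_trans (cabs_CI_le _ cK) _ => //.
  apply: (@le_trans _ _ (\int[nu]_(p in @disc R) (disc_weight p * cabs (h p) * B))).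
    by apply: le_Rintegral => //; case: cK.
  by rewrite RintegralZr.
rewrite KE [leRHS](_ : _ = cabs cp * B + cabs cm * B + fine (weighted_variation nu h) * B);
  last first.
  by rewrite /rep_norm /B; ring.
apply: le_trans (cabsD _ _) _; apply: lerD => //.
apply: le_trans (cabsD _ _) _; rewrite !cabsM; apply: lerD.
  by rewrite ler_wpM2l ?cabs_ge0 // sign_kernel_bound // expr1n.
by rewrite ler_wpM2l ?cabs_ge0 // sign_kernel_bound // sqrrN expr1n.
Qed.

Lemma symbol_functional_bound (phi : nat -> R[i]) :
  (forall x, infinite_set [set y | adj x y]) ->
  is_schur_multiplier (fun x y => phi (d x y)) ->
  forall (T : nat -> nat -> R[i]) K, mx_bounded_by T 1 ->
    (forall i j : nat, (K <= i)%N || (K <= j)%N -> diagonal_diff T i j = 0) ->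
    cabs (\sum_(0 <= i < K) \sum_(0 <= j < K) diagonal_diff T i j * phi (i + j)%N) <=
      schur_norm (fun x y => phi (d x y)).
Proof.
move=> infinite_degree psiS T K; pose Y : eqType := {classic X}.
have [p parentP] := parent_exists tree_adj distance_d x0.
have [c cP] := children_exist tree_adj distance_d infinite_degree parentP.
have c_inj x : injective (c x) by case: (cP x).
have c_adj x a : adj x (c x a) by case: (cP x).
have c_depth x a : d x0 (c x a) = (d x0 x).+1 by case: (cP x).
have c_parent x a : p (c x a) = x by case: (cP x).
have dC := dist_sym tree_adj distance_d.
have childl x y a : (d x0 y <= d x0 x)%N -> d (c x a) y = (d x y).+1.
  move=> xy; rewrite (dist_parent tree_adj distance_d parentP) ?c_parent //.
    by move=> E; move: xy; rewrite -E c_depth ltnn.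
  by rewrite c_depth; exact: leqW.
have incl x y a : incomparable d x0 x y -> d (c x a) y =
  (d x y).+1 /\ incomparable d x0 (c x a) y.
  exact: (incomparable_child tree_adj distance_d parentP c_adj c_depth).
have incs := @incomparable_sym _ _ _ tree_adj distance_d x0.
apply: (@transfer R Y d x0 p c (incomparable d x0)) => //.
- exact: (dist_xx distance_d).
- by move=> x y b xy; rewrite dC childl // dC.
- move=> x y b /incs/incl - /(_ b)[e /incs i]; split=> //.
  by rewrite dC e dC.
- move=> x a b /eqP ab.
  apply: (incomparable_siblings tree_adj distance_d parentP c_adj c_parent c_depth).
  by move=> /c_inj.
- by move=> A A1; exact: schur_norm_bound.
Qed.

End Tree.

(** * Construction of the representing measure *)

Section Representation.
Variables (R : realType) (phi : nat -> R[i]) (N : R).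
Hypothesis phiN : forall (T : nat -> nat -> R[i]) K, mx_bounded_by T 1 ->
    (forall i j : nat, (K <= i)%N || (K <= j)%N -> diagonal_diff T i j = 0) ->
    cabs (\sum_(0 <= i < K) \sum_(0 <= j < K) diagonal_diff T i j * phi (i + j)%N) <= N.

Notation D := (@disc R).

Lemma disc_power_small (p : R * R) (c : R[i]) e : D p -> 0 < e ->
  exists n0, forall n, (n0 <= n)%N -> cabs (toC p ^+ n * c) <= e.
Proof.
move=> Dp e0; have : cabs (toC p) ^+ n * cabs c @[n --> \oo] --> 0 * cabs c.
  apply: cvgMr_tmp; apply: cvg_expr; by rewrite ger0_norm ?cabs_ge0 // disc_lt1.
rewrite mul0r => /cvgrPdist_le /(_ _ e0)[n0 _ H].
exists n0 => n /H; rewrite /= sub0r normrN cabsM cabsX ger0_norm //.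
by rewrite mulr_ge0 ?exprn_ge0 ?cabs_ge0.
Qed.

(** Powers of z tend to 0 at every point of the open disc and are dominated by 1. Hence the integral
    term does not affect the even and odd limits. *)
Lemma CI_power_small nu (h : R * R -> R[i]) e : cintegrable nu D h -> 0 < e ->
  exists n0, forall n, (n0 <= n)%N -> cabs (CI nu D (fun p => toC p ^+ n * h p)) <= e.
Proof.
move=> [mh Ih] e0; have mD := @measurable_disc R.
have [|p Dp|p Dp|n p Dp||_ cR cI] :=
  @CI_dominated _ _ _ nu D mD (fun n p => toC p ^+ n * h p) (fun=> 0) (fun p => cabs (h p)).
- by move=> n; apply: cmeasM => //; apply: cmeasX; exact: cmeas_toC.
- apply: epsilon_cvg => t t0; have [n0 H] := disc_power_small (h p) Dp t0.
  by exists n0 => n /H; apply: le_trans; rewrite subr0; exact: Re_le_cabs.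
- apply: epsilon_cvg => t t0; have [n0 H] := disc_power_small (h p) Dp t0.
  by exists n0 => n /H; apply: le_trans; rewrite subr0; exact: Im_le_cabs.
- rewrite cabsM cabsX ler_piMl ?cabs_ge0 // exprn_ile1 ?cabs_ge0 //.
  exact: disc_le1.
- by [].
have e2 : 0 < e / 2 by rewrite divr_gt0.
move: cR => /cvgrPdist_le /(_ _ e2)[n0 _ H0].
move: cI => /cvgrPdist_le /(_ _ e2)[n1 _ H1].
exists (maxn n0 n1) => n; rewrite geq_max => /andP[a b].
apply: le_trans (cabs_le_Re_Im _) _.
have Re0 : complex.Re (CI nu D (fun=> 0)) = 0 by rewrite CI0.
have Im0 : complex.Im (CI nu D (fun=> 0)) = 0 by rewrite CI0.
have := lerD (H0 n a) (H1 n b).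
by rewrite Re0 Im0 !sub0r !normrN (_ : e / 2 + e / 2 = e) //; field.
Qed.

Lemma representation_exists : exists cp cm nu h,
  admissible_rep phi cp cm nu h /\ rep_norm cp cm nu h <= 8 / pi * N.
Proof.
have [cp [cm lim]] := symbol_limits phiN; exists cp, cm.
have [nu [nuD nu_moment]] := polar_measure R; exists nu.
have mD := @measurable_disc R.
pose N' := N - cabs cp - cabs cm.
have hB M B : mx_bounded_by B 1 ->
    cabs (\sum_(0 <= i < M) \sum_(0 <= j < M) B i j * hankel_symbol phi (i + j)%N) <= N'.
  by move=> B1; have := hankel_functional phiN M lim B1; rewrite /N'; lra.
have [g [Ig gN gmom]] := symbol_density nuD nu_moment hB (hankel_summable phiN).
have [mg Jg] := Ig.
pose t (p : R * R) : R[i] := 1 - toC p ^+ 2.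
(* Division by 1 - z^2 undoes the second difference: (z^m - z^(m+2)) h = z^m g (1 - |z|^2). It also
   makes [disc_weight] times |h| equal to |g|. *)
pose h p := g p * (1 - cabs (toC p) ^+ 2)%:C / t p.
have t0 p : D p -> t p != 0 by exact: disc_neq0.
have ct0 p : D p -> cabs (t p) != 0 by move=> /t0/cabs_gt0/lt0r_neq0.
have whg p : D p -> disc_weight p * cabs (h p) = cabs (g p).
  move=> Dp; have w0 := disc_gt0 Dp.
  rewrite disc_weightE /h !cabsM cabsV cabs_real (ger0_norm (ltW w0)) -/(t p).
  by field; rewrite ct0 // gt_eqF.
have hg p : D p -> cabs (h p) <= cabs (g p).
  by move=> Dp; rewrite -whg // ler_peMl ?cabs_ge0 // disc_weight_ge1.
have mt : cmeas D t.
  have : cmeas D (fun p => 1 + (-1) * toC p ^+ 2).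
    apply: cmeasD; first exact: cmeas_cst.
    by apply: cmeasM; [exact: cmeas_cst|apply: cmeasX; exact: cmeas_toC].
  by under eq_fun do rewrite mulN1r.
have mh : cmeas D h.
  apply: cmeasM; last exact: cmeas_inv.
  by apply: cmeasM => //; exact: cmeas_w.
have Ih : cintegrable nu D h by exact: cintegrable_le mh hg Jg.
have wvE : weighted_variation nu h = (\int[nu]_(p in D) (cabs (g p))%:E)%E.
  by apply: eq_integral => p; rewrite inE => Dp; rewrite whg.
have Inh n : cintegrable nu D (fun p => toC p ^+ n * h p).
  apply: (@cintegrable_le _ _ _ _ _ _ _ (fun p => cabs (h p))) => //.
  - by apply: cmeasM => //; apply: cmeasX; exact: cmeas_toC.
  - move=> p Dp; rewrite cabsM cabsX ler_piMl ?cabs_ge0 // exprn_ile1 ?cabs_ge0 //.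
    exact: disc_le1.
  - by case: Ih.
exists h; split; last first.
  rewrite /rep_norm wvE -/(Rintegral _ _ _).
  (* The L^1 bound is (8/pi)(N - |c_+| - |c_-|); since 8/pi >= 1, adding |c_+| + |c_-| stays below
     (8/pi) N. *)
  have K1 : 1 <= 8 / pi :> R.
    rewrite ler_pdivlMr ?pi_gt0 // mul1r.
    by have := pihalf_lt2 R; lra.
  move: gN; rewrite /N'; have := cabs_ge0 cp; have := cabs_ge0 cm.
  move: (\int[nu]_(p in D) _) (8 / pi) K1 => I k k1 a b c.
  apply: le_trans (lerD (lexx _) c) _; nra.
split.
- by case: mh Ih => mR mI [_].
- by rewrite wvE Rintegral_EFin // ltry.
move=> n; rewrite -[cintegral nu h _]/(CI nu D (fun p => toC p ^+ n * h p)).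
(* The discrepancy is 2-periodic, as both sides have second differences h, and it tends to 0; hence
   it is 0. *)
pose dl n := phi n - (cp + cm * (-1) ^+ n + CI nu D (fun p => toC p ^+ n * h p)).
have dl2 m : dl m.+2 = dl m.
  have : CI nu D (fun p => toC p ^+ m * h p) + (-1) * CI nu D (fun p => toC p ^+ m.+2 * h p) =
    hankel_symbol phi m.
    rewrite -CIZ // -CID //; last exact: cintegrableZ.
    rewrite -gmom; apply: eq_CI => // p Dp.
    rewrite !exprS /h; have := t0 p Dp; rewrite /t expr2 => t0p.
    by field.
  rewrite /dl /hankel_symbol => E; apply/eqP; rewrite -subr_eq0; apply/eqP.
  rewrite !exprS; move: E.
  move: (CI nu D _) (CI nu D _) (phi m) (phi m.+2) => a b q r E.
  have -> : b = a + (q - r) by rewrite -E; ring.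
  by ring.
have dlk k m : dl (m + k.*2)%N = dl m.
  by elim: k => [|k IH]; rewrite ?addn0 // doubleS !addnS dl2.
suff small e : 0 < e -> cabs (dl n) <= e.
  apply/eqP; rewrite -subr_eq0 -/(dl n); apply/eqP; apply: cabs_eq0.
  apply/eqP; rewrite eq_le cabs_ge0 andbT.
  by apply/ler_addgt0Pr => e e0; rewrite add0r; exact: small.
move=> e0; have e2 : 0 < e / 2 by rewrite divr_gt0.
have [n0 H0] := lim _ e2; have [n1 H1] := CI_power_small Ih e2.
pose k := maxn n0 n1; rewrite -(dlk k); set m := (n + k.*2)%N.
have mk : (k.*2 <= m)%N by exact: leq_addl.
have small1 : cabs (phi m - (cp + cm * (-1) ^+ m)) <= e / 2.
  have n0m : (n0 <= m./2)%N.
    by have := leq_maxl n0 n1; rewrite -/k; move: mk => /half_leq; rewrite doubleK => a b;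
      exact: leq_trans b a.
  have sign_even j : (-1) ^+ (j + j) = 1 :> R[i] by rewrite exprD -expr2 sqrr_sign.
  have := odd_double_half m; rewrite -addnn; have := H0 _ n0m.
  move: (m./2) => j [He Ho]; case: (odd m) => /= <-.
    by rewrite add1n exprS sign_even mulr1 mulrN1.
  by rewrite add0n sign_even mulr1.
have small2 : cabs (CI nu D (fun p => toC p ^+ m * h p)) <= e / 2.
  apply: H1; apply: leq_trans mk; rewrite -addnn; apply: leq_trans (leq_maxr n0 n1) _.
  exact: leq_addl.
rewrite /dl opprD addrA; apply: le_trans (cabsD _ _) _; rewrite cabsN; lra.
Qed.

End Representation.

Theorem theorem3p2 (R : realType) (X : Type) (adj : X -> X -> Prop) (x0 : X)
    (d : X -> X -> nat) (phi : nat -> R[i]) :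
  homogeneous_tree_infinite_degree adj ->
  is_graph_distance adj d ->
  let psi := fun x y : X => phi (d x y) in
  [/\ (is_schur_multiplier psi <->
         exists (cp cm : R[i]) (nu : {measure set (R * R)%type -> \bar R})
                (h : R * R -> R[i]), admissible_rep phi cp cm nu h),
      (forall (cp cm : R[i]) (nu : {measure set (R * R)%type -> \bar R})
              (h : R * R -> R[i]),
         admissible_rep phi cp cm nu h -> schur_norm psi <= rep_norm cp cm nu h) &
      (is_schur_multiplier psi ->
         exists (cp cm : R[i]) (nu : {measure set (R * R)%type -> \bar R})
                (h : R * R -> R[i]),
           admissible_rep phi cp cm nu h /\
           rep_norm cp cm nu h <= 8 / pi * schur_norm psi)].
Proof.
move=> [tree infinite_degree] dist psi.
have bound cp cm nu h : admissible_rep phi cp cm nu h ->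
    is_schur_multiplier psi /\ schur_norm psi <= rep_norm cp cm nu h.
  move=> rep; apply: schur_norm_le; first exact: rep_norm_ge0.
  exact: (representation_bound x0 tree dist rep).
have repr : is_schur_multiplier psi -> exists cp cm nu h,
    admissible_rep phi cp cm nu h /\ rep_norm cp cm nu h <= 8 / pi * schur_norm psi.
  move=> psiS; apply: representation_exists => T K.
  exact: (symbol_functional_bound x0 tree dist infinite_degree psiS).
split=> //; last by move=> cp cm nu h /bound[].
split=> [/repr[cp [cm [nu [h [rep _]]]]]|[cp [cm [nu [h /bound[]]]]]] //.
by exists cp, cm, nu, h.
Qed.
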